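(* Let $n\ge 2$, let $m_1,\dots,m_n>0$ be real numbers, and let $\Omega=\{z\in\mathbb{C}^n : |z_1|^{2m_1}+\cdots+|z_n|^{2m_n}<1\}$ be the corresponding complex ellipsoid. Let $f\in A^2(\Omega)$. If the Hankel operator $H_{\overline{f}}$ is Hilbert-Schmidt on $A^2(\Omega)$, then $f$ is constant.
   Context: $L^2(\Omega)$ is the space of complex-valued functions on $\Omega$ that are square integrable with respect to Lebesgue measure $dV$, and $A^2(\Omega)$ (the Bergman space) is its closed subspace of square integrable holomorphic functions. The Bergman projection $P$ is the orthogonal projection from $L^2(\Omega)$ onto $A^2(\Omega)$. For $f\in A^2(\Omega)$, the Hankel operator with anti-holomorphic symbol $\overline{f}$ is the (possibly unbounded) densely defined operator from $A^2(\Omega)$ to $L^2(\Omega)$ given by $H_{\overline{f}}(g)=(I-P)(\overline{f}g)$, for those $g\in A^2(\Omega)$ with $\overline{f}g\in L^2(\Omega)$ (this includes all polynomials, since $\Omega$ is bounded). A bounded linear operator $T$ on a Hilbert space $H$ (here with values in a Hilbert space) is Hilbert-Schmidt if there is an orthonormal basis $\{\xi_j\}$ of $H$ such that $\sum_j\|T(\xi_j)\|^2<\infty$; saying that $H_{\overline{f}}$ is Hilbert-Schmidt on $A^2(\Omega)$ means that it extends to a bounded operator $A^2(\Omega)\to L^2(\Omega)$ with this property. *)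

(* Defs.v *)
From HB Require Import structures.
From mathcomp Require Import all_boot all_order all_algebra.
From mathcomp Require Import complex.
From mathcomp Require Import all_classical all_reals all_analysis.

Set Implicit Arguments.
Unset Strict Implicit.
Unset Printing Implicit Defensive.

Import Order.TTheory GRing.Theory Num.Theory.
Import numFieldNormedType.Exports.

Local Open Scope classical_set_scope.
Local Open Scope ring_scope.

Section sigma_finite_product.
Context d1 d2 (T1 : measurableType d1) (T2 : measurableType d2) (R : realType).
Variable mu : {sigma_finite_measure set T1 -> \bar R}.
Variable nu : {sigma_finite_measure set T2 -> \bar R}.

Lemma sigma_finite_product : sigma_finite setT (mu \x nu)%E.
Proof.
have /sigma_finiteP[F [TF ndF Foo]] := sigma_finiteT mu.
have /sigma_finiteP[G [TG ndG Goo]] := sigma_finiteT nu.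
exists (fun n => F n `*` G n).
  rewrite -setXTT TF TG predeqE => -[x y]; split.
    move=> [/= [n _ Fnx] [k _ Gky]]; exists (maxn n k) => //; split.
    - by move: x Fnx; exact/subsetPset/ndF/leq_maxl.
    - by move: y Gky; exact/subsetPset/ndG/leq_maxr.
  by move=> [n _ []/= ? ?]; split; exists n.
move=> k; have [? ?] := Foo k; have [? ?] := Goo k.
split; first exact: measurableX.
by rewrite product_measure1E// lte_mul_pinfty// ge0_fin_numE.
Qed.

End sigma_finite_product.

(* The library has no product measure on tuples: it is built here one factor at
   a time; [power_measure_box] characterizes it. *)
Section power_measure.
Context d (T : measurableType d) (R : realType).
Variable mu : {sigma_finite_measure set T -> \bar R}.

Definition tcons n (p : T * n.-tuple T) : n.+1.-tuple T :=
  [tuple of p.1 :: p.2].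

Definition tuncons n (t : n.+1.-tuple T) : T * n.-tuple T :=
  (thead t, [tuple of behead t]).

Lemma tconsK n : cancel (@tcons n) (@tuncons n).
Proof. by case=> x t; congr (_, _); exact/val_inj. Qed.

Lemma tunconsK n : cancel (@tuncons n) (@tcons n).
Proof. by move=> t; rewrite [RHS]tuple_eta; exact/val_inj. Qed.

Lemma measurable_tcons n : measurable_fun [set: T * n.-tuple T] (@tcons n).
Proof. exact: measurable_cons. Qed.

Lemma measurable_tuncons n : measurable_fun [set: n.+1.-tuple T] (@tuncons n).
Proof.
by apply: measurable_fun_pair; [exact: measurable_tnth|exact: measurable_behead].
Qed.

Definition cons_measure n (nu : {sigma_finite_measure set (n.-tuple T) -> \bar R})
    : set (n.+1.-tuple T) -> \bar R :=
  pushforward (mu \x nu)%E (@tcons n).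

Section cons_measure.
Variables (n : nat) (nu : {sigma_finite_measure set (n.-tuple T) -> \bar R}).

HB.instance Definition _ := Measure.copy (cons_measure nu)
  (measure_function_pushforward__canonical__measure_function_Measure
    (mu \x nu)%E (@measurable_tcons n)).

Let cons_measure_sigma_finite : sigma_finite setT (cons_measure nu).
Proof.
have [F FT mF] := sigma_finite_product mu nu.
exists (fun k => @tuncons n @^-1` F k); first by rewrite -preimage_bigcup -FT.
move=> k; have [mFk Fkoo] := mF k; split.
  by rewrite -[X in measurable X]setTI; exact: measurable_tuncons.
rewrite /cons_measure /pushforward -comp_preimage.
by rewrite (_ : _ \o _ = id) //; apply/funext => x /=; rewrite tconsK.
Qed.

HB.instance Definition _ := Measure_isSigmaFinite.Build _ _ _ (cons_measure nu)
  cons_measure_sigma_finite.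

End cons_measure.

Fixpoint power_measure n : {sigma_finite_measure set (n.-tuple T) -> \bar R} :=
  if n is k.+1 then cons_measure (power_measure k) else dirac [tuple].

Lemma power_measure_box n (A : 'I_n -> set T) : (forall i, measurable (A i)) ->
  power_measure n [set t | forall i, A i (tnth t i)] = (\prod_i mu (A i))%E.
Proof.
elim: n A => [|n ih] A mA /=.
  rewrite big_ord0 (_ : mkset _ = setT) ?diracT//.
  by apply/seteqP; split => // t _ [].
rewrite /cons_measure /pushforward big_ord_recl -ih//.
rewrite -product_measure1E//; last first.
  rewrite (_ : mkset _ = \bigcap_(i in [set: 'I_n])
      ((@tnth n T)^~ i @^-1` A (lift ord0 i))); last first.
    by apply/seteqP; split => t /= At i => [_|]; exact: At.
  apply: fin_bigcap_measurable => // i _.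
  by rewrite -[X in measurable X]setTI; exact: measurable_tnth.
congr (_ _); apply/seteqP; split => [[x t] At|[x t] [Ax At]] /=.
  split => [|i] /=; first exact: (At ord0).
  by have := At (lift ord0 i); rewrite /= tnthS.
by move=> i; case: (unliftP ord0 i) => [j|] ->; rewrite ?tnthS//=; exact: At.
Qed.

End power_measure.

Section planar_lebesgue_measure.
Variable R : realType.

Definition lebesgue_measure2 :
    set (measurableTypeR R * measurableTypeR R) -> \bar R :=
  (@lebesgue_measure R \x @lebesgue_measure R)%E.

HB.instance Definition _ := Measure.on lebesgue_measure2.
HB.instance Definition _ := Measure_isSigmaFinite.Build _ _ _ lebesgue_measure2
  (sigma_finite_product (@lebesgue_measure R) (@lebesgue_measure R)).

End planar_lebesgue_measure.

(* [R[i]] as a normed space over itself, so that differentiability of maps on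
   ['rV[R[i]]_n] is complex differentiability. *)
HB.instance Definition _ (R : rcfType) := NormedModule.copy R[i] R[i]^o.

Section complex_space.
Variables (R : realType) (n : nat).

Definition row_of_reals
    (x : n.-tuple (measurableTypeR R * measurableTypeR R)) : 'rV[R[i]]_n :=
  \row_j Complex (tnth x j).1 (tnth x j).2.

(* The Borel sigma-algebra, transported from [(R * R)^n] along the bijection
   [row_of_reals]. *)
Let measurable_Cn : set (set 'rV[R[i]]_n) :=
  [set A | measurable (row_of_reals @^-1` A)].

Let measurable_Cn0 : measurable_Cn set0.
Proof. by rewrite /measurable_Cn/= preimage_set0. Qed.

Let measurable_CnC A : measurable_Cn A -> measurable_Cn (~` A).
Proof. by rewrite /measurable_Cn/= preimage_setC; exact: measurableC. Qed.

Let measurable_Cn_bigcup (F : (set 'rV[R[i]]_n)^nat) :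
  (forall k, measurable_Cn (F k)) -> measurable_Cn (\bigcup_k F k).
Proof.
by move=> mF; rewrite /measurable_Cn/= preimage_bigcup; exact: bigcupT_measurable.
Qed.

HB.instance Definition _ := @isMeasurable.Build default_measure_display
  'rV[R[i]]_n measurable_Cn measurable_Cn0 measurable_CnC measurable_Cn_bigcup.

Lemma measurable_row_of_reals : measurable_fun setT row_of_reals.
Proof. by move=> _ A mA; rewrite setTI. Qed.

Definition lebesgue_Cn : set 'rV[R[i]]_n -> \bar R :=
  pushforward (power_measure (@lebesgue_measure2 R) n) row_of_reals.

HB.instance Definition _ := Measure.copy lebesgue_Cn
  (measure_function_pushforward__canonical__measure_function_Measure
    (power_measure (@lebesgue_measure2 R) n) measurable_row_of_reals).

Lemma lebesgue_Cn_box (a b c e : 'I_n -> R) :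
  (forall j, a j <= b j) -> (forall j, c j <= e j) ->
  lebesgue_Cn [set z : 'rV[R[i]]_n | forall j,
    a j < complex.Re (z ord0 j) <= b j /\ c j < complex.Im (z ord0 j) <= e j] =
  (\prod_j ((b j - a j) * (e j - c j)))%:E.
Proof.
move=> ab ce; rewrite /lebesgue_Cn /pushforward.
transitivity (\prod_j lebesgue_measure2 (`]a j, b j] `*` `]c j, e j]))%E.
  rewrite -power_measure_box; last by move=> j; exact: measurableX.
  congr (_ _); apply/seteqP; split => x /= xab j; have := xab j;
    by rewrite !mxE/= !in_itv.
rewrite -prodEFin; apply: eq_bigr => j _.
rewrite /lebesgue_measure2 product_measure1E//=.
have itvE (x y : R) : x <= y ->
    lebesgue_measure (`]x, y] : set (measurableTypeR R)) = (y - x)%:E.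
  move=> xy; rewrite lebesgue_measure_itv/= lte_fin.
  by case: ltgtP xy => // -> _; rewrite subrr.
by rewrite !itvE.
Qed.

End complex_space.
Arguments lebesgue_Cn : clear implicits.

(* Elements of L^2 and A^2 are represented by functions on all of C^n, of which
   only the values on the domain [D] matter; elements of L^2 are moreover only
   significant up to equality almost everywhere on [D]. *)
Section bergman.
Variables (R : realType) (n : nat) (D : set 'rV[R[i]]_n).

Local Notation C := R[i].
Local Notation Cn := 'rV[R[i]]_n.
Local Notation dV := (lebesgue_Cn R n).
Implicit Types (f g h p : Cn -> C) (T : (Cn -> C) -> (Cn -> C)).

Definition cmeasurable_fun h :=
  measurable_fun D (fun z => complex.Re (h z)) /\
  measurable_fun D (fun z => complex.Im (h z)).

Definition cintegral h : C :=
  Complex (\int[dV]_(z in D) complex.Re (h z))%R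
          (\int[dV]_(z in D) complex.Im (h z))%R.

Definition L2norm_sq h : \bar R :=
  (\int[dV]_(z in D) (Normc.normc (h z) ^+ 2)%:E)%E.

Definition L2 : set (Cn -> C) :=
  [set h | cmeasurable_fun h /\ (L2norm_sq h < +oo)%E].

Definition L2dot g h : C := cintegral (fun z => g z * conjc (h z)).

Definition holomorphic f := forall z, D z -> differentiable f z.

Definition bergman_space : set (Cn -> C) :=
  [set f | holomorphic f /\ L2 f].

(* The orthogonal projection of [h] exists for [h] in L^2 because A^2 is closed
   in L^2, and it is unique on [D]; the default value of [xget] is only used for
   [h] outside L^2. *)
Definition bergman_projection h : Cn -> C :=
  xget (fun=> 0) [set p | bergman_space p /\
    forall g, bergman_space g -> L2dot (fun z => h z - p z) g = 0].

Definition hankel_domain f : set (Cn -> C) :=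
  [set g | bergman_space g /\ L2 (fun z => conjc (f z) * g z)].

Definition hankel f g : Cn -> C :=
  fun z => conjc (f z) * g z - bergman_projection (fun w => conjc (f w) * g w) z.

(* Well defined on A^2: by linearity and boundedness, functions that agree on
   [D] have images that agree almost everywhere on [D]. *)
Definition bounded_operator T :=
  [/\ forall g, bergman_space g -> L2 (T g),
      forall a g h, bergman_space g -> bergman_space h ->
        ae_eq dV D (T (fun z => a * g z + h z)) (fun z => a * T g z + T h z)
    & exists M : R, forall g, bergman_space g ->
        (L2norm_sq (T g) <= (M ^+ 2)%:E * L2norm_sq g)%E].

(* Indexed by [nat] since A^2 of a nonempty bounded domain is separable and, for
   [n > 0], infinite-dimensional. *)
Definition bergman_orthonormal_basis (xi : (Cn -> C)^nat) :=
  [/\ forall j, bergman_space (xi j),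
      forall j k, L2dot (xi j) (xi k) = (j == k)%:R
    & forall g, bergman_space g -> forall eps : R, 0 < eps ->
        exists N (c : C^nat),
          (L2norm_sq (fun z => g z - \sum_(0 <= j < N) c j * xi j z)%R <
            eps%:E)%E].

Definition hilbert_schmidt T :=
  bounded_operator T /\
  exists xi, bergman_orthonormal_basis xi /\
    (\sum_(0 <= j <oo) L2norm_sq (T (xi j)) < +oo)%E.

Definition hankel_hilbert_schmidt f :=
  exists T, hilbert_schmidt T /\
    forall g, hankel_domain f g -> ae_eq dV D (T g) (hankel f g).

End bergman.

Definition ellipsoid (R : realType) (n : nat) (m : 'I_n -> R) :
    set 'rV[R[i]]_n :=
  [set z | \sum_(j < n) Normc.normc (z ord0 j) `^ (2 * m j) < 1].

(* Main.v *)
From HB Require Import structures.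
Require Import Defs.
From mathcomp Require Import all_boot all_order all_algebra.
From mathcomp Require Import complex ring lra.
From mathcomp Require Import all_classical all_reals all_analysis.
From mathcomp Require Import measurable_realfun.

(** The argument works on every bounded complete Reinhardt domain [D] in at
    least two variables; the ellipsoid is one. It shows that each nonconstant
    monomial in the Taylor expansion of [f] would on its own make the
    Hilbert-Schmidt norm of the Hankel operator infinite.

    Taylor coefficients. For [f] holomorphic on [D], averaging
    [f (u z) * (u ^ d)^*] over the torus of unimodular [u] gives a function of
    [z] that is homogeneous of multidegree [d] under rotations and, because
    circle means of holomorphic functions scale ([slice_scaling], a consequence
    of Goursat's lemma [boundary_integral_eq0]), under real dilations as well.
    So it is a multiple of [z ^ d]. Hence the integral of [f z * (z ^ d)^*]
    against any bounded weight that depends only on the moduli of the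
    coordinates is one number [c], the Taylor coefficient, times the same
    integral for [z ^ d] ([weighted_moment]); and [f] integrates to zero against
    functions that a rotation of one coordinate by the angle [y] multiplies by
    [cis y ^+ k] with [0 < k] ([vanishing_moment]).

    Test functions. Let [p] be the monomial of multidegree [alpha], with
    [0 < alpha j], and let [l] differ from [j]; this is where two variables are
    needed. Put [e i k = z_l ^ i * p ^ k], and let [h i k] be [p^* * e i k] minus
    its projection on the Bergman space. As [h i k] is orthogonal to that space,
    the projection in the Hankel operator does not contribute to
    [<H (e i k), h i k>], which is [c^*] times the square norm of [h i k]. The
    [h i k] are pairwise orthogonal, as the torus acts on them by different
    characters. For pairwise orthogonal [w x] and arbitrary [v x], Bessel's
    inequality bounds the sum of
    [|<T (v x), w x>| ^ 2 / (|v x| ^ 2 * |w x| ^ 2)] by the square of the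
    Hilbert-Schmidt norm of [T] ([hilbert_schmidt_bound]). So the sum of
    [|c| ^ 2 * |h i k| ^ 2 / |e i k| ^ 2] is finite. For fixed [i] the quotients
    telescope ([sum_test_norm]): the sum over [k <= N] is the ratio of the square
    norms of [e i N.+1] and [e i N]. These ratios cannot all be small, because
    the square norm of [e i k] decays at most geometrically in [k], at a rate
    that does not depend on [i] ([cnorm_ratio]). Each of the infinitely many
    values of [i] therefore contributes at least a fixed positive multiple of
    [|c| ^ 2], and [c = 0] ([hankel_coef_eq0]).

    Conclusion. After subtraction of the constant term all the integrals of [f]
    against products of monomials and conjugate monomials vanish. Powers of a
    polynomial in the coordinates and their conjugates that peaks at a point of
    [D] concentrate there, so [f] minus the constant vanishes at that point
    ([moments_zero_eq0]). *)

Set Implicit Arguments.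
Unset Strict Implicit.
Unset Printing Implicit Defensive.

Import Order.TTheory GRing.Theory Num.Theory.
Import numFieldNormedType.Exports.

Local Open Scope classical_set_scope.
Local Open Scope ring_scope.

(** * Goursat's lemma for closed forms on rectangles *)

Section segment_integral.
Variable R : realType.
Implicit Types (a b c d e k m x y : R) (u : R -> R).

Definition segment_integral a b u : R :=
  \int[@lebesgue_measure R]_(x in `[a, b]) u x.

Definition continuous_on a b u := forall x, a <= x <= b -> {for x, continuous u}.

Lemma integrable_segment a b u : continuous_on a b u ->
  (@lebesgue_measure R).-integrable `[a, b] (EFin \o u).
Proof.
move=> cu; apply: continuous_compact_integrable; first exact: segment_compact.
apply: continuous_in_subspaceT => x.
by rewrite inE/= in_itv/= => /cu.
Qed.

Lemma segment_integral_split a m b u : a <= m -> m <= b -> continuous_on a b u ->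
  segment_integral a b u = segment_integral a m u + segment_integral m b u.
Proof.
move=> am mb cu; have iu := integrable_segment cu.
apply/eqP; rewrite addrC -subr_eq /segment_integral; apply/eqP.
rewrite (Rintegral_itvB iu) ?bnd_simp//.
rewrite Rintegral_itv_obnd_cbnd//.
apply: (integrableS _ _ _ iu) => //; exact: subset_itvScc.
Qed.

Lemma segment_integral_near a b u k e : a <= b -> continuous_on a b u ->
  (forall x, a <= x <= b -> `|u x - k| <= e) ->
  `|segment_integral a b u - k * (b - a)| <= e * (b - a).
Proof.
move=> ab cu ue.
have mab : measurable (`[a, b] : set (measurableTypeR R)) by [].
have lab : fine (@lebesgue_measure R `[a, b]) = b - a.
  by rewrite lebesgue_measure_itv/= lte_fin; case: ltgtP ab => //= -> _; rewrite subrr.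
have icst (r : R) : (@lebesgue_measure R).-integrable `[a, b] (EFin \o (fun=> r)).
  by apply: integrable_segment => x _; exact: cvg_cst.
have iu := integrable_segment cu.
have -> : segment_integral a b u - k * (b - a) = segment_integral a b (fun x => u x - k).
  by rewrite /segment_integral RintegralB// Rintegral_cst// lab.
have iuk : (@lebesgue_measure R).-integrable `[a, b] (EFin \o (fun x => u x - k)).
  apply: (@integrable_segment a b) => x xab; apply: cvgB; [exact: cu|exact: cvg_cst].
apply: (le_trans (le_normr_Rintegral _ _)) => //.
rewrite -lab -Rintegral_cst//; apply: le_Rintegral => //; first exact: integrable_norm iuk.
Qed.
End segment_integral.

Section goursat.
Variable R : realType.
Implicit Types (a b c d x y e : R) (P Q : R -> R -> R).

(** Differentiability at one point, with [p] and [q] the partial derivatives: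
    Goursat's argument does not need them to be continuous. *)
Definition is_diff2 (u : R -> R -> R) x y p q := forall e, 0 < e ->
  exists2 r : R, 0 < r & forall x' y', `|x' - x| < r -> `|y' - y| < r ->
    `|u x' y' - u x y - p * (x' - x) - q * (y' - y)|
      <= e * (`|x' - x| + `|y' - y|).

Lemma is_diff2_continuous1 u x y p q : is_diff2 u x y p q ->
  {for x, continuous (fun t => u t y)}.
Proof.
move=> du; apply/cvgrPdist_le => /= e e0.
have [r r0 hr] := du 1 ltr01.
have s0 : 0 < Num.min r (e / (1 + `|p|)) by rewrite lt_min r0/= divr_gt0// ltr_pwDl.
exists (Num.min r (e / (1 + `|p|))) => //= t /=; rewrite lt_min => /andP[tr te].
have tx : `|t - x| < r by rewrite distrC.
have := hr t y tx; rewrite subrr normr0 mulr0 addr0 subr0 mul1r => /(_ r0) h.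
have -> : u x y - u t y = - ((u t y - u x y - p * (t - x)) + p * (t - x)) by ring.
rewrite normrN (le_trans (ler_normD _ _))// normrM.
rewrite (le_trans (lerD h (lexx _)))// -[X in X + _]mul1r -mulrDl.
by rewrite mulrC -ler_pdivlMr ?ltr_pwDl// distrC ltW.
Qed.

Lemma is_diff2_swap u x y p q : is_diff2 u x y p q ->
  is_diff2 (fun s t => u t s) y x q p.
Proof.
move=> du e /du[r r0 hr]; exists r => // y' x' hy hx.
have := hr x' y' hx hy; congr (`|_| <= _ * _); ring.
Qed.

Lemma is_diff2_continuous2 u x y p q : is_diff2 u x y p q ->
  {for y, continuous (fun t => u x t)}.
Proof. by move=> /is_diff2_swap/is_diff2_continuous1. Qed.

Section rectangle.
Variables (P Q : R -> R -> R).

(** The circulation of [P dx + Q dy] around the rectangle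
    [[a, b] x [c, d]]. *)
Definition boundary_integral (q : R * R * (R * R)) : R :=
  let: ((a, b), (c, d)) := q in
  (segment_integral a b (P^~ c) - segment_integral a b (P^~ d)) +
  (segment_integral c d (Q b) - segment_integral c d (Q a)).

Let F := boundary_integral.

(** Closedness of [P dx + Q dy]: the shared [p2] is both [dP/dy] and
    [dQ/dx]. *)
Definition closed_on (q : R * R * (R * R)) :=
  forall x y, q.1.1 <= x <= q.1.2 -> q.2.1 <= y <= q.2.2 ->
  exists p1 p2 q1, is_diff2 P x y p1 p2 /\ is_diff2 Q x y p2 q1.

Let wf (q : R * R * (R * R)) := q.1.1 <= q.1.2 /\ q.2.1 <= q.2.2.

Let closed_cont1 a b c d y : closed_on ((a, b), (c, d)) -> c <= y <= d ->
  continuous_on a b (P^~ y).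
Proof.
by move=> h hy x hx; have [p1 [p2 [q1 [/is_diff2_continuous1 ]]]] := h _ _ hx hy.
Qed.

Let closed_cont2 a b c d x : closed_on ((a, b), (c, d)) -> a <= x <= b ->
  continuous_on c d (Q x).
Proof.
by move=> h hx y hy; have [p1 [p2 [q1 [_ /is_diff2_continuous2 ]]]] := h _ _ hx hy.
Qed.

Let mid a b := (a + b) / 2.

Let halfx (q : R * R * (R * R)) : R * R * (R * R) :=
  let l := ((q.1.1, mid q.1.1 q.1.2), q.2) in
  if `|F q| <= 2 * `|F l| then l else ((mid q.1.1 q.1.2, q.1.2), q.2).

Let halfy (q : R * R * (R * R)) : R * R * (R * R) :=
  let l := (q.1, (q.2.1, mid q.2.1 q.2.2)) in
  if `|F q| <= 2 * `|F l| then l else (q.1, (mid q.2.1 q.2.2, q.2.2)).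

Let sub (q q' : R * R * (R * R)) :=
  [/\ q'.1.1 <= q.1.1, q.1.2 <= q'.1.2, q'.2.1 <= q.2.1 & q.2.2 <= q'.2.2].

Let closedS q q' : sub q q' -> closed_on q' -> closed_on q.
Proof.
move=> [s1 s2 s3 s4] h x y /andP[x1 x2] /andP[y1 y2]; apply: h.
  by rewrite (le_trans s1 x1) (le_trans x2 s2).
by rewrite (le_trans s3 y1) (le_trans y2 s4).
Qed.

Let pick_half (f f1 f2 : R) : f = f1 + f2 -> ~~ (`|f| <= 2 * `|f1|) -> `|f| <= 2 * `|f2|.
Proof.
move=> ->; have := ler_normD f1 f2; rewrite -ltNge; lra.
Qed.

(** Circulations add up, so one of the two halves carries at least half of
    the circulation. *)
Let halfxP q : wf q -> closed_on q ->
  [/\ wf (halfx q), sub (halfx q) q, `|F q| <= 2 * `|F (halfx q)|,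
   (halfx q).1.2 - (halfx q).1.1 = (q.1.2 - q.1.1) / 2 &
   (halfx q).2.2 - (halfx q).2.1 = q.2.2 - q.2.1].
Proof.
move: q => [[a b] [c d]] [/= ab cd] cl; rewrite /halfx/=.
have m1 : a <= mid a b by rewrite /mid; lra.
have m2 : mid a b <= b by rewrite /mid; lra.
case: ifPn => [h|].
  by split => //=; rewrite /mid; lra.
have FE : F ((a, b), (c, d)) = F ((a, mid a b), (c, d)) + F ((mid a b, b), (c, d)).
  rewrite /F/= (@segment_integral_split _ a (mid a b) b)//; last first.
    by apply: (closed_cont1 cl); rewrite lexx.
  rewrite (@segment_integral_split _ a (mid a b) b)//; last first.
    by apply: (closed_cont1 cl); rewrite lexx andbT.
  ring.
move/(pick_half FE) => h; split => //=; rewrite /mid; lra.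
Qed.

Let halfyP q : wf q -> closed_on q ->
  [/\ wf (halfy q), sub (halfy q) q, `|F q| <= 2 * `|F (halfy q)|,
   (halfy q).2.2 - (halfy q).2.1 = (q.2.2 - q.2.1) / 2 &
   (halfy q).1.2 - (halfy q).1.1 = q.1.2 - q.1.1].
Proof.
move: q => [[a b] [c d]] [/= ab cd] cl; rewrite /halfy/=.
have m1 : c <= mid c d by rewrite /mid; lra.
have m2 : mid c d <= d by rewrite /mid; lra.
case: ifPn => [h|].
  by split => //=; rewrite /mid; lra.
have FE : F ((a, b), (c, d)) = F ((a, b), (c, mid c d)) + F ((a, b), (mid c d, d)).
  rewrite /F/= (@segment_integral_split _ c (mid c d) d)//; last first.
    by apply: (closed_cont2 cl); rewrite lexx ab.
  rewrite (@segment_integral_split _ c (mid c d) d)//; last first.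
    by apply: (closed_cont2 cl); rewrite lexx ab.
  ring.
move/(pick_half FE) => h; split => //=; rewrite /mid; lra.
Qed.

Variable q0 : R * R * (R * R).
Hypotheses (wf0 : wf q0) (cl0 : closed_on q0).

Let quarter k := iter k (halfy \o halfx) q0.

Let subxx q : sub q q. Proof. by []. Qed.

Let sub_trans q1 q2 q3 : sub q1 q2 -> sub q2 q3 -> sub q1 q3.
Proof.
move=> [a1 a2 a3 a4] [b1 b2 b3 b4]; split.
- exact: le_trans a1.
- exact: le_trans a2 _.
- exact: le_trans a3.
- exact: le_trans a4 _.
Qed.

Let quarterP k : [/\ wf (quarter k), sub (quarter k) q0,
  `|F q0| <= 4 ^+ k * `|F (quarter k)|,
   (quarter k).1.2 - (quarter k).1.1 = (q0.1.2 - q0.1.1) / 2 ^+ k &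
   (quarter k).2.2 - (quarter k).2.1 = (q0.2.2 - q0.2.1) / 2 ^+ k]
  /\ sub (quarter k.+1) (quarter k).
Proof.
have step q : wf q -> sub q q0 -> [/\ wf ((halfy \o halfx) q),
    sub ((halfy \o halfx) q) q, `|F q| <= 4 * `|F ((halfy \o halfx) q)|,
    ((halfy \o halfx) q).1.2 - ((halfy \o halfx) q).1.1 = (q.1.2 - q.1.1) / 2 &
    ((halfy \o halfx) q).2.2 - ((halfy \o halfx) q).2.1 = (q.2.2 - q.2.1) / 2].
  move=> w s; have cl := closedS s cl0.
  have [w1 s1 f1 d1 e1] := halfxP w cl.
  have [w2 s2 f2 d2 e2] := halfyP w1 (closedS s1 cl).
  split => //=; first exact: sub_trans s1.
  - by apply: (le_trans f1); move: f2; lra.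
  - by rewrite e2.
  - by rewrite d2 e1.
elim: k => [|k [[w s f d e] _]].
  split; last by have [] := step _ wf0 (subxx _).
  by split => //; rewrite expr0 ?mul1r// divr1.
have [w1 s1 f1 d1 e1] := step _ w s.
have s2 : sub (quarter k.+1) q0 by exact: sub_trans s.
split; last by have [] := step _ w1 s2.
split => //.
- apply: (le_trans f); rewrite exprSr -mulrA ler_pM2l ?exprn_gt0//.
- by rewrite [LHS]d1 d exprSr invfM mulrA.
- by rewrite [LHS]e1 e exprSr invfM mulrA.
Qed.

Let quarter_mono k l : (k <= l)%N -> sub (quarter l) (quarter k).
Proof.
move=> /subnK <-; elim: (l - k)%N => [|j ih]; first by rewrite add0n.
by rewrite addSn; apply: sub_trans ih; have [] := quarterP (j + k).
Qed.

Let nested_point (lo hi : nat -> R) :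
  (forall k, lo k <= hi k) -> (forall k l, (k <= l)%N -> lo k <= lo l /\ hi l <= hi k) ->
  exists x, forall k, lo k <= x <= hi k.
Proof.
move=> lh mono.
have ub l : ubound (range lo) (hi l).
  move=> _ [k _ <-]; have [kl|/ltnW lk] := leqP k l.
    by apply: le_trans (lh l); have [] := mono _ _ kl.
  by apply: (le_trans (lh k)); have [] := mono _ _ lk.
have hs : has_sup (range lo) by split; [exists (lo 0%N), 0%N|exists (hi 0%N); exact: ub].
exists (sup (range lo)) => k; apply/andP; split.
  by apply: sup_upper_bound => //; exists k.
by apply: ge_sup; [case: hs|exact: ub].
Qed.

(** Bisecting in both directions [k] times, always keeping the half with the
    larger circulation, leaves a rectangle with at least the [4 ^- k]-th part of
    the circulation. Near the common point of these rectangles the form is exact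
    up to an error of first order, so this part is at most [2 * e] times the
    square of the half perimeter, which is itself proportional to [4 ^- k]. *)
Lemma boundary_integral_eq0 : boundary_integral q0 = 0.
Proof.
have [x0 hx] := @nested_point (fun k => (quarter k).1.1) (fun k => (quarter k).1.2)
  (fun k => let: conj (And5 (conj h _) _ _ _ _) _ := quarterP k in h)
  (fun k l kl => let: And4 h1 h2 _ _ := quarter_mono kl in conj h1 h2).
have [y0 hy] := @nested_point (fun k => (quarter k).2.1) (fun k => (quarter k).2.2)
  (fun k => let: conj (And5 (conj _ h) _ _ _ _) _ := quarterP k in h)
  (fun k l kl => let: And4 _ _ h1 h2 := quarter_mono kl in conj h1 h2).
have [p1 [p2 [q1 [dP dQ]]]] : exists p1 p2 q1, is_diff2 P x0 y0 p1 p2 /\ is_diff2 Q x0 y0 p2 q1.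
  by apply: cl0; [exact: (hx 0%N)|exact: (hy 0%N)].
set W := q0.1.2 - q0.1.1; set H := q0.2.2 - q0.2.1.
have W0 : 0 <= W by rewrite subr_ge0; case: wf0.
have H0 : 0 <= H by rewrite subr_ge0; case: wf0.
suff main e : 0 < e -> `|F q0| <= 2 * e * (W + H) ^+ 2.
  apply/eqP; rewrite -normr_eq0; apply/eqP/le_anti; rewrite normr_ge0 andbT.
  apply/ler_addgt0Pl => e e0; rewrite addr0.
  have D0 : 0 < 2 * ((W + H) ^+ 2 + 1) by rewrite mulr_gt0// ltr_wpDl// sqr_ge0.
  apply: (le_trans (main (e / (2 * ((W + H) ^+ 2 + 1))) _)); first by rewrite divr_gt0.
  set D := 2 * (_ + 1) in D0 *.
  have -> : 2 * (e / D) * (W + H) ^+ 2 = e * (2 * (W + H) ^+ 2 / D) by ring.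
  by rewrite ler_piMr ?(ltW e0)// ler_pdivrMr// mul1r /D; lra.
move=> e0; have [r r0 hP] := dP _ e0; have [s s0 hQ] := dQ _ e0.
have [k hk] : exists k, (W + H) / 2 ^+ k < Num.min r s.
  have m0 : 0 < Num.min r s by rewrite lt_min r0.
  have := @cvg_geometric R (W + H) (2^-1).
  rewrite ger0_norm// invf_lt1// ltr1n => /(_ isT) /cvgrPdist_lt /(_ _ m0)[k _ hk].
  exists k; have := hk k (leqnn k); rewrite /= sub0r normrN exprVn ger0_norm//.
  by apply: mulr_ge0; [exact: addr_ge0|rewrite -exprVn exprn_ge0].
have [[w sq fq dw dh] _] := quarterP k.
have clk := closedS sq cl0.
apply: (le_trans fq); move: (hx k) (hy k) w clk dw dh.
case: (quarter k) => -[a b] [c d] /= /andP[ax xb] /andP[cy yd] [/= ab cd] clk dw dh.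
set X := b - a in dw *; set Y := d - c in dh *.
have X0 : 0 <= X by rewrite subr_ge0.
have Y0 : 0 <= Y by rewrite subr_ge0.
have XY : X + Y < Num.min r s by rewrite dw dh -mulrDl.
have XYr : X + Y < r by move: XY; rewrite lt_min => /andP[].
have XYs : X + Y < s by move: XY; rewrite lt_min => /andP[].
have nx x : a <= x <= b -> `|x - x0| <= X.
  by move=> /andP[h1 h2]; rewrite ler_distl /X; apply/andP; split; lra.
have ny y : c <= y <= d -> `|y - y0| <= Y.
  by move=> /andP[h1 h2]; rewrite ler_distl /Y; apply/andP; split; lra.
have approx (u : R -> R -> R) p q t (h : forall x' y', `|x' - x0| < t -> `|y' - y0| < t ->
    `|u x' y' - u x0 y0 - p * (x' - x0) - q * (y' - y0)| <= e * (`|x' - x0| + `|y' - y0|)) :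
    X + Y < t -> forall x y, a <= x <= b -> c <= y <= d ->
    `|u x y - u x0 y0 - p * (x - x0) - q * (y - y0)| <= e * (X + Y).
  move=> ht x y /nx hx' /ny hy'; apply: (le_trans (h _ _ _ _)); try lra.
  by rewrite ler_pM2l// lerD.
have aP := approx _ _ _ _ hP XYr.
have aQ := approx _ _ _ _ hQ XYs.
have caa : a <= a <= b by rewrite lexx.
have cbb : a <= b <= b by rewrite lexx ab.
have ccc : c <= c <= d by rewrite lexx.
have cdd : c <= d <= d by rewrite lexx cd.
have dist4 (A B : R) : `|A| <= e * (X + Y) -> `|B| <= e * (X + Y) -> `|A - B| <= 2 * e * (X + Y).
  by move=> hA hB; apply: (le_trans (ler_normB _ _)); move: hA hB; lra.
have integD (u v : R -> R) a' b' : continuous_on a' b' u -> continuous_on a' b' v ->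
    segment_integral a' b' u - segment_integral a' b' v = segment_integral a' b' (fun x => u x - v x).
  by move=> cu cv; rewrite /segment_integral RintegralB//; exact: integrable_segment.
have E1 : `|(segment_integral a b (P^~ c) - segment_integral a b (P^~ d)) - p2 * (c - d) * X|
    <= 2 * e * (X + Y) * X.
  have cP1 := closed_cont1 clk ccc; have cP2 := closed_cont1 clk cdd.
  rewrite integD//; apply: segment_integral_near => //.
    by move=> x hx'; apply: cvgB; [exact: cP1|exact: cP2].
  move=> x hx'; have := dist4 _ _ (aP x c hx' ccc) (aP x d hx' cdd).
  by congr (`|_| <= _); ring.
have E2 : `|(segment_integral c d (Q b) - segment_integral c d (Q a)) - p2 * (b - a) * Y|
    <= 2 * e * (X + Y) * Y.
  have cP1 := closed_cont2 clk cbb; have cP2 := closed_cont2 clk caa.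
  rewrite integD//; apply: segment_integral_near => //.
    by move=> x hx'; apply: cvgB; [exact: cP1|exact: cP2].
  move=> y hy'; have := dist4 _ _ (aQ b y cbb hy') (aQ a y caa hy').
  by congr (`|_| <= _); ring.
have FE : `|F ((a, b), (c, d))| <= 2 * e * (X + Y) ^+ 2.
  have -> : 2 * e * (X + Y) ^+ 2 = 2 * e * (X + Y) * X + 2 * e * (X + Y) * Y by ring.
  apply: le_trans (lerD E1 E2); apply: le_trans (ler_normD _ _).
  by rewrite le_eqVlt /F /= /X /Y; apply/orP; left; apply/eqP; congr (`|_|); ring.
apply: (le_trans (ler_wpM2l _ FE)); first by rewrite exprn_ge0.
have -> : (4 : R) ^+ k = (2 ^+ k) ^+ 2 by rewrite -exprM mulnC exprM; congr (_ ^+ _); ring.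
have E0 : (2 : R) ^+ k != 0 by rewrite expf_neq0.
rewrite dw dh le_eqVlt; apply/orP; left; apply/eqP.
by move: (2 ^+ k) E0 => E E0; rewrite -/W -/H; field.
Qed.

End rectangle.
End goursat.

Local Open Scope complex_scope.
Local Notation "z ^*" := (conjc z) : ring_scope.
Local Notation normc := Normc.normc.

(** * The complex exponential and circle means *)

Section normc_facts.
Variable R : rcfType.
Implicit Types (z w : R[i]) (x y : R).

Lemma normC_E z : `|z| = (normc z)%:C.
Proof. by case: z. Qed.

Lemma normc_ge0 z : 0 <= normc z.
Proof. by case: z => x y; exact: sqrtr_ge0. Qed.

Lemma sqr_normcE z : normc z ^+ 2 = complex.Re z ^+ 2 + complex.Im z ^+ 2.
Proof. by case: z => x y; rewrite sqr_sqrtr// addr_ge0// sqr_ge0. Qed.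

Lemma normRe_le z : `|complex.Re z| <= normc z.
Proof.
rewrite -(@ler_pXn2r _ 2)// ?nnegrE ?normc_ge0// sqr_normcE real_normK ?num_real//.
by rewrite lerDl sqr_ge0.
Qed.

Lemma normIm_le z : `|complex.Im z| <= normc z.
Proof.
rewrite -(@ler_pXn2r _ 2)// ?nnegrE ?normc_ge0// sqr_normcE real_normK ?num_real//.
by rewrite lerDr sqr_ge0.
Qed.

Lemma normc_le z : normc z <= `|complex.Re z| + `|complex.Im z|.
Proof.
rewrite -(@ler_pXn2r _ 2)// ?nnegrE ?normc_ge0// ?addr_ge0// sqr_normcE.
rewrite sqrrD !real_normK ?num_real// addrAC lerDl.
by rewrite mulrn_wge0// mulr_ge0.
Qed.

Lemma normcD_le z w : normc (z + w) <= normc z + normc w.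
Proof. by have := ler_normD z w; rewrite !normC_E -raddfD/= lecR. Qed.

Lemma normcJ z : normc z^* = normc z.
Proof. by case: z => x y /=; rewrite sqrrN. Qed.

Lemma normc_real x : normc x%:C = `|x|.
Proof. by rewrite /= expr0n/= addr0 sqrtr_sqr. Qed.

Lemma normcX z n : normc (z ^+ n) = normc z ^+ n.
Proof.
elim: n => [|n ih]; first by rewrite !expr0 Normc.normc1.
by rewrite !exprS Normc.normcM ih.
Qed.

Lemma normc_prod (I : Type) (r : seq I) (P : pred I) (F : I -> R[i]) :
  normc (\prod_(i <- r | P i) F i) = \prod_(i <- r | P i) normc (F i).
Proof.
by elim/big_rec2: _ => [|i x y _ <-]; [exact: Normc.normc1|exact: Normc.normcM].
Qed.

Lemma mulcJ z : z * z^* = (normc z ^+ 2)%:C.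
Proof. by rewrite -sqr_normc normC_E rmorphXn. Qed.

Lemma normc_eq0 z : (normc z == 0) = (z == 0).
Proof.
apply/eqP/eqP => [/Normc.eq0_normc//|->]; exact: Normc.normc0.
Qed.

Lemma normc_gt0 z : (0 < normc z) = (z != 0).
Proof. by rewrite lt_neqAle normc_ge0 andbT eq_sym normc_eq0. Qed.

Lemma cReM z w : complex.Re (z * w) =
  complex.Re z * complex.Re w - complex.Im z * complex.Im w.
Proof. by case: z w => ? ? []. Qed.

Lemma cImM z w : complex.Im (z * w) =
  complex.Re z * complex.Im w + complex.Im z * complex.Re w.
Proof. by case: z w => ? ? []. Qed.

Lemma cReB z w : complex.Re (z - w) = complex.Re z - complex.Re w.
Proof. by case: z w => ? ? []. Qed.

Lemma cImB z w : complex.Im (z - w) = complex.Im z - complex.Im w.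
Proof. by case: z w => ? ? []. Qed.

Lemma cReD z w : complex.Re (z + w) = complex.Re z + complex.Re w.
Proof. by case: z w => ? ? []. Qed.

Lemma cImD z w : complex.Im (z + w) = complex.Im z + complex.Im w.
Proof. by case: z w => ? ? []. Qed.

End normc_facts.

Section first_order.
Variable K : numFieldType.
Implicit Types (f : K -> K) (a D : K).

Lemma derive1_first_order f a D : is_derive (a : K^o) 1 (f : K^o -> K^o) D ->
  forall e, 0 < e -> exists2 r : K, 0 < r &
    forall b, `|b - a| < r -> `|f b - f a - D * (b - a)| <= e * `|b - a|.
Proof.
move=> [df Df] e e0.
have /cvgrPdist_le /(_ e e0) : (fun h : K => h^-1 *: (f (h *: (1:K^o) + a) - f a)) @ 0^' --> D.
  by rewrite -Df; exact: df.
move=> [r /= r0 hr]; exists r => // b br.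
have [->|bna] := eqVneq b a; first by rewrite !subrr mulr0 subr0 normr0 mulr0.
have b0 : b - a != 0 by rewrite subr_eq0.
have := hr (b - a); rewrite /= sub0r normrN => /(_ br b0).
have -> : (b - a) *: (1 : K^o) + a = b by rewrite /GRing.scale/= mulr1 subrK.
rewrite -(ler_pM2r (_ : 0 < `|b - a|)) ?normr_gt0// -normrM.
rewrite -[X in _ -> X <= _]normrN; congr (`|_| <= _).
have E : (b - a)^-1 * (f b - f a) * (b - a) = f b - f a by rewrite mulrAC mulVf// mul1r.
by rewrite mulrBl /GRing.scale/= E; ring.
Qed.

Lemma first_order_is_derive f a D :
  (forall e, 0 < e -> exists2 r : K, 0 < r &
    forall b, `|b - a| < r -> `|f b - f a - D * (b - a)| <= e * `|b - a|) ->
  is_derive (a : K^o) 1 (f : K^o -> K^o) D.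
Proof.
move=> h.
have cv : (fun h : K => h^-1 *: (f (h *: (1:K^o) + a) - f a)) @ 0^' --> (D : K^o).
  apply/cvgrPdist_le => e e0; have [r r0 hr] := h e e0.
  exists r => // t /=; rewrite sub0r normrN => tr t0.
  have := hr (t + a); rewrite addrK => /(_ tr).
  have -> : t *: (1 : K^o) + a = t + a by rewrite /GRing.scale/= mulr1.
  move=> ht; rewrite -(ler_pM2r (_ : 0 < `|t|)) ?normr_gt0// -normrM; move: ht.
  rewrite -[X in X <= _ -> _]normrN; congr (`|_| <= _).
  have E : t^-1 * (f (t + a) - f a) * t = f (t + a) - f a by rewrite mulrAC mulVf// mul1r.
  by rewrite [in RHS]mulrBl /GRing.scale/= E; ring.
split; first by apply/cvg_ex; exists D.
exact/cvg_lim.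
Qed.

End first_order.

Section complex_exponential.
Variable R : realType.
Implicit Types (z w : R[i]) (x y : R).

Definition cexp z : R[i] :=
  Complex (expR (complex.Re z) * cos (complex.Im z))
          (expR (complex.Re z) * sin (complex.Im z)).

Lemma cexpD z w : cexp (z + w) = cexp z * cexp w.
Proof.
case: z w => [a b] [c d]; rewrite /cexp/= expRD sinD cosD; congr Complex; ring.
Qed.

Lemma cexp0 : cexp 0 = 1.
Proof. by rewrite /cexp/= expR0 cos0 sin0 mulr1 mulr0. Qed.

Lemma normc_cexp z : normc (cexp z) = expR (complex.Re z).
Proof.
rewrite /cexp/= !exprMn -mulrDr cos2Dsin2 mulr1 sqrtr_sqr ger0_norm// expR_ge0.
Qed.

Lemma cexp_neq0 z : cexp z != 0.
Proof. by rewrite -normc_eq0 normc_cexp gt_eqF// expR_gt0. Qed.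

Lemma cexpMn z n : cexp (z *+ n) = cexp z ^+ n.
Proof.
elim: n => [|n ih]; first by rewrite mulr0n cexp0 expr0.
by rewrite mulrS cexpD ih exprS.
Qed.

Lemma first_order_at0 (f : R -> R) D : is_derive (0 : R^o) 1 (f : R^o -> R^o) D ->
  forall e, 0 < e -> exists2 r : R, 0 < r &
    forall t, `|t| < r -> `|f t - f 0 - D * t| <= e * `|t|.
Proof.
move=> df e /(derive1_first_order df)[r r0 hr]; exists r => // t tr.
by have := hr t; rewrite subr0; exact.
Qed.

(** Reduces to the derivatives at [0] of the real exponential, cosine and
    sine. *)
Lemma cexp_first_order e : 0 < e -> exists2 r : R, 0 < r &
  forall z, normc z < r -> normc (cexp z - 1 - z) <= e * normc z.
Proof.
(* the first-order errors [d * N] enter at most nine times in all *)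
move=> e0; have [d [d0 d1 de]] : exists d : R, [/\ 0 < d, d <= 1 & d <= e / 10].
  exists (Num.min (e / 10) 1); rewrite lt_min divr_gt0//= ltr01 !ge_min !lexx orbT.
  by split.
have [r1 r10 h1] := first_order_at0 (is_derive_expR 0) d0.
have [r2 r20 h2] := first_order_at0 (is_derive_cos 0) d0.
have [r3 r30 h3] := first_order_at0 (is_derive_sin 0) d0.
exists (Num.min (Num.min r1 r2) (Num.min r3 d)); first by rewrite !lt_min r10 r20 r30 d0.
move=> z; rewrite !lt_min => /andP[/andP[zr1 zr2] /andP[zr3 zd]].
have nx := normRe_le z; have ny := normIm_le z.
apply: (le_trans (normc_le _)).
case: z => x y in nx ny zr1 zr2 zr3 zd *; rewrite /= in nx ny zr1 zr2 zr3 zd *.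
set N := Num.sqrt _ in nx ny zr1 zr2 zr3 zd *.
have {h1} := h1 x (le_lt_trans nx zr1); rewrite expR0 mul1r => h1.
have {h2} := h2 y (le_lt_trans ny zr2); rewrite sin0 oppr0 mul0r subr0 cos0 => h2.
have {h3} := h3 y (le_lt_trans ny zr3); rewrite cos0 mul1r sin0 subr0 => h3.
rewrite addr0.
have N0 : 0 <= N := le_trans (normr_ge0 _) nx.
have dN : d * N <= e / 10 * N by rewrite ler_wpM2r.
have {}h1 : `|expR x - 1 - x| <= d * N by rewrite (le_trans h1)// ler_pM2l.
have {}h2 : `|cos y - 1| <= d * N by rewrite (le_trans h2)// ler_pM2l.
have {}h3 : `|sin y - y| <= d * N by rewrite (le_trans h3)// ler_pM2l.
have dN1 : d * N <= 1 * N by rewrite ler_wpM2r.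
have E1 : `|expR x - 1| <= 2 * N.
  have -> : expR x - 1 = (expR x - 1 - x) + x by ring.
  by apply: (le_trans (ler_normD _ _)); move: nx h1 dN1; lra.
have E2 : `|expR x| <= 3.
  have -> : expR x = (expR x - 1) + 1 by ring.
  by apply: (le_trans (ler_normD _ _)); rewrite normr1; move: E1 zd d1; lra.
have A : `|expR x * cos y - 1 - x| <= 4 * (d * N).
  have -> : expR x * cos y - 1 - x = (expR x - 1 - x) + expR x * (cos y - 1) by ring.
  apply: (le_trans (ler_normD _ _)); rewrite normrM.
  have := ler_pM (normr_ge0 _) (normr_ge0 _) E2 h2; move: h1; lra.
have B : `|expR x * sin y - y| <= 5 * (d * N).
  have -> : expR x * sin y - y = expR x * (sin y - y) + (expR x - 1) * y by ring.
  apply: (le_trans (ler_normD _ _)); rewrite !normrM.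
  have := ler_pM (normr_ge0 _) (normr_ge0 _) E2 h3.
  have := ler_pM (normr_ge0 _) (normr_ge0 _) E1 ny.
  have : N * N <= d * N by apply: ler_wpM2r => //; exact: ltW.
  lra.
have eN : 0 <= e * N by rewrite mulr_ge0// ltW.
move: A B dN eN; lra.
Qed.

Lemma is_derive_cexp z : is_derive (z : R[i]^o) 1 (cexp : R[i]^o -> R[i]^o) (cexp z).
Proof.
apply: first_order_is_derive => e e0.
have nz : 0 < normc (cexp z) by rewrite normc_gt0 cexp_neq0.
have [ee0 e'0] : e = (complex.Re e)%:C /\ 0 < complex.Re e.
  by move: e0; case: (e) => a b; rewrite ltcE/= => /andP[/eqP-> ?].
have [r r0 hr] := cexp_first_order (divr_gt0 e'0 nz).
exists r%:C; first by rewrite ltcR.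
move=> b; rewrite normC_E ltcR => /hr hb.
have -> : cexp b - cexp z - cexp z * (b - z) = cexp z * (cexp (b - z) - 1 - (b - z)).
  have -> : cexp b = cexp z * cexp (b - z) by rewrite -cexpD addrC subrK.
  by ring.
rewrite !normC_E ee0 -rmorphM lecR Normc.normcM.
by apply: (le_trans (ler_wpM2l (ltW nz) hb)); rewrite mulrA mulrCA divff ?mulr1 ?gt_eqF.
Qed.

End complex_exponential.

Section circle_mean.
Variable R : realType.
Implicit Types (Phi : R[i] -> R[i]) (a b : R).

(** The Cauchy-Riemann equations say that [Im Phi dx + Re Phi dy] is closed.
    By periodicity the horizontal sides of the rectangle [[a, b] x [0, 2 * pi]]
    cancel in its circulation, which leaves the two vertical ones. *)
Lemma circle_mean_const Phi a b : a <= b ->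
  (forall w, a <= complex.Re w <= b -> differentiable (Phi : R[i]^o -> R[i]^o) w) ->
  (forall x, Phi (Complex x 0) = Phi (Complex x (2 * pi))) ->
  segment_integral 0 (2 * pi) (fun y => complex.Re (Phi (Complex a y))) =
  segment_integral 0 (2 * pi) (fun y => complex.Re (Phi (Complex b y))).
Proof.
move=> ab dPhi per.
pose P x y := complex.Im (Phi (Complex x y)).
pose Q x y := complex.Re (Phi (Complex x y)).
have : boundary_integral P Q ((a, b), (0, 2 * pi)) = 0.
  apply: boundary_integral_eq0; first by split => //=; rewrite mulr_ge0// pi_ge0.
  move=> x y /= axb _; pose w := Complex x y.
  have [D dw] : exists D : R[i], is_derive (w : R[i]^o) 1 (Phi : R[i]^o -> R[i]^o) D.
    by eexists; apply/derivableP/derivable1_diffP; exact: dPhi.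
  have FO e : 0 < e -> exists2 r : R, 0 < r & forall x' y', `|x' - x| < r -> `|y' - y| < r ->
     normc (Phi (Complex x' y') - Phi w - D * Complex (x' - x) (y' - y)) <= e * (`|x' - x| + `|y' - y|).
    move=> e0; have ec0 : (0 : R[i]) < e%:C by rewrite ltcR.
    have [r r0 hr] := derive1_first_order dw ec0.
    have [er r'0] : r = (complex.Re r)%:C /\ 0 < complex.Re r.
      by move: r0; case: (r) => u v; rewrite ltcE/= => /andP[/eqP-> ?].
    exists (complex.Re r / 2); first by rewrite divr_gt0.
    move=> x' y' hx hy; have := hr (Complex x' y').
    have -> : Complex x' y' - w = Complex (x' - x) (y' - y) by [].
    rewrite !normC_E er ltcR => h.
    have nb : normc (Complex (x' - x) (y' - y)) <= `|x' - x| + `|y' - y| by exact: normc_le.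
    have {h} := h (le_lt_trans nb (_ : _ < _)).
    rewrite -rmorphM lecR => h; apply: (le_trans (h _)); last by rewrite ler_pM2l.
    by move: hx hy; lra.
  exists (complex.Im D), (complex.Re D), (- complex.Im D).
  split=> e /FO[r r0 hr]; exists r => // x' y' hx hy; apply: le_trans (hr x' y' hx hy).
    apply: le_trans (normIm_le _); rewrite !cImB cImM /P /w/=.
    by rewrite le_eqVlt; apply/orP; left; apply/eqP; congr (`|_|); ring.
  apply: le_trans (normRe_le _); rewrite !cReB cReM /P /w/=.
  by rewrite le_eqVlt; apply/orP; left; apply/eqP; congr (`|_|); ring.
rewrite /boundary_integral.
have -> : (P^~ 0) = (P^~ (2 * pi)) by apply/funext => x; rewrite /P per.
by rewrite subrr add0r => /eqP; rewrite subr_eq0 => /eqP ->.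
Qed.

End circle_mean.

(** * Complex-valued integrals *)

Section complex_integral.
Context d (T : measurableType d) (R : realType).
Variable mu : {measure set T -> \bar R}.
Implicit Types (D : set T) (u v : T -> R[i]) (c : R[i]).

Definition cmeas D u :=
  measurable_fun D (fun x => complex.Re (u x)) /\
  measurable_fun D (fun x => complex.Im (u x)).

Definition cintegrable D u :=
  mu.-integrable D (EFin \o (fun x => complex.Re (u x))) /\
  mu.-integrable D (EFin \o (fun x => complex.Im (u x))).

(** [cintegral] is the case of [lebesgue_Cn]; here the circle is needed as
    well. *)
Definition cint D u : R[i] :=
  Complex (\int[mu]_(x in D) complex.Re (u x))%R
          (\int[mu]_(x in D) complex.Im (u x))%R.

Lemma cmeas_cst D c : cmeas D (fun=> c).
Proof. by split; exact: measurable_cst. Qed.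

Lemma cmeasD D u v : cmeas D u -> cmeas D v -> cmeas D (fun x => u x + v x).
Proof.
move=> [u1 u2] [v1 v2]; split.
  rewrite [X in measurable_fun _ X](_ : _ = (fun x => complex.Re (u x) + complex.Re (v x)));
    last by apply/funext => x; exact: cReD.
  exact: measurable_funD.
rewrite [X in measurable_fun _ X](_ : _ = (fun x => complex.Im (u x) + complex.Im (v x)));
  last by apply/funext => x; exact: cImD.
exact: measurable_funD.
Qed.

Lemma cmeasM D u v : cmeas D u -> cmeas D v -> cmeas D (fun x => u x * v x).
Proof.
move=> [u1 u2] [v1 v2]; split.
  rewrite [X in measurable_fun _ X](_ : _ = (fun x => complex.Re (u x) * complex.Re (v x)
      - complex.Im (u x) * complex.Im (v x))); last by apply/funext => x; case: (u x) (v x) => ? ? [].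
  by apply: measurable_funB; exact: measurable_funM.
rewrite [X in measurable_fun _ X](_ : _ = (fun x => complex.Re (u x) * complex.Im (v x)
    + complex.Im (u x) * complex.Re (v x))); last by apply/funext => x; case: (u x) (v x) => ? ? [].
by apply: measurable_funD; exact: measurable_funM.
Qed.

Lemma cmeasN D u : cmeas D u -> cmeas D (fun x => - u x).
Proof.
move=> [u1 u2]; split.
  rewrite (_ : (fun _ => _) = (fun x => - complex.Re (u x))).
    exact: measurableT_comp.
  by apply/funext => x; case: (u x).
rewrite (_ : (fun _ => _) = (fun x => - complex.Im (u x))).
  exact: measurableT_comp.
by apply/funext => x; case: (u x).
Qed.

Lemma cmeasB D u v : cmeas D u -> cmeas D v -> cmeas D (fun x => u x - v x).
Proof. by move=> hu hv; apply: cmeasD => //; exact: cmeasN. Qed.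

Lemma cmeasJ D u : cmeas D u -> cmeas D (fun x => (u x)^*).
Proof.
move=> [u1 u2]; split.
  rewrite (_ : (fun _ => _) = (fun x => complex.Re (u x)))//.
  by apply/funext => x; case: (u x).
rewrite (_ : (fun _ => _) = (fun x => - complex.Im (u x))).
  exact: measurableT_comp.
by apply/funext => x; case: (u x).
Qed.

Lemma cmeasX D u n : cmeas D u -> cmeas D (fun x => u x ^+ n).
Proof.
move=> hu; elim: n => [|n ih]; first exact: cmeas_cst.
by under eq_fun do rewrite exprS; exact: cmeasM.
Qed.

Lemma cmeas_real D (f : T -> R) : measurable_fun D f -> cmeas D (fun x => (f x)%:C).
Proof. by move=> mf; split => //; exact: measurable_cst. Qed.

Lemma cmeas_prod D (I : Type) (r : seq I) (F : I -> T -> R[i]) :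
  (forall i, cmeas D (F i)) -> cmeas D (fun x => \prod_(i <- r) F i x).
Proof.
move=> hF; elim: r => [|i r ih].
  by under eq_fun do rewrite big_nil; exact: cmeas_cst.
by under eq_fun do rewrite big_cons; exact: cmeasM.
Qed.

Lemma cmeas_sqr_normc D u : cmeas D u -> measurable_fun D (fun x => normc (u x) ^+ 2).
Proof.
move=> [u1 u2]; under eq_fun do rewrite sqr_normcE.
by apply: measurable_funD; exact: measurable_funX.
Qed.

Lemma cmeas_normc D u : cmeas D u -> measurable_fun D (fun x => normc (u x)).
Proof.
move=> hu; rewrite (_ : (fun _ => _) = Num.sqrt \o (fun x => normc (u x) ^+ 2)).
  by apply: measurableT_comp; [by apply: continuous_measurable_fun; apply: sqrt_continuous|exact: cmeas_sqr_normc].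
by apply/funext => x /=; rewrite sqrtr_sqr ger0_norm// normc_ge0.
Qed.

Lemma cmeasS D D' u : measurable D -> D' `<=` D -> cmeas D u -> cmeas D' u.
Proof. by move=> mD sD [u1 u2]; split; exact: (measurable_funS mD). Qed.

Lemma eq_cmeas D u v : {in D, u =1 v} -> cmeas D u -> cmeas D v.
Proof.
by move=> uv [u1 u2]; split; [move: u1|move: u2]; apply: eq_measurable_fun => x /uv ->.
Qed.

Lemma cintegrableS D D' u : measurable D -> measurable D' -> D' `<=` D ->
  cintegrable D u -> cintegrable D' u.
Proof. by move=> mD mD' sD [u1 u2]; split; exact: (integrableS mD). Qed.

Section on_domain.
Variable (D : set T).
Hypothesis mD : measurable D.

Lemma cintegrable_dominated u (f : T -> R) : cmeas D u ->
  mu.-integrable D (EFin \o f) -> (forall x, D x -> normc (u x) <= f x) ->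
  cintegrable D u.
Proof.
move=> [mu1 mu2] fi uf; split; apply: (le_integrable mD _ _ fi).
- exact/measurable_EFinP.
- move=> x Dx /=; rewrite lee_fin (le_trans (normRe_le _))//.
  by rewrite (le_trans (uf _ Dx))// ler_norm.
- exact/measurable_EFinP.
- move=> x Dx /=; rewrite lee_fin (le_trans (normIm_le _))//.
  by rewrite (le_trans (uf _ Dx))// ler_norm.
Qed.

Lemma cintegrable_cmeas u : cintegrable D u -> cmeas D u.
Proof.
by move=> [/measurable_int/measurable_EFinP ? /measurable_int/measurable_EFinP ?].
Qed.

Lemma cintegrable_normc u : cintegrable D u ->
  mu.-integrable D (EFin \o (fun x => normc (u x))).
Proof.
move=> iu; have := integrableD mD (integrable_norm iu.1) (integrable_norm iu.2).
move/(le_integrable mD); apply.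
  exact/measurable_EFinP/cmeas_normc/cintegrable_cmeas.
move=> x Dx /=; rewrite lee_fin ger0_norm ?normc_ge0// (le_trans (normc_le _))//.
by rewrite ler_norm.
Qed.

Lemma cintegrableP u : cmeas D u ->
  cintegrable D u <-> (\int[mu]_(x in D) (normc (u x))%:E < +oo)%E.
Proof.
move=> mu_; split=> [/cintegrable_normc/integrableP[_]|h].
  by under eq_integral do rewrite /= ger0_norm ?normc_ge0//.
apply: (@cintegrable_dominated u (fun x => normc (u x)) mu_) => //.
apply/integrableP; split; first exact/measurable_EFinP/cmeas_normc.
by under eq_integral do rewrite /= ger0_norm ?normc_ge0//.
Qed.

Lemma cintegrableD u v : cintegrable D u -> cintegrable D v ->
  cintegrable D (fun x => u x + v x).
Proof.
move=> iu iv; apply: (cintegrable_dominated _ (f := fun x => normc (u x) + normc (v x))).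
- by apply: cmeasD; exact: cintegrable_cmeas.
- exact: (integrableD mD (cintegrable_normc iu) (cintegrable_normc iv)).
- by move=> x _; exact: normcD_le.
Qed.

Lemma cintegrable_mul_bounded u v (B : R) : cintegrable D u -> cmeas D v ->
  (forall x, D x -> normc (v x) <= B) -> cintegrable D (fun x => u x * v x).
Proof.
move=> iu mv vB; apply: (cintegrable_dominated _ (f := fun x => B * normc (u x))).
- by apply: cmeasM => //; exact: cintegrable_cmeas.
- exact: (integrableZl mD B (cintegrable_normc iu)).
- by move=> x Dx; rewrite Normc.normcM mulrC ler_wpM2r ?normc_ge0// vB.
Qed.

Lemma cintegrableZ c u : cintegrable D u -> cintegrable D (fun x => c * u x).
Proof.
move=> iu; under eq_fun do rewrite mulrC.
by apply: (@cintegrable_mul_bounded _ _ (normc c)) => //; exact: cmeas_cst.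
Qed.

Lemma cintegrableN u : cintegrable D u -> cintegrable D (fun x => - u x).
Proof. by move=> iu; under eq_fun do rewrite -mulN1r; exact: cintegrableZ. Qed.

Lemma cintegrableJ u : cintegrable D u -> cintegrable D (fun x => (u x)^*).
Proof.
move=> iu; apply: (cintegrable_dominated _ (cintegrable_normc iu)).
  exact/cmeasJ/cintegrable_cmeas.
by move=> x _; rewrite normcJ.
Qed.

Lemma cintegrable_bounded u (B : R) : (mu D < +oo)%E -> cmeas D u ->
  (forall x, D x -> normc (u x) <= B) -> cintegrable D u.
Proof.
move=> fD mu_ uB; apply: (cintegrable_dominated _ (f := fun=> B)) => //.
apply/integrableP; split; first exact/measurable_EFinP/measurable_cst.
by rewrite /= integral_cst// lte_mul_pinfty ?lee_fin// fin_numElt ltNye.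
Qed.

Lemma eq_cintegrable u v : {in D, u =1 v} -> cintegrable D u -> cintegrable D v.
Proof.
move=> uv iu; apply: (cintegrable_dominated _ (cintegrable_normc iu)).
  exact: eq_cmeas uv (cintegrable_cmeas iu).
by move=> x Dx; rewrite uv// inE.
Qed.

Lemma cintD u v : cintegrable D u -> cintegrable D v ->
  cint D (fun x => u x + v x) = cint D u + cint D v.
Proof.
move=> [u1 u2] [v1 v2]; rewrite /cint.
under eq_Rintegral do rewrite cReD.
under [X in Complex _ X]eq_Rintegral do rewrite cImD.
by rewrite !RintegralD.
Qed.

Lemma cintZ c u : cintegrable D u -> cint D (fun x => c * u x) = c * cint D u.
Proof.
move=> [u1 u2]; rewrite /cint.
under eq_Rintegral do rewrite cReM.
under [X in Complex _ X]eq_Rintegral do rewrite cImM.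
have Z r f : mu.-integrable D (EFin \o f) -> mu.-integrable D (EFin \o (fun x => r * f x)).
  by move=> fi; exact: (integrableZl mD r fi).
rewrite RintegralB ?RintegralD//; try exact: Z.
by rewrite !RintegralZl//; case: c.
Qed.

Lemma cintN u : cintegrable D u -> cint D (fun x => - u x) = - cint D u.
Proof.
by move=> iu; under eq_fun do rewrite -mulN1r; rewrite cintZ// mulN1r.
Qed.

Lemma cintB u v : cintegrable D u -> cintegrable D v ->
  cint D (fun x => u x - v x) = cint D u - cint D v.
Proof. by move=> iu iv; rewrite cintD ?cintN//; exact: cintegrableN. Qed.

Lemma cintJ u : cintegrable D u -> cint D (fun x => (u x)^*) = (cint D u)^*.
Proof.
move=> [u1 u2]; rewrite /cint/=; congr Complex.
  by apply: eq_Rintegral => x _; case: (u x).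
have -> : (\int[mu]_(x in D) complex.Im ((u x)^*))%R =
    (\int[mu]_(x in D) ((-1) * complex.Im (u x)))%R.
  by apply: eq_Rintegral => x _; case: (u x) => a b/=; rewrite mulN1r.
by rewrite RintegralZl// mulN1r.
Qed.

Lemma eq_cint u v : {in D, u =1 v} -> cint D u = cint D v.
Proof.
by move=> uv; congr Complex; apply: eq_Rintegral => x /uv ->.
Qed.

Lemma cintegrable_sum (I : Type) (r : seq I) (F : I -> T -> R[i]) :
  (forall i, cintegrable D (F i)) -> cintegrable D (fun x => \sum_(i <- r) F i x).
Proof.
move=> hF; elim: r => [|i r ih].
  by under eq_fun do rewrite big_nil; split; exact: integrable0.
by under eq_fun do rewrite big_cons; exact: cintegrableD.
Qed.

Lemma cint_sum (I : Type) (r : seq I) (F : I -> T -> R[i]) :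
  (forall i, cintegrable D (F i)) ->
  cint D (fun x => \sum_(i <- r) F i x) = \sum_(i <- r) cint D (F i).
Proof.
move=> hF; elim: r => [|i r ih].
  under eq_fun do rewrite big_nil.
  by rewrite big_nil /cint Rintegral_cst// mul0r.
under eq_fun do rewrite big_cons.
by rewrite big_cons cintD// ?ih//; exact: cintegrable_sum.
Qed.

Lemma cint_real (f : T -> R) : cint D (fun x => (f x)%:C) = (\int[mu]_(x in D) f x)%R%:C.
Proof. by rewrite /cint/= Rintegral_cst// mul0r. Qed.

Lemma cint_cst c : cint D (fun=> c) = c * (fine (mu D))%:C.
Proof. by case: c => a b; rewrite /cint !Rintegral_cst//=; simpc. Qed.

(** Lets an equality between real parts of integrals, when it is known for all
    complex multiples of the integrands, be used for the imaginary parts. *)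
Lemma Im_cint u : complex.Im (cint D u) =
  (\int[mu]_(x in D) complex.Re (- 'i%C * u x))%R.
Proof.
by rewrite /=; apply: eq_Rintegral => x _; case: (u x) => a b /=; ring.
Qed.

End on_domain.
End complex_integral.

Section fubini.
Context d1 d2 (T1 : measurableType d1) (T2 : measurableType d2) (R : realType).
Variable m1 : {sigma_finite_measure set T1 -> \bar R}.
Variable m2 : {sigma_finite_measure set T2 -> \bar R}.
Variables (D1 : set T1) (D2 : set T2).
Hypotheses (mD1 : measurable D1) (mD2 : measurable D2).

(** The uniform bound [A] on the inner integrals and the finite measure of [D1]
    make the extension of [f] by zero integrable on the product space. *)
Lemma Rintegral_swap (f : T1 -> T2 -> R) (A : R) :
  measurable_fun (D1 `*` D2) (fun p => f p.1 p.2) ->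
  (m1 D1 < +oo)%E ->
  (forall x, D1 x -> (\int[m2]_(y in D2) `|f x y|%:E <= A%:E)%E) ->
  (forall x, D1 x -> m2.-integrable D2 (EFin \o f x)) ->
  (forall y, D2 y -> m1.-integrable D1 (EFin \o f^~ y)) ->
  (\int[m1]_(x in D1) (\int[m2]_(y in D2) f x y) =
   \int[m2]_(y in D2) (\int[m1]_(x in D1) f x y))%R.
Proof.
move=> mf fD1 fA i1 i2.
have mD : measurable (D1 `*` D2) by exact: measurableX.
pose g (p : T1 * T2) : \bar R := ((fun p => (f p.1 p.2)%:E) \_ (D1 `*` D2)) p.
have mg : measurable_fun setT g.
  by apply/(measurable_restrictT _ mD); exact/measurable_EFinP.
have gE x y : g (x, y) = ((fun x => ((fun y => (f x y)%:E) \_ D2) y) \_ D1) x.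
  rewrite /g !patchE/= in_setX/=.
  by case: (x \in D1); case: (y \in D2).
have EL : (\int[m1]_x \int[m2]_y g (x, y) =
   \int[m1]_(x in D1) \int[m2]_(y in D2) (f x y)%:E)%E.
  rewrite [RHS]integral_mkcond; apply: eq_integral => x _; rewrite patchE.
  case: ifPn => xD.
    rewrite [RHS]integral_mkcond; apply: eq_integral => y _.
    by rewrite gE patchE xD.
  apply: integral0_eq => y _; by rewrite gE patchE (negbTE xD).
have ER : (\int[m2]_y \int[m1]_x g (x, y) =
   \int[m2]_(y in D2) \int[m1]_(x in D1) (f x y)%:E)%E.
  rewrite [RHS]integral_mkcond; apply: eq_integral => y _; rewrite patchE.
  case: ifPn => yD.
    rewrite [RHS]integral_mkcond; apply: eq_integral => x _.
    by rewrite gE !patchE yD.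
  by apply: integral0_eq => x _; rewrite gE !patchE (negbTE yD) if_same.
have ig : (m1 \x m2)%E.-integrable setT g.
  apply/(integrable12ltyP m1 m2 mg).
  apply: (@le_lt_trans _ _ (\int[m1]_x ((fun=> A%:E) \_ D1) x)%E); last first.
    rewrite -integral_mkcond integral_cst//.
    by have [A0|A0] := leP 0 A; [rewrite lte_mul_pinfty|rewrite (le_lt_trans (mule_le0_ge0 _ _))// ?lee_fin ?ltW].
  apply: ge0_le_integral => //.
  - by move=> x _; apply: integral_ge0.
  - apply: (@measurable_fun_fubini_tonelli_F _ _ _ _ _ m2 (fun p => `|g p|%E)) => //; exact: measurableT_comp.
  - by apply/(measurable_restrictT _ mD1); exact: measurable_cst.
  move=> x _; rewrite patchE; case: ifPn => xD.
    apply: le_trans (fA x (set_mem xD)); rewrite [leRHS]integral_mkcond.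
    rewrite le_eqVlt; apply/orP; left; apply/eqP; apply: eq_integral => y _.
    by rewrite gE !patchE xD; case: ifP => //; rewrite abse0.
  by rewrite integral0_eq// => y _; rewrite gE patchE (negbTE xD) abse0.
have /= := Fubini ig; rewrite EL ER => h.
have fin1 x : D1 x -> (\int[m2]_(y in D2) (f x y)%:E)%E =
    ((\int[m2]_(y in D2) f x y)%R)%:E.
  by move=> /i1 ii; rewrite /Rintegral fineK//; exact: integrable_fin_num.
have fin2 y : D2 y -> (\int[m1]_(x in D1) (f x y)%:E)%E =
    ((\int[m1]_(x in D1) f x y)%R)%:E.
  by move=> /i2 ii; rewrite /Rintegral fineK//; exact: integrable_fin_num.
move: h; rewrite (eq_integral (fun x => ((\int[m2]_(y in D2) f x y)%R)%:E)); last first.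
  by move=> x /set_mem /fin1.
rewrite [X in _ = X](eq_integral (fun y => ((\int[m1]_(x in D1) f x y)%R)%:E)); last first.
  by move=> y /set_mem /fin2.
by rewrite {1 3}/Rintegral => ->.
Qed.

Lemma cint_swap (f : T1 -> T2 -> R[i]) (A : R) :
  cmeas (D1 `*` D2) (fun p => f p.1 p.2) ->
  (m1 D1 < +oo)%E ->
  (forall x, D1 x -> (\int[m2]_(y in D2) (normc (f x y))%:E <= A%:E)%E) ->
  (forall x, D1 x -> cintegrable m2 D2 (f x)) ->
  (forall y, D2 y -> cintegrable m1 D1 (f^~ y)) ->
  cint m1 D1 (fun x => cint m2 D2 (f x)) =
  cint m2 D2 (fun y => cint m1 D1 (f^~ y)).
Proof.
move=> [mf1 mf2] fD1 fA i1 i2; rewrite /cint/=.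
have dom (h : R[i] -> R) : (forall z, `|h z| <= normc z) ->
    (forall x, D1 x -> measurable_fun D2 (fun y => h (f x y))) ->
    forall x, D1 x -> (\int[m2]_(y in D2) `|h (f x y)|%:E <= A%:E)%E.
  move=> hn mh x D1x; apply: le_trans (fA x D1x); apply: ge0_le_integral => //.
  - have := mh x D1x; move=> /(measurableT_comp (@normr_measurable R setT)) hh; exact/measurable_EFinP.
  - by apply/measurable_EFinP/cmeas_normc/(cintegrable_cmeas (i1 x D1x)).
  - by move=> y D2y; rewrite lee_fin.
congr Complex; apply: (@Rintegral_swap _ A) => //.
- apply: dom; first exact: normRe_le.
  by move=> x /i1/cintegrable_cmeas[].
- by move=> x /i1[].
- by move=> y /i2[].
- apply: dom; first exact: normIm_le.
  by move=> x /i1/cintegrable_cmeas[].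
- by move=> x /i1[].
- by move=> y /i2[].
Qed.

End fubini.

(** * Measure-preserving maps *)

Section measure_preserving.
Context d (T : measurableType d) (R : realType).
Implicit Types (mu : {measure set T -> \bar R}).

Definition measure_preserving mu (phi : T -> T) :=
  measurable_fun setT phi /\ forall A, measurable A -> mu (phi @^-1` A) = mu A.

Lemma measure_preserving_comp mu phi psi :
  measure_preserving mu phi -> measure_preserving mu psi ->
  measure_preserving mu (phi \o psi).
Proof.
move=> [mphi hphi] [mpsi hpsi]; split; first exact: measurableT_comp.
move=> A mA; rewrite comp_preimage hpsi ?hphi//.
by rewrite -[X in measurable X]setTI; exact: mphi.
Qed.

Lemma measure_preserving_id mu : measure_preserving mu id.
Proof. by split => //; exact: measurable_id. Qed.

Section change_of_variables.
Variables (mu : {measure set T -> \bar R}) (phi : T -> T) (D : set T).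
Hypotheses (phi_mp : measure_preserving mu phi) (mD : measurable D).
Hypothesis phiD : phi @^-1` D = D.

Let ge0_integral_measure_preserving (f : T -> \bar R) : measurable_fun D f ->
  (forall x, D x -> 0 <= f x)%E ->
  (\int[mu]_(x in D) f (phi x) = \int[mu]_(x in D) f x)%E.
Proof.
move=> mf f0; have [mphi hphi] := phi_mp.
rewrite [RHS](eq_measure_integral
    (measure_function_pushforward__canonical__measure_function_Measure mu mphi)).
  by rewrite [RHS](ge0_integral_pushforward mphi)// ?phiD// => x /set_mem; exact: f0.
by move=> A mA _; rewrite /= /pushforward hphi.
Qed.

Lemma integral_measure_preserving (f : T -> \bar R) : measurable_fun D f ->
  (\int[mu]_(x in D) f (phi x) = \int[mu]_(x in D) f x)%E.
Proof.
move=> mf; rewrite [RHS]integralE [LHS]integralE.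
rewrite -(ge0_integral_measure_preserving (measurable_funepos mf))//.
rewrite -(ge0_integral_measure_preserving (measurable_funeneg mf))//.
by congr (_ - _)%E; apply: eq_integral => x _; rewrite ?funeposE ?funenegE.
Qed.

Lemma measurable_fun_preserving (d' : measure_display) (T' : measurableType d') (f : T -> T') :
  measurable_fun D f -> measurable_fun D (f \o phi).
Proof.
have [mphi _] := phi_mp; move=> mf; apply: (measurable_comp mD _ mf).
  by move=> _ [x + <-]; rewrite -{1}phiD.
exact: measurable_funTS.
Qed.

Lemma cmeas_preserving (u : T -> R[i]) : cmeas D u -> cmeas D (u \o phi).
Proof.
move=> [u1 u2]; split.
  exact: (measurable_fun_preserving u1).
exact: (measurable_fun_preserving u2).
Qed.

Lemma cint_measure_preserving (u : T -> R[i]) : cmeas D u ->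
  cint mu D (fun x => u (phi x)) = cint mu D u.
Proof.
move=> [u1 u2]; congr Complex; rewrite /Rintegral.
  by rewrite (@integral_measure_preserving (fun x => (complex.Re (u x))%:E))//; exact/measurable_EFinP.
by rewrite (@integral_measure_preserving (fun x => (complex.Im (u x))%:E))//; exact/measurable_EFinP.
Qed.

Lemma cintegrable_measure_preserving (u : T -> R[i]) : cintegrable mu D u ->
  cintegrable mu D (fun x => u (phi x)).
Proof.
move=> iu; have mu_ := cintegrable_cmeas iu.
apply/cintegrableP => //; first exact: cmeas_preserving.
rewrite (@integral_measure_preserving (fun x => (normc (u x))%:E)).
  exact/cintegrableP.
exact/measurable_EFinP/cmeas_normc.
Qed.

End change_of_variables.
End measure_preserving.

Section product_preserving.
Context d1 d2 (T1 : measurableType d1) (T2 : measurableType d2) (R : realType).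
Variable m1 : {sigma_finite_measure set T1 -> \bar R}.
Variable m2 : {sigma_finite_measure set T2 -> \bar R}.

Lemma measure_preserving_prod phi psi :
  measure_preserving m1 phi -> measure_preserving m2 psi ->
  measure_preserving (m1 \x m2)%E (fun p => (phi p.1, psi p.2)).
Proof.
move=> [mphi hphi] [mpsi hpsi].
have mpp : measurable_fun setT (fun p : T1 * T2 => (phi p.1, psi p.2)).
  by apply/measurable_fun_pair; exact: measurableT_comp.
split=> // A mA; symmetry.
apply: (@product_measure_unique _ _ _ _ _ m1 m2
  (measure_function_pushforward__canonical__measure_function_Measure _ mpp)) => //.
move=> B C mB mC /=; rewrite /pushforward.
rewrite (_ : _ @^-1` _ = (phi @^-1` B) `*` (psi @^-1` C))//.
rewrite product_measure1E; first by rewrite hphi ?hpsi.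
  by rewrite -[X in measurable X]setTI; exact: mphi.
by rewrite -[X in measurable X]setTI; exact: mpsi.
Qed.

End product_preserving.

Section power_preserving.
Context d (T : measurableType d) (R : realType).
Variable mu : {sigma_finite_measure set T -> \bar R}.

Definition tuple_map n (phi : 'I_n -> T -> T) (t : n.-tuple T) : n.-tuple T :=
  [tuple phi i (tnth t i) | i < n].

Lemma measurable_tuple_map n (phi : 'I_n -> T -> T) :
  (forall i, measurable_fun setT (phi i)) -> measurable_fun setT (tuple_map phi).
Proof.
move=> mphi; apply/measurable_fun_tnthP => i.
rewrite (_ : _ \o _ = phi i \o (@tnth n T)^~ i).
  by apply: measurableT_comp => //; exact: measurable_tnth.
by apply/funext => t /=; rewrite tnth_mktuple.
Qed.

Lemma measure_preserving_power n (phi : 'I_n -> T -> T) :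
  (forall i, measure_preserving mu (phi i)) ->
  measure_preserving (power_measure mu n) (tuple_map phi).
Proof.
move=> hphi; split; first by apply: measurable_tuple_map => i; have [] := hphi i.
elim: n phi hphi => [|n ih] phi hphi A mA.
  rewrite /= (_ : _ @^-1` _ = A)//; apply/seteqP.
  by split=> x; rewrite (tuple0 x) /= (tuple0 (tuple_map _ _)).
pose psi := fun i : 'I_n => phi (lift ord0 i).
have mpsi : measure_preserving (power_measure mu n) (tuple_map psi).
  split; last by move=> B mB; apply: ih => // i; exact: hphi.
  by apply: measurable_tuple_map => i; have [] := hphi (lift ord0 i).
have [_ hprod] := measure_preserving_prod (hphi ord0) mpsi.
have E p : tcons (phi ord0 p.1, tuple_map psi p.2) = tuple_map phi (tcons p).
  case: p => x t; apply: eq_from_tnth => i; rewrite tnth_mktuple.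
  have [j ->|->] := unliftP ord0 i; last by rewrite !tnth0.
  by rewrite !tnthS /= tnth_mktuple.
have mtA : measurable (@tcons _ T n @^-1` A).
  by rewrite -[X in measurable X]setTI; exact: measurable_tcons.
have h := hprod _ mtA.
change ((mu \x power_measure mu n)%E (@tcons _ T n @^-1` (tuple_map phi @^-1` A)) =
  (mu \x power_measure mu n)%E (@tcons _ T n @^-1` A)).
rewrite -h; congr ((_ \x _)%E _).
by apply/seteqP; split => p; rewrite /preimage /mkset E.
Qed.

End power_preserving.

Section planar_rotation.
Variable R : realType.
Local Notation MR := (measurableTypeR R).
Local Notation lambda := (@lebesgue_measure R).

Lemma lebesgue_measure_translation (t : R) :
  measure_preserving lambda (fun x : MR => x + t).
Proof.
have mt : measurable_fun setT (fun x : MR => x + t : MR) by exact: measurable_funD.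
split=> // A mA; symmetry.
apply: (@lebesgue_measure_unique R
  (measure_function_pushforward__canonical__measure_function_Measure lambda mt)) => //.
move=> _ [[a b] /= _ <-]; rewrite /pushforward.
rewrite (_ : _ @^-1` _ = `]a - t, b - t]%classic); last first.
  by apply/seteqP; split => x; rewrite /preimage/= !in_itv/= ltrBlDr lerBrDr.
rewrite !lebesgue_measure_itv/= !lte_fin ltrD2r.
by case: ifP => // _; congr (_%:E); ring.
Qed.

Lemma shear_preserving (t : R) :
  measure_preserving (@lebesgue_measure2 R) (fun p : MR * MR => (p.1, p.2 + t * p.1)).
Proof.
have ms : measurable_fun setT (fun p : MR * MR => (p.1, p.2 + t * p.1) : MR * MR).
  by apply/measurable_fun_pair => //; apply: measurable_funD => //; exact: measurable_funM.
split=> // A mA; rewrite /lebesgue_measure2 /product_measure1.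
apply: eq_integral => x _ /=.
have [mt ht] := lebesgue_measure_translation (t * x).
rewrite -[RHS]ht; last exact: measurable_xsection.
congr (lambda _); apply/seteqP; split => y; rewrite /xsection/=; by rewrite !inE.
Qed.

Lemma swap_preserving :
  measure_preserving (@lebesgue_measure2 R) (fun p : MR * MR => (p.2, p.1)).
Proof.
have ms : measurable_fun setT (fun p : MR * MR => (p.2, p.1) : MR * MR).
  exact/measurable_fun_pair.
split=> // A mA; symmetry.
apply: (@product_measure_unique _ _ _ _ _ lambda lambda
  (measure_function_pushforward__canonical__measure_function_Measure
    (@lebesgue_measure2 R) ms)) => //.
move=> B C mB mC /=; rewrite /pushforward.
rewrite (_ : _ @^-1` _ = C `*` B); last by apply/seteqP; split => p [].
by rewrite /lebesgue_measure2 product_measure1E// muleC.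
Qed.

(** A rotation with [b != 0] is a product of three shears, and the half turn is
    the square of a quarter turn. *)
Lemma rotation_preserving (a b : R) : a ^+ 2 + b ^+ 2 = 1 ->
  measure_preserving (@lebesgue_measure2 R)
    (fun p : MR * MR => (a * p.1 - b * p.2, a * p.2 + b * p.1)).
Proof.
have shear' t : measure_preserving (@lebesgue_measure2 R)
    (fun p : MR * MR => (p.1 + t * p.2, p.2)).
  rewrite (_ : (fun _ => _) = (fun p : MR * MR => (p.2, p.1)) \o
     (fun p : MR * MR => (p.1, p.2 + t * p.1)) \o (fun p : MR * MR => (p.2, p.1)))//.
  apply: measure_preserving_comp; last exact: swap_preserving.
  by apply: measure_preserving_comp; [exact: swap_preserving|exact: shear_preserving].
(* the shears have parameters [t], [b] and [t], where [t] is minus the tangent of the half angle *)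
have main (a' b' : R) : b' != 0 -> a' ^+ 2 + b' ^+ 2 = 1 -> measure_preserving (@lebesgue_measure2 R)
    (fun p : MR * MR => (a' * p.1 - b' * p.2, a' * p.2 + b' * p.1)).
  move=> b0 ab1; pose t := (a' - 1) / b'.
  rewrite (_ : (fun _ => _) = (fun p : MR * MR => (p.1 + t * p.2, p.2)) \o
    (fun p : MR * MR => (p.1, p.2 + b' * p.1)) \o (fun p : MR * MR => (p.1 + t * p.2, p.2))).
    apply: measure_preserving_comp; last exact: shear'.
    by apply: measure_preserving_comp; [exact: shear'|exact: shear_preserving].
  have tb : t * b' = a' - 1 by rewrite /t divfK.
  have ta : t * (a' + 1) = - b'.
    apply: (mulIf b0); rewrite mulrAC tb -subr_sqr expr1n.
    by rewrite -ab1; ring.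
  apply/funext => -[x y] /=; congr (_, _).
    transitivity ((1 + t * b') * x + (t * (2 + t * b')) * y); last by ring.
    by rewrite tb (_ : 2 + (a' - 1) = a' + 1) ?ta; ring.
  by transitivity ((1 + t * b') * y + b' * x); [rewrite tb; ring|ring].
have [->|b0] := eqVneq b 0; last exact: main.
rewrite expr0n/= addr0 => /eqP; rewrite sqrf_eq1 => /orP[/eqP ->|/eqP ->].
  rewrite (_ : (fun _ => _) = id); first exact: measure_preserving_id.
  by apply/funext => -[x y] /=; congr (_, _); ring.
rewrite (_ : (fun _ => _) = (fun p : MR * MR => (0 * p.1 - 1 * p.2, 0 * p.2 + 1 * p.1)) \o
  (fun p : MR * MR => (0 * p.1 - 1 * p.2, 0 * p.2 + 1 * p.1))).
  by apply: measure_preserving_comp; apply: main; rewrite ?oner_neq0//; ring.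
by apply/funext => -[x y] /=; congr (_, _); ring.
Qed.

End planar_rotation.

(** * Lebesgue measure on complex space *)

Section complex_space_measure.
Variables (R : realType) (n : nat).
Local Notation Cn := 'rV[R[i]]_n.
Local Notation dV := (lebesgue_Cn R n).
Local Notation MR := (measurableTypeR R).
Implicit Types (z w u : Cn).

Definition tuple_of_row z : n.-tuple (MR * MR) :=
  [tuple (complex.Re (z ord0 j), complex.Im (z ord0 j)) | j < n].

Lemma tuple_of_rowK : cancel tuple_of_row (@row_of_reals R n).
Proof.
by move=> z; apply/rowP => j; rewrite !mxE tnth_mktuple/=; case: (z ord0 j).
Qed.

Lemma row_of_realsK : cancel (@row_of_reals R n) tuple_of_row.
Proof.
by move=> t; apply: eq_from_tnth => j; rewrite tnth_mktuple !mxE/=; case: (tnth t j).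
Qed.

Lemma cmeas_coord j : cmeas [set: Cn] (fun z => z ord0 j).
Proof.
have mt : measurable_fun setT (fun t : n.-tuple (MR * MR) => tnth t j) by exact: measurable_tnth.
split=> _ A mA; rewrite setTI /measurable/=.
  rewrite (_ : _ @^-1` _ = (fst \o (fun t : n.-tuple (MR * MR) => tnth t j)) @^-1` A).
    by rewrite -[X in measurable X]setTI; apply: measurableT_comp.
  by apply/seteqP; split => t; rewrite /preimage/= !mxE/=.
rewrite (_ : _ @^-1` _ = (snd \o (fun t : n.-tuple (MR * MR) => tnth t j)) @^-1` A).
  by rewrite -[X in measurable X]setTI; apply: measurableT_comp.
by apply/seteqP; split => t; rewrite /preimage/= !mxE/=.
Qed.

Lemma measurable_to_row d (X : measurableType d) (F : X -> Cn) :
  (forall j, cmeas setT (fun x => F x ord0 j)) -> measurable_fun setT F.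
Proof.
move=> mF _ A mA; rewrite setTI.
have mT : measurable_fun setT (tuple_of_row \o F).
  apply/measurable_fun_tnthP => j.
  rewrite (_ : _ \o _ = (fun x => (complex.Re (F x ord0 j), complex.Im (F x ord0 j)))).
    by have [mRe mIm] := mF j; apply/measurable_fun_pair.
  by apply/funext => x /=; rewrite tnth_mktuple.
rewrite (_ : F @^-1` A = (tuple_of_row \o F) @^-1` (@row_of_reals R n @^-1` A)).
  by rewrite -[X in measurable X]setTI; apply: mT.
by apply/seteqP; split => x; rewrite /preimage/= tuple_of_rowK.
Qed.

Lemma measurable_tuple_of_row : measurable_fun setT tuple_of_row.
Proof.
apply/measurable_fun_tnthP => j.
rewrite (_ : _ \o _ = (fun z : Cn => (complex.Re (z ord0 j), complex.Im (z ord0 j)))).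
  by have [mRe mIm] := cmeas_coord j; apply/measurable_fun_pair.
by apply/funext => x /=; rewrite tnth_mktuple.
Qed.

Let lebesgue_Cn_sigma_finite : sigma_finite setT dV.
Proof.
have [F FT mF] := sigma_finiteT (power_measure (@lebesgue_measure2 R) n).
exists (fun k => tuple_of_row @^-1` F k); first by rewrite -preimage_bigcup -FT.
move=> k; have [mFk Fkoo] := mF k; split.
  by rewrite -[X in measurable X]setTI; exact: measurable_tuple_of_row.
rewrite /lebesgue_Cn /pushforward -comp_preimage.
by rewrite (_ : _ \o _ = id) //; apply/funext => x /=; rewrite row_of_realsK.
Qed.

HB.instance Definition _ := Measure_isSigmaFinite.Build _ _ _ dV
  lebesgue_Cn_sigma_finite.

Definition cmul u z : Cn := \row_j (u ord0 j * z ord0 j).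

Definition unimodular u := forall j, normc (u ord0 j) = 1.

(** On each coordinate, multiplication by a unimodular number is a planar
    rotation. *)
Lemma cmul_preserving u : unimodular u -> measure_preserving dV (cmul u).
Proof.
move=> u1; split.
  apply: measurable_to_row => j; under eq_fun do rewrite mxE.
  by apply: cmeasM; [exact: cmeas_cst|exact: cmeas_coord].
move=> A mA; rewrite /lebesgue_Cn /pushforward.
pose phi j (p : MR * MR) : MR * MR :=
  (complex.Re (u ord0 j) * p.1 - complex.Im (u ord0 j) * p.2,
   complex.Re (u ord0 j) * p.2 + complex.Im (u ord0 j) * p.1).
have phi_mp j : measure_preserving (@lebesgue_measure2 R) (phi j).
  by apply: rotation_preserving; rewrite -sqr_normcE u1 expr1n.
have [_ /(_ (@row_of_reals R n @^-1` A) mA) h] := measure_preserving_power phi_mp.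
rewrite -[RHS]h.
have E t : cmul u (row_of_reals t) = row_of_reals (tuple_map phi t).
  apply/rowP => j; rewrite !mxE tnth_mktuple /phi; case: (u ord0 j) => a b.
  by congr Complex => /=; ring.
by congr (power_measure _ _ _); apply/seteqP; split => t; rewrite /preimage /mkset E.
Qed.

Lemma lebesgue_Cn_coord_eq0 j : dV [set z | z ord0 j = 0] = 0%E.
Proof.
rewrite /lebesgue_Cn /pushforward.
pose A (i : 'I_n) : set (MR * MR) := if i == j then [set 0] `*` [set 0] else setT.
rewrite (_ : _ @^-1` _ = [set t | forall i, A i (tnth t i)]).
  rewrite power_measure_box; last first.
    by move=> i; rewrite /A; case: ifP => // _; exact: measurableX.
  rewrite (bigD1 j)//= {1}/A eqxx /lebesgue_measure2 product_measure1E//.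
  by rewrite [X in (X * _ * _)%E](lebesgue_measure_set1 0) !mul0e.
apply/seteqP; split => t; rewrite /preimage/= !mxE/=.
  by move=> tj i; rewrite /A; case: eqVneq => // ->; case: tj => ? ?; split.
by move=> /(_ j); rewrite /A eqxx => -[/= -> ->].
Qed.

Lemma measurable_coordwise (P : 'I_n -> R[i] -> Prop) :
  (forall j, measurable [set t : MR * MR | P j (Complex t.1 t.2)]) ->
  measurable [set z : Cn | forall j, P j (z ord0 j)].
Proof.
move=> mP; rewrite /measurable/=.
rewrite (_ : _ @^-1` _ = \bigcap_(j in [set: 'I_n])
    ((fun t : n.-tuple (MR * MR) => tnth t j) @^-1` [set t : MR * MR | P j (Complex t.1 t.2)])).
  apply: fin_bigcap_measurable => // j _.
  by rewrite -[X in measurable X]setTI; exact: measurable_tnth.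
apply/seteqP; split=> t; rewrite /preimage/=.
  by move=> h j _; have := h j; rewrite mxE.
by move=> h j; have := h j I; rewrite mxE.
Qed.

Definition polydisc (p : Cn) (r : R) :=
  [set z : Cn | forall j, normc (z ord0 j - p ord0 j) < r].

Lemma measurable_polydisc p r : measurable (polydisc p r).
Proof.
apply: (measurable_coordwise (P := fun j (x : R[i]) => normc (x - p ord0 j) < r)) => j.
rewrite -[X in measurable X]setTI.
rewrite (_ : mkset _ = (fun t : MR * MR => normc (Complex t.1 t.2 - p ord0 j)) @^-1` `]-oo, r[).
  have : measurable_fun setT (fun t : MR * MR => normc (Complex t.1 t.2 - p ord0 j)).
    apply: cmeas_normc; apply: cmeasB; last exact: cmeas_cst.
    by split; [exact: measurable_fst|exact: measurable_snd].
  by apply.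
by apply/seteqP; split => t; rewrite /= in_itv.
Qed.

Lemma measurable_box (a b c e : 'I_n -> R) : measurable [set z : Cn | forall j,
  a j < complex.Re (z ord0 j) <= b j /\ c j < complex.Im (z ord0 j) <= e j].
Proof.
apply: (measurable_coordwise
  (P := fun j (x : R[i]) => a j < complex.Re x <= b j /\ c j < complex.Im x <= e j)) => j.
rewrite (_ : mkset _ = `]a j, b j] `*` `]c j, e j]); first exact: measurableX.
by apply/seteqP; split => t; rewrite /= !in_itv.
Qed.

Lemma lebesgue_Cn_polydisc_gt0 (p : Cn) (r : R) : 0 < r -> (0 < dV (polydisc p r))%E.
Proof.
move=> r0; pose a j := complex.Re (p ord0 j) - r / 3.
pose b j := complex.Re (p ord0 j) + r / 3.
pose c j := complex.Im (p ord0 j) - r / 3.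
pose e j := complex.Im (p ord0 j) + r / 3.
have ab j : a j <= b j by rewrite /a /b; lra.
have ce j : c j <= e j by rewrite /c /e; lra.
have := lebesgue_Cn_box ab ce; set B := [set z | _] => dB.
apply: (@lt_le_trans _ _ (dV B)).
  rewrite dB lte_fin prodr_gt0// => j _; apply: mulr_gt0; rewrite /a /b /c /e; lra.
apply: le_measure; rewrite ?inE; [exact: measurable_box|exact: measurable_polydisc|].
move=> z /= zB j; have [/andP[h1 h2] /andP[h3 h4]] := zB j.
apply: le_lt_trans (normc_le _) _; rewrite cReB cImB.
have : `|complex.Re (z ord0 j) - complex.Re (p ord0 j)| <= r / 3.
  by rewrite ler_distl; move: h1 h2; rewrite /a /b => h1 h2; apply/andP; split; lra.
have : `|complex.Im (z ord0 j) - complex.Im (p ord0 j)| <= r / 3.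
  by rewrite ler_distl; move: h3 h4; rewrite /c /e => h3 h4; apply/andP; split; lra.
lra.
Qed.

Lemma lebesgue_Cn_unit_polydisc_fin : (dV (polydisc 0%R 1%R) < +oo)%E.
Proof.
have ab (j : 'I_n) : (-1 : R) <= 1 by lra.
have := lebesgue_Cn_box ab ab; set B := [set z | _] => dB.
apply: (@le_lt_trans _ _ (dV B)); last by rewrite dB ltry.
apply: le_measure; rewrite ?inE; [exact: measurable_polydisc|exact: measurable_box|].
move=> z /= zB j; have := zB j; rewrite mxE subr0 => zj.
have := le_lt_trans (normRe_le _) zj; have := le_lt_trans (normIm_le _) zj.
by rewrite !ltr_norml => /andP[? ?] /andP[? ?]; split; apply/andP; split => //; exact: ltW.
Qed.

End complex_space_measure.

(** * Slices of holomorphic functions on complete Reinhardt domains *)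

Section complex_compact.
Variable R : realType.

Lemma continuous_normc : continuous (@Normc.normc R).
Proof.
move=> z; have Fz : Filter (nbhs z) by exact: nbhs_filter.
apply/cvgrPdist_lt => e e0.
have ec0 : (0 : R[i]) < e%:C by rewrite ltcR.
near=> w.
have zw : `|z - w| < e%:C by near: w; exact: cvgr_dist_lt.
move: zw; rewrite normC_E ltcR; apply: le_lt_trans.
have A := normcD_le (z - w) w; rewrite subrK in A.
have B := normcD_le (w - z) z; rewrite subrK in B.
have C : normc (w - z) = normc (z - w) by rewrite -normcN opprB.
by rewrite ler_distl; apply/andP; split; lra.
Unshelve. all: by end_near. Qed.

Lemma continuous_Complex : continuous (fun p : R * R => Complex p.1 p.2 : R[i]).
Proof.
move=> [x y]; apply/cvgrPdist_lt => e; case: e => e e'; rewrite ltcE/= => /andP[/eqP -> e0].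
have h0 : 0 < e / 2 by rewrite divr_gt0.
near=> p.
rewrite normC_E ltcR; apply: le_lt_trans (normc_le _) _ => /=.
have : `|x - p.1| < e / 2.
  near: p; exists (ball x (e / 2), setT) => /=; last by move=> q [].
  by split; [exact: nbhsx_ballx|exact: filterT].
have : `|y - p.2| < e / 2.
  near: p; exists (setT, ball y (e / 2)) => /=; last by move=> q [].
  by split; [exact: filterT|exact: nbhsx_ballx].
by move=> h1 h2; have := ltrD h1 h2; lra.
Unshelve. all: by end_near. Qed.

Lemma compact_closed_disc (r : R) : compact [set z : R[i] | normc z <= r].
Proof.
apply: (@subclosed_compact _ _ ((fun p : R * R => Complex p.1 p.2) @` (`[-r, r] `*` `[-r, r]))).
- rewrite (_ : mkset _ = @Normc.normc R @^-1` [set x : R | x <= r])//.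
  by apply: closed_comp => [z _|]; [exact: continuous_normc|exact: closed_le].
- apply: continuous_compact; last by apply: compact_setX; exact: segment_compact.
  by apply: continuous_subspaceT; exact: continuous_Complex.
- move=> z /= zr; exists (complex.Re z, complex.Im z); last by case: z zr.
  by split; rewrite /= in_itv/= -ler_norml (le_trans _ zr) ?normRe_le ?normIm_le.
Qed.

End complex_compact.

Section slices.
Variables (R : realType) (n : nat).
Local Notation Cn := 'rV[R[i]]_n.
Variable (D : set Cn).

Definition complete_reinhardt := forall z w : Cn, D z ->
  (forall j, normc (w ord0 j) <= normc (z ord0 j)) -> D w.

Hypothesis D_complete : complete_reinhardt.
Variable (f : Cn -> R[i]).
Hypothesis f_hol : holomorphic D f.

(** The points dominated by [z] form a compact polydisc, which lies in [D]. *)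
Lemma holomorphic_bounded (z : Cn) : D z -> exists B : R, forall w : Cn,
  (forall j, normc (w ord0 j) <= normc (z ord0 j)) -> normc (f w) <= B.
Proof.
move=> Dz; pose K := [set w : Cn | forall j, normc (w ord0 j) <= normc (z ord0 j)].
have cK : compact K.
  by apply: (rV_compact (A := fun j => [set x : R[i] | normc x <= normc (z ord0 j)])) => j; exact: compact_closed_disc.
have : compact ((@Normc.normc R \o f) @` K).
  apply: continuous_compact => //; apply: continuous_in_subspaceT => w /set_mem Kw.
  apply: continuous_comp; last exact: continuous_normc.
  by apply: differentiable_continuous; apply: f_hol; exact: D_complete Dz Kw.
move/(@compact_bounded R R^o) => [M [Mr hM]]; exists (M + 1) => w Kw.
have Kfw : ((@Normc.normc R \o f) @` K) (normc (f w)) by exists w.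
have M1 : M < M + 1 by rewrite ltrDl.
have := hM (M + 1) M1 _ Kfw; exact/le_trans/ler_norm.
Qed.

(** Acts through [cmul], on the [j]-th coordinate only. *)
Definition dilation (j : 'I_n) (c : R[i]) : Cn := \row_i (if i == j then c else 1).

Lemma cmul_dilation1 j z : cmul (dilation j 1) z = z.
Proof. by apply/rowP => i; rewrite !mxE if_same mul1r. Qed.

(** The slice is read in the logarithmic variable, in which circles become
    vertical segments of length [2 * pi]. *)
Lemma differentiable_slice j z w : D (cmul (dilation j (cexp w)) z) ->
  differentiable ((fun x => f (cmul (dilation j (cexp x)) z)) : R[i]^o -> R[i]^o) w.
Proof.
move=> Dw.
pose a : Cn := \row_i (if i == j then 0 else z ord0 i).
pose v : Cn := \row_i (if i == j then z ord0 i else 0).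
have E x : cmul (dilation j x) z = a + x *: v.
  apply/rowP => i; rewrite !mxE; case: ifP => _; last by rewrite mul1r mulr0 addr0.
  by rewrite add0r.
rewrite (_ : (fun x => f (cmul (dilation j (cexp x)) z)) =
  f \o (fun x : R[i]^o => a + x *: v) \o (@cexp R : R[i]^o -> R[i]^o)); last first.
  by apply/funext => x /=; rewrite E.
apply: differentiable_comp.
  apply/derivable1_diffP; have := is_derive_cexp w; by case.
apply: differentiable_comp; last by apply: f_hol; rewrite -E.
apply: differentiableD; first exact: differentiable_cst.
by apply: differentiableZl; exact: ex_diff.
Qed.

End slices.

Section slice_mean.
Variables (R : realType) (n : nat).
Local Notation Cn := 'rV[R[i]]_n.
Variable (D : set Cn).
Hypothesis D_complete : complete_reinhardt D.
Variable (f : Cn -> R[i]).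
Hypothesis f_hol : holomorphic D f.

Definition cis (y : R) : R[i] := Complex (cos y) (sin y).

Lemma cexp_polar x y : cexp (Complex x y) = (expR x)%:C * cis y.
Proof. by rewrite /cexp /cis/=; congr Complex; rewrite !mul0r ?subr0 ?addr0. Qed.

Lemma normc_cis y : normc (cis y) = 1.
Proof. by rewrite /= cos2Dsin2 sqrtr1. Qed.

Local Notation circle_integral := (cint (@lebesgue_measure R) `[0, 2 * pi]).

(** The circles of radius [expR a] and [1] are two opposite sides of a rectangle
    in the logarithmic variable. The factor [q] will be a power of the
    exponential, which selects a Fourier coefficient. *)
Lemma slice_mean (j : 'I_n) (z : Cn) (q : R[i] -> R[i]) (a : R) :
  D z -> a <= 0 ->
  (forall w, differentiable (q : R[i]^o -> R[i]^o) w) ->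
  (forall x, q (Complex x 0) = q (Complex x (2 * pi))) ->
  circle_integral (fun y => f (cmul (dilation j ((expR a)%:C * cis y)) z) * q (Complex a y)) =
  circle_integral (fun y => f (cmul (dilation j (cis y)) z) * q (Complex 0 y)).
Proof.
move=> Dz a0 dq pq.
pose Phi c w := c * (f (cmul (dilation j (cexp w)) z) * q w).
have inD w : a <= complex.Re w <= 0 -> D (cmul (dilation j (cexp w)) z).
  move=> /andP[_ w0]; apply: D_complete Dz _ => i; rewrite !mxE.
  case: ifP => _; last by rewrite mul1r.
  by rewrite Normc.normcM normc_cexp ler_piMl ?normc_ge0// -expR0 ler_expR.
have ReE c : segment_integral 0 (2 * pi) (fun y => complex.Re (Phi c (Complex a y))) =
  segment_integral 0 (2 * pi) (fun y => complex.Re (Phi c (Complex 0 y))).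
  apply: circle_mean_const => //.
    move=> w hw; rewrite /Phi.
    apply: (@differentiableM _ _ (fun=> c) _ w); first exact: differentiable_cst.
    apply: (@differentiableM _ _ (fun x => f (cmul (dilation j (cexp x)) z)) q w) => //.
    by apply: (differentiable_slice (D := D)) => //; exact: inD.
  move=> x; rewrite /Phi pq; congr (c * (f (cmul (dilation j _) _) * _)).
  by rewrite !cexp_polar /cis cos0 sin0 mulr_natl cos2pi sin2pi.
apply/eqP; rewrite eq_complex; apply/andP; split; apply/eqP.
  have := ReE 1; rewrite /segment_integral /Phi/= => h.
  transitivity (\int[lebesgue_measure]_(x in `[0, (2 * pi)])
      complex.Re (1 * (f (cmul (dilation j (cexp (Complex a x))) z) * q (Complex a x)))).
    by apply: eq_Rintegral => y _; rewrite mul1r cexp_polar.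
  rewrite h; apply: eq_Rintegral => y _; by rewrite mul1r cexp_polar expR0 mul1r.
rewrite !Im_cint; have := ReE (- 'i%C); rewrite /segment_integral /Phi => h.
transitivity (\int[lebesgue_measure]_(x in `[0, (2 * pi)])
    complex.Re (- 'i%C * (f (cmul (dilation j (cexp (Complex a x))) z) * q (Complex a x)))).
  by apply: eq_Rintegral => y _; rewrite cexp_polar.
rewrite h; apply: eq_Rintegral => y _; by rewrite cexp_polar expR0 mul1r.
Qed.

End slice_mean.

(** * Fourier coefficients of slices *)

Lemma differentiable_power (K : numFieldType) (V : normedModType K) (f : V -> K^o) (x : V) k :
  differentiable f x -> differentiable (fun y => f y ^+ k : K^o) x.
Proof.
move=> df; elim: k => [|k ih].
  by under eq_fun do rewrite expr0; exact: differentiable_cst.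
by under eq_fun do rewrite exprS; exact: differentiableM.
Qed.

Section slice_coefficients.
Variables (R : realType) (n : nat).
Local Notation Cn := 'rV[R[i]]_n.
Local Notation dV := (lebesgue_Cn R n).
Local Notation MR := (measurableTypeR R).
Local Notation circle := (`[0%R, (2 * pi)%R]%classic).
Local Notation lambda := (@lebesgue_measure R).

Lemma cmeas_comp d (X : measurableType d) (E : set X) (D : set Cn) (F : X -> Cn) (f : Cn -> R[i]) :
  measurable D -> measurable E -> measurable_fun setT F -> (forall x, E x -> D (F x)) ->
  cmeas D f -> cmeas E (fun x => f (F x)).
Proof.
move=> mD mE mF EF [f1 f2]; split.
  apply: (measurable_comp mD _ f1); first by move=> _ [x /EF ? <-].
  exact: measurable_funTS.
apply: (measurable_comp mD _ f2); first by move=> _ [x /EF ? <-].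
exact: measurable_funTS.
Qed.

Lemma cmeas_cis : cmeas [set: MR] (@cis R).
Proof.
split; first by apply: continuous_measurable_fun; exact: continuous_cos.
by apply: continuous_measurable_fun; exact: continuous_sin.
Qed.

Lemma measurable_cmul d (X : measurableType d) (u v : X -> Cn) :
  (forall j, cmeas setT (fun x => u x ord0 j)) ->
  (forall j, cmeas setT (fun x => v x ord0 j)) ->
  forall j, cmeas setT (fun x => cmul (u x) (v x) ord0 j).
Proof. by move=> mu mv j; under eq_fun do rewrite mxE; exact: cmeasM. Qed.

Lemma cmeas_dilation d (X : measurableType d) (j : 'I_n) (c : X -> R[i]) :
  cmeas setT c -> forall i, cmeas setT (fun x => (dilation j (c x) : Cn) ord0 i).
Proof.
move=> mc i; under eq_fun do rewrite mxE.
by case: (i == j) => //; exact: cmeas_cst.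
Qed.

Lemma cisJ (y : R) : (cis y)^* * cis y = 1.
Proof. by rewrite mulrC mulcJ normc_cis expr1n. Qed.

Lemma lebesgue_circle_fin : (lambda circle < +oo)%E.
Proof. by rewrite lebesgue_measure_itv/=; case: ifP => _; rewrite ltry. Qed.

Lemma lebesgue_circle : fine (lambda circle) = 2 * pi.
Proof. by rewrite lebesgue_measure_itv/= lte_fin mulr_gt0 ?pi_gt0//= subr0. Qed.

Variable (D : set Cn).
Hypotheses (mD : measurable D) (D_complete : complete_reinhardt D).
Variable (f : Cn -> R[i]).
Hypotheses (f_hol : holomorphic D f) (f_meas : cmeas D f).

Lemma dilation_in j c z : normc c <= 1 -> D z -> D (cmul (dilation j c) z).
Proof.
move=> c1 Dz; apply: D_complete Dz _ => i; rewrite !mxE; case: ifP => _; last by rewrite mul1r.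
by rewrite Normc.normcM ler_piMl ?normc_ge0.
Qed.

Lemma normc_scis (s y : R) : 0 <= s -> normc (s%:C * cis y) = s.
Proof. by move=> s0; rewrite Normc.normcM normc_cis mulr1 normc_real ger0_norm. Qed.

Lemma cintegrable_slice j z (s : R) (q : R -> R[i]) : D z -> 0 <= s <= 1 ->
  cmeas [set: MR] q -> (forall y, normc (q y) <= 1) ->
  cintegrable lambda circle (fun y => f (cmul (dilation j (s%:C * cis y)) z) * q y).
Proof.
move=> Dz /andP[s0 s1] mq q1; have [B hB] := holomorphic_bounded D_complete f_hol Dz.
have inD y : D (cmul (dilation j (s%:C * cis y)) z).
  by apply: dilation_in => //; rewrite normc_scis.
apply: (cintegrable_bounded _ _ (B := B)) => //; first exact: lebesgue_circle_fin.
  apply: cmeasM; last by apply: cmeasS mq.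
  apply: (cmeas_comp mD) f_meas => //.
  apply: measurable_to_row; apply: measurable_cmul; last by move=> i; exact: cmeas_cst.
  by apply: cmeas_dilation; apply: cmeasM; [exact: cmeas_cst|exact: cmeas_cis].
move=> y _; rewrite Normc.normcM; apply: (le_trans (ler_pM (normc_ge0 _) (normc_ge0 _) _ (q1 y))).
  apply: hB => i; rewrite !mxE; case: ifP => _; last by rewrite mul1r.
  by rewrite Normc.normcM normc_scis// ler_piMl ?normc_ge0.
by rewrite mulr1.
Qed.

Definition slice_integral j z (s : R) (q : R -> R[i]) : R[i] :=
  cint lambda circle (fun y => f (cmul (dilation j (s%:C * cis y)) z) * q y).

Lemma cmeas_cisJX k : cmeas [set: MR] (fun y => (cis y)^* ^+ k : R[i]).
Proof. exact/cmeasX/cmeasJ/cmeas_cis. Qed.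

Lemma normc_cisJX k y : normc ((cis y)^* ^+ k : R[i]) = 1.
Proof. by rewrite normcX normcJ normc_cis expr1n. Qed.

(** With the multiplier [cexp (- w) ^+ k], [slice_mean] equates [s ^- k] times the
    left-hand side with the slice integral over the circle of radius [1]. *)
Lemma slice_scaling j z (s : R) k : D z -> 0 < s <= 1 ->
  slice_integral j z s (fun y => (cis y)^* ^+ k) =
  (s ^+ k)%:C * slice_integral j z 1 (fun y => (cis y)^* ^+ k).
Proof.
move=> Dz /andP[s0 s1].
have dq w : differentiable ((fun w => cexp (- w) ^+ k) : R[i]^o -> R[i]^o) w.
  apply: differentiable_power; apply: (@differentiable_comp _ _ _ _ (-%R : R[i]^o -> R[i]^o) (@cexp R : R[i]^o -> R[i]^o)).
    by apply: differentiableN; exact: ex_diff.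
  by apply/derivable1_diffP; have := is_derive_cexp (- w); case.
have pq (x : R) : cexp (- Complex x 0) ^+ k = cexp (- Complex x (2 * pi)) ^+ k.
  by congr (_ ^+ k); rewrite /cexp/= !cosN !sinN cos0 sin0 mulr_natl cos2pi sin2pi.
have E a y : cexp (- Complex a y) ^+ k = (expR (- a) ^+ k)%:C * (cis y)^* ^+ k :> R[i].
  rewrite rmorphXn/= -exprMn; congr (_ ^+ k).
  by rewrite /cexp /cis/= cosN sinN; congr Complex; rewrite mul0r ?subr0 ?addr0.
have a0 : ln s <= 0 by rewrite ln_le0.
have ls : expR (ln s) = s by rewrite lnK// posrE.
have := @slice_mean R n D D_complete f f_hol j z (fun w => cexp (- w) ^+ k) (ln s) Dz a0 dq pq.
rewrite ls.
have -> : cint lambda circle (fun y => f (cmul (dilation j (s%:C * cis y)) z) * cexp (- Complex (ln s) y) ^+ k) =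
   ((s^-1) ^+ k)%:C * slice_integral j z s (fun y => (cis y)^* ^+ k).
  rewrite /slice_integral -cintZ//.
    by apply: eq_cint => y _; rewrite E expRN ls mulrCA.
  apply: cintegrable_slice => //; [by rewrite ltW|exact: cmeas_cisJX|by move=> y; rewrite normc_cisJX].
have -> : cint lambda circle (fun y => f (cmul (dilation j (cis y)) z) * cexp (- Complex 0 y) ^+ k) =
   slice_integral j z 1 (fun y => (cis y)^* ^+ k).
  by apply: eq_cint => y _; rewrite E oppr0 expR0 expr1n !mul1r.
move=> <-; rewrite mulrA; have -> : (s ^+ k)%:C * (s^-1 ^+ k)%:C = 1 :> R[i]; last by rewrite mul1r.
by rewrite -rmorphM -exprMn mulfV ?gt_eqF// expr1n rmorph1.
Qed.

(** With the multiplier [cexp w ^+ k] the integral is [s ^+ k] times the same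
    integral over the circle of radius [s], which stays bounded when [s] tends to
    [0]. *)
Lemma slice_vanish j z k : D z -> (0 < k)%N ->
  slice_integral j z 1 (fun y => cis y ^+ k) = 0.
Proof.
move=> Dz k0.
have [B hB] := holomorphic_bounded D_complete f_hol Dz.
have mq : cmeas [set: MR] (fun y => cis y ^+ k : R[i]) by exact/cmeasX/cmeas_cis.
have q1 y : normc (cis y ^+ k : R[i]) <= 1 by rewrite normcX normc_cis expr1n.
have dq w : differentiable ((fun w => cexp w ^+ k) : R[i]^o -> R[i]^o) w.
  by apply: differentiable_power; apply/derivable1_diffP; have := is_derive_cexp w; case.
have pq (x : R) : cexp (Complex x 0) ^+ k = cexp (Complex x (2 * pi)) ^+ k.
  by congr (_ ^+ k); rewrite /cexp/= cos0 sin0 mulr_natl cos2pi sin2pi.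
have key (s : R) : 0 < s <= 1 -> slice_integral j z 1 (fun y => cis y ^+ k) =
    (s ^+ k)%:C * slice_integral j z s (fun y => cis y ^+ k).
  move=> /andP[s0 s1]; have a0 : ln s <= 0 by rewrite ln_le0.
  have ls : expR (ln s) = s by rewrite lnK// posrE.
  have := @slice_mean R n D D_complete f f_hol j z (fun w => cexp w ^+ k) (ln s) Dz a0 dq pq.
  rewrite ls.
  have E a y : cexp (Complex a y) ^+ k = (expR a ^+ k)%:C * cis y ^+ k :> R[i].
    by rewrite rmorphXn/= -exprMn cexp_polar.
  have -> : cint lambda circle (fun y => f (cmul (dilation j (s%:C * cis y)) z) * cexp (Complex (ln s) y) ^+ k) =
     (s ^+ k)%:C * slice_integral j z s (fun y => cis y ^+ k).
    rewrite /slice_integral -cintZ//; first by apply: eq_cint => y _; rewrite E ls mulrCA.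
    by apply: cintegrable_slice => //; rewrite ltW.
  move=> ->; apply: eq_cint => y _; by rewrite E expR0 expr1n !mul1r.
set J := slice_integral j z 1 _.
have B0 : 0 <= B by apply: le_trans (hB z _); [exact: normc_ge0|].
have bound (h : R[i] -> R) s : 0 < s <= 1 -> (forall x y, h (x%:C * y) = x * h y) ->
    (forall x, `|h x| <= normc x) ->
    (forall u, h (cint lambda circle u) = (\int[lambda]_(y in circle) h (u y))%R) ->
    (forall u, cintegrable lambda circle u -> lambda.-integrable circle (EFin \o (h \o u))) ->
    `|h J| <= s * (B * (2 * pi)).
  move=> s01 hZ hn hint hi; rewrite /J (key s s01) hZ normrM.
  have /andP[s0 s1] := s01.
  have isl : cintegrable lambda circle
      (fun y => f (cmul (dilation j (s%:C * cis y)) z) * cis y ^+ k).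
    by apply: cintegrable_slice => //; rewrite ltW.
  rewrite ger0_norm ?exprn_ge0 ?(ltW s0)//; apply: ler_pM => //.
  - by rewrite exprn_ge0// ltW.
  - by case: k k0 {mq q1 dq pq key J isl} => // k _; rewrite exprS ler_piMr ?(ltW s0)// exprn_ile1// ltW.
  rewrite hint; apply: (le_trans (le_normr_Rintegral _ _)) => //; first exact: hi.
  have -> : B * (2 * pi) = (\int[lambda]_(y in circle) B)%R by rewrite Rintegral_cst// lebesgue_circle.
  apply: le_Rintegral => //.
  - exact: (integrable_norm (hi _ isl)).
  - apply/integrableP; split; first exact/measurable_EFinP/measurable_cst.
    by rewrite /= integral_cst// lte_mul_pinfty// lebesgue_circle_fin.
  - move=> y _ /=; apply: (le_trans (hn _)); rewrite Normc.normcM.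
    apply: (le_trans (ler_pM (normc_ge0 _) (normc_ge0 _) _ (q1 y))); last by rewrite mulr1.
    apply: hB => i; rewrite !mxE; case: ifP => _; last by rewrite mul1r.
    by rewrite Normc.normcM normc_scis ?(ltW s0)// ler_piMl ?normc_ge0.
have zero (a b : R) : 0 <= b -> (forall s, 0 < s <= 1 -> `|a| <= s * b) -> a = 0.
  move=> b0 h; apply/eqP; rewrite -normr_le0; apply/ler_addgt0Pr => e e0; rewrite add0r.
  have t0 : 0 < e / (e + b) by rewrite divr_gt0// ltr_wpDr.
  have t1 : e / (e + b) <= 1 by rewrite ler_pdivrMr ?ltr_wpDr// mul1r lerDl.
  apply: (le_trans (h (e / (e + b)) _)); first by rewrite t0 t1.
  by rewrite -mulrA ler_piMr ?(ltW e0)// mulrC ler_pdivrMr ?ltr_wpDr// mul1r lerDr ltW.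
have C0 : 0 <= B * (2 * pi) by rewrite !mulr_ge0// pi_ge0.
apply/eqP; rewrite eq_complex; apply/andP; split; apply/eqP; apply: (zero _ _ C0) => s s01.
  apply: bound => //; [by move=> x [a b] /=; rewrite mul0r subr0|exact: normRe_le|by move=> u []].
apply: bound => //; [by move=> x [a b] /=; rewrite mul0r addr0|exact: normIm_le|by move=> u []].
Qed.

End slice_coefficients.

(** * Monomials and the torus action *)

Section monomials.
Variables (R : realType) (n : nat).
Local Notation Cn := 'rV[R[i]]_n.
Implicit Types (z w u : Cn) (d : 'I_n -> nat).

Definition mono d z : R[i] := \prod_j z ord0 j ^+ d j.

Lemma mono_cmul d u z : mono d (cmul u z) = mono d u * mono d z.
Proof. by rewrite /mono -big_split; apply: eq_bigr => j _; rewrite mxE exprMn. Qed.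

Lemma normc_mono d z : normc (mono d z) = \prod_j normc (z ord0 j) ^+ d j.
Proof. by rewrite /mono normc_prod; apply: eq_bigr => j _; rewrite normcX. Qed.

Lemma normc_mono_unimodular d u : unimodular u -> normc (mono d u) = 1.
Proof. by move=> u1; rewrite normc_mono big1// => j _; rewrite u1 expr1n. Qed.

Lemma mono_neq0 d z : (forall j, z ord0 j != 0) -> mono d z != 0.
Proof. by move=> z0; apply/prodf_neq0 => j _; rewrite expf_neq0. Qed.

Lemma mono_dilation d j c : mono d (dilation j c) = c ^+ d j.
Proof.
rewrite /mono (bigD1 j)//= mxE eqxx big1 ?mulr1// => i /negbTE ij.
by rewrite mxE ij expr1n.
Qed.

Lemma cmeas_mono (d : 'I_n -> nat) : cmeas [set: Cn] (mono d).
Proof. by apply: cmeas_prod => j; apply: cmeasX; exact: cmeas_coord. Qed.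

Lemma cmulA u v z : cmul u (cmul v z) = cmul (cmul u v) z.
Proof. by apply/rowP => j; rewrite !mxE mulrA. Qed.

Lemma cmulC u z : cmul u z = cmul z u.
Proof. by apply/rowP => j; rewrite !mxE mulrC. Qed.

(** A point of the torus if no coordinate of [z] vanishes; vanishing coordinates
    stay [0]. *)
Definition ang z : Cn := \row_j (z ord0 j * ((normc (z ord0 j))^-1)%:C).

Lemma ang_unimodular z : (forall j, z ord0 j != 0) -> unimodular (ang z).
Proof.
move=> z0 j; rewrite mxE Normc.normcM normc_real ger0_norm ?invr_ge0 ?normc_ge0//.
by rewrite mulfV// normc_eq0.
Qed.

Lemma ang_cmul u z : unimodular u -> ang (cmul u z) = cmul u (ang z).
Proof. by move=> u1; apply/rowP => j; rewrite !mxE Normc.normcM u1 mul1r mulrA. Qed.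

Lemma cmul_ang_modulus z : (forall j, z ord0 j != 0) ->
  z = cmul (ang z) (\row_j (normc (z ord0 j))%:C).
Proof.
move=> z0; apply/rowP => j; rewrite !mxE -mulrA -rmorphM/= mulVf ?mulr1//.
by rewrite normc_eq0.
Qed.

Lemma cmeas_ang j : cmeas [set: Cn] (fun z => ang z ord0 j).
Proof.
under eq_fun do rewrite mxE; apply: cmeasM; first exact: cmeas_coord.
apply: cmeas_real.
rewrite (_ : (fun _ => _) = (fun x => x `^ (-1)) \o (fun z : Cn => normc (z ord0 j))).
  by apply: measurableT_comp; [exact: measurable_powR|exact/cmeas_normc/cmeas_coord].
by apply/funext => z /=; rewrite powR_inv1// normc_ge0.
Qed.

End monomials.

Section torus_average.
Variables (R : realType) (n : nat).
Local Notation Cn := 'rV[R[i]]_n.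
Local Notation dV := (lebesgue_Cn R n).
Local Notation MR := (measurableTypeR R).
Local Notation circle := (`[0%R, (2 * pi)%R]%classic).
Local Notation lambda := (@lebesgue_measure R).

Variable (D : set Cn).
Hypotheses (mD : measurable D) (D_complete : complete_reinhardt D).
Hypothesis D_disc : D `<=` polydisc 0 1.

Definition off_axes := [set z : Cn | forall j, z ord0 j != 0].
(** The part of [D] where [ang] has values in the torus; the rest is a null
    set. *)
Definition D_off := D `&` off_axes.

Lemma rotation_in u z : unimodular u -> D z -> D (cmul u z).
Proof.
by move=> u1 Dz; apply: D_complete Dz _ => j; rewrite mxE Normc.normcM u1 mul1r.
Qed.

Lemma unimodularV u : unimodular u -> exists2 v : Cn, unimodular v & forall z, cmul v (cmul u z) = z.
Proof.
move=> u1; exists (\row_j (u ord0 j)^*); first by move=> j; rewrite mxE normcJ.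
by move=> z; apply/rowP => j; rewrite !mxE mulrA [_^* * _]mulrC mulcJ u1 expr1n mul1r.
Qed.

Lemma rotation_preimage (u : Cn) : unimodular u -> cmul u @^-1` D = D.
Proof.
move=> u1; apply/seteqP; split => z /=; last exact: rotation_in.
by have [v v1 vK] := unimodularV u1; move=> /(rotation_in v1); rewrite vK.
Qed.

Lemma rotation_preimage_off (u : Cn) : unimodular u -> cmul u @^-1` D_off = D_off.
Proof.
move=> u1; rewrite /D_off preimage_setI rotation_preimage//; congr (_ `&` _).
apply/seteqP; split => z /= h j; have := h j; rewrite mxE mulf_eq0 negb_or.
  by case/andP.
by move=> ->; rewrite -normc_eq0 u1 oner_neq0.
Qed.

Lemma axes_null : dV (~` off_axes) = 0%E /\ measurable off_axes.
Proof.
have mA (j : 'I_n) : measurable [set z : Cn | z ord0 j = 0].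
  have [mre mim] := @cmeas_coord R n j.
  rewrite (_ : [set z : Cn | z ord0 j = 0] = ((fun z : Cn => complex.Re (z ord0 j)) @^-1` [set 0]) `&`
     ((fun z : Cn => complex.Im (z ord0 j)) @^-1` [set 0])).
    by apply: measurableI; rewrite -[X in measurable X]setTI; [exact: mre|exact: mim].
  apply/seteqP; split => z /=; first by move=> ->.
  by move=> [h1 h2]; apply/eqP; rewrite eq_complex h1 h2 !eqxx.
have E : ~` off_axes = \bigcup_(j in [set: 'I_n]) [set z : Cn | z ord0 j = 0].
  apply/seteqP; split => z /=.
    by move=> /existsNP[j /negP]; rewrite negbK => /eqP zj; exists j.
  by move=> [j _ /= zj]; apply/existsNP; exists j; rewrite zj eqxx.
have mE : measurable (~` off_axes).
  by rewrite E; apply: fin_bigcup_measurable => // j _; exact: mA.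
split; last by rewrite -[X in measurable X]setCK; exact: measurableC.
have E2 : ~` off_axes = \big[setU/set0]_(j <- index_enum 'I_n) [set z : Cn | z ord0 j = 0].
  by rewrite E -bigcup_seq; apply: eq_bigcupl; split => j _ //=; rewrite mem_index_enum.
have [_ <-] : measurable (~` off_axes) /\ dV (~` off_axes) = 0%E; last by [].
rewrite E2; elim: (index_enum 'I_n) => [|j s [ms ds]].
  by rewrite big_nil; split; [exact: measurable0|exact: measure0].
rewrite big_cons; split; first exact: measurableU.
by rewrite measureU0//; exact: lebesgue_Cn_coord_eq0.
Qed.

Lemma mD_off : measurable D_off.
Proof. by apply: measurableI => //; exact: axes_null.2. Qed.

Lemma D_fin : (dV D < +oo)%E.
Proof.
apply: le_lt_trans (lebesgue_Cn_unit_polydisc_fin R n).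
by apply: le_measure; rewrite ?inE//; exact: measurable_polydisc.
Qed.

Lemma D_off_fin : (dV D_off < +oo)%E.
Proof.
apply: le_lt_trans D_fin; apply: le_measure; rewrite ?inE//; first exact: mD_off.
exact: subIsetl.
Qed.

Lemma dV_D_off : dV D_off = dV D.
Proof.
have mC : measurable (~` off_axes) by apply: measurableC; exact: axes_null.2.
have mN : measurable (D `&` ~` off_axes) by exact: measurableI.
have dN : dV (D `&` ~` off_axes) = 0%E.
  apply/eqP; rewrite eq_le measure_ge0 andbT -axes_null.1.
  by apply: le_measure; rewrite ?inE//; exact: subIsetr.
have DE : D = D_off `|` (D `&` ~` off_axes) by rewrite /D_off -setIUr setUv setIT.
by rewrite [in RHS]DE measureU0//; exact: mD_off.
Qed.

Lemma cint_D_off u : cintegrable dV D u -> cint dV D u = cint dV D_off u.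
Proof.
have E : D_off = D `\` ~` off_axes by rewrite setDE setCK.
have mC : measurable (~` off_axes) by apply: measurableC; exact: axes_null.2.
move=> [u1 u2]; rewrite /cint E; congr Complex; rewrite /Rintegral.
  by rewrite (negligible_integral mC mD u1)//; exact: axes_null.1.
by rewrite (negligible_integral mC mD u2)//; exact: axes_null.1.
Qed.

End torus_average.

(** * Torus averages *)

Section torus_coefficients.
Variables (R : realType) (n : nat).
Local Notation Cn := 'rV[R[i]]_n.
Local Notation dV := (lebesgue_Cn R n).
Local Notation MR := (measurableTypeR R).
Local Notation circle := (`[0%R, (2 * pi)%R]%classic).
Local Notation lambda := (@lebesgue_measure R).

Variable (D : set Cn).
Hypotheses (mD : measurable D) (D_complete : complete_reinhardt D).
Hypothesis D_disc : D `<=` polydisc 0 1.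
Variable (f : Cn -> R[i]).
Hypotheses (f_hol : holomorphic D f) (f_meas : cmeas D f).
Local Notation D_off := (D_off D).

Lemma D_coord_lt1 z j : D z -> normc (z ord0 j) < 1.
Proof. by move=> /D_disc /(_ j); rewrite mxE subr0. Qed.

Section fixed_degree.
Variable d : 'I_n -> nat.

Definition torus_kernel (z w : Cn) : R[i] :=
  f (cmul (ang w) z) * (mono d (ang w))^*.

(** Integrating over [w] in [D] through the angular part [ang w] is, up to the
    constant factor [dV D], averaging over the torus, and does not need a measure
    on the torus. *)
Definition torus_coef (z : Cn) : R[i] := cint dV D_off (torus_kernel z).

Let D_offP w : D_off w -> forall j, w ord0 j != 0. Proof. by case. Qed.

Lemma torus_kernel_bound z : D z -> exists B : R, forall (c : R[i]) j w,
  normc c <= 1 -> D_off w ->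
  normc (f (cmul (dilation j c) (cmul (ang w) z)) * (mono d (ang w))^*) <= B.
Proof.
move=> Dz; have [B hB] := holomorphic_bounded D_complete f_hol Dz.
exists B => c j w c1 Dw; have aw := ang_unimodular (D_offP Dw).
rewrite Normc.normcM normcJ normc_mono_unimodular// mulr1; apply: hB => i.
have E : normc (cmul (ang w) z ord0 i) = normc (z ord0 i).
  by rewrite mxE Normc.normcM aw mul1r.
rewrite [cmul (dilation _ _) _ _ _]mxE Normc.normcM E mxE; case: ifP => _.
  by rewrite ler_piMl ?normc_ge0.
by rewrite Normc.normc1 mul1r.
Qed.

Lemma torus_in z w : D z -> D_off w -> D (cmul (ang w) z).
Proof. by move=> Dz Dw; apply: rotation_in => //; exact/ang_unimodular/D_offP. Qed.

Lemma cmeas_monoJ : cmeas D_off (fun w => (mono d (ang w))^*).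
Proof.
apply: cmeasJ; apply: cmeas_prod => j; apply: cmeasX.
exact: (cmeasS measurableT (@subsetT _ _) (@cmeas_ang R n j)).
Qed.

Lemma cintegrable_torus_kernel z : D z -> cintegrable dV D_off (torus_kernel z).
Proof.
move=> Dz; have [B hB] := holomorphic_bounded D_complete f_hol Dz.
apply: (cintegrable_bounded (mD_off mD) _ _ (B := B)); first exact: D_off_fin.
  apply: cmeasM; last exact: cmeas_monoJ.
  apply: (cmeas_comp mD (mD_off mD)) f_meas; last by move=> w; exact: torus_in.
  apply: measurable_to_row; apply: measurable_cmul => j; [exact: cmeas_ang|exact: cmeas_cst].
move=> w Dw; have aw := ang_unimodular (D_offP Dw).
rewrite Normc.normcM normcJ normc_mono_unimodular// mulr1; apply: hB => i.
by rewrite mxE Normc.normcM aw mul1r.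
Qed.

(** Change of variables [w -> cmul u w]. *)
Lemma torus_coef_rot u z : unimodular u -> D z ->
  torus_coef (cmul u z) = mono d u * torus_coef z.
Proof.
move=> u1 Dz; rewrite /torus_coef -cintZ; [|exact: mD_off|exact: cintegrable_torus_kernel].
have iK : cintegrable dV D_off (fun w => mono d u * torus_kernel z w).
  by apply: cintegrableZ; [exact: mD_off|exact: cintegrable_torus_kernel].
rewrite -[RHS](cint_measure_preserving (cmul_preserving u1) (mD_off mD)
  (rotation_preimage_off D_complete u1) (cintegrable_cmeas iK)).
apply: eq_cint => w _; rewrite /torus_kernel ang_cmul// cmulA [cmul (ang w) u]cmulC.
rewrite mono_cmul rmorphM/= mulrCA; congr (_ * _).
by rewrite mulrA mulcJ normc_mono_unimodular// expr1n mul1r.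
Qed.

Lemma torus_coef_swap z j (s : R) (c : R[i]) : D z -> 0 <= s <= 1 ->
  cint lambda circle (fun y => cint dV D_off (fun w =>
    f (cmul (dilation j (s%:C * cis y)) (cmul (ang w) z)) * (cis y)^* ^+ d j * (c * (mono d (ang w))^*))) =
  cint dV D_off (fun w => slice_integral f j (cmul (ang w) z) s (fun y => (cis y)^* ^+ d j)
    * (c * (mono d (ang w))^*)).
Proof.
move=> Dz s01; have [B hB] := torus_kernel_bound Dz.
have /andP[s0 s1] := s01.
have sc1 y : normc (s%:C * cis y) <= 1 by rewrite normc_scis.
have inD y w : D_off w -> D (cmul (dilation j (s%:C * cis y)) (cmul (ang w) z)).
  by move=> Dw; apply: dilation_in => //; exact: torus_in.
have hB' y w : D_off w -> normc (f (cmul (dilation j (s%:C * cis y)) (cmul (ang w) z))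
   * (cis y)^* ^+ d j * (c * (mono d (ang w))^*)) <= normc c * B.
  move=> Dw; rewrite mulrAC mulrCA -mulrA Normc.normcM Normc.normcM normc_cisJX mulr1.
  by rewrite ler_wpM2l ?normc_ge0//; exact: hB.
have mF : cmeas (circle `*` D_off) (fun p : MR * Cn =>
    f (cmul (dilation j (s%:C * cis p.1)) (cmul (ang p.2) z)) * (cis p.1)^* ^+ d j * (c * (mono d (ang p.2))^*)).
  have mX : measurable ((circle : set MR) `*` D_off) := measurableX (measurable_itv _) (mD_off mD).
  have fstm : measurable_fun setT (@fst MR Cn) by exact: measurable_fst.
  have sndm : measurable_fun setT (@snd MR Cn) by exact: measurable_snd.
  have mcis : cmeas setT (fun p : MR * Cn => cis p.1).
    have [c1 c2] := @cmeas_cis R.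
    by split; [exact: (measurableT_comp c1 fstm)|exact: (measurableT_comp c2 fstm)].
  have mang i : cmeas setT (fun p : MR * Cn => ang p.2 ord0 i).
    have [c1 c2] := @cmeas_ang R n i.
    by split; [exact: (measurableT_comp c1 sndm)|exact: (measurableT_comp c2 sndm)].
  apply: cmeasM; first apply: cmeasM.
  - apply: (cmeas_comp mD mX) f_meas; last by move=> [y w] [_ Dw]; exact: inD.
    apply: measurable_to_row; apply: measurable_cmul.
      by apply: cmeas_dilation; apply: cmeasM; [exact: cmeas_cst|exact: mcis].
    by apply: measurable_cmul => i; [exact: mang|exact: cmeas_cst].
  - exact: (cmeasS measurableT (@subsetT _ _) (cmeasX _ (cmeasJ mcis))).
  - apply: cmeasM; first exact: cmeas_cst.
    apply: (cmeasS measurableT (@subsetT _ _)); apply: cmeasJ; apply: cmeas_prod => i; apply: cmeasX; exact: mang.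
have mslice1 y : cmeas D_off (fun w => f (cmul (dilation j (s%:C * cis y)) (cmul (ang w) z))
   * (cis y)^* ^+ d j * (c * (mono d (ang w))^*)).
  apply: cmeasM; last by apply: cmeasM; [exact: cmeas_cst|exact: cmeas_monoJ].
  apply: cmeasM; last exact: cmeas_cst.
  apply: (cmeas_comp mD (mD_off mD)) f_meas; last by move=> w; exact: inD.
  apply: measurable_to_row; apply: measurable_cmul; first by move=> i; exact: cmeas_cst.
  by apply: measurable_cmul => i; [exact: cmeas_ang|exact: cmeas_cst].
rewrite (@cint_swap _ _ _ _ _ lambda (lebesgue_Cn R n) circle D_off _ (mD_off mD)
   (fun y w => f (cmul (dilation j (s%:C * cis y)) (cmul (ang w) z)) * (cis y)^* ^+ d j *
     (c * (mono d (ang w))^*)) (normc c * B * fine (dV D_off)))//.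
- apply: eq_cint => w /set_mem Dw.
  rewrite /slice_integral [RHS]mulrC -cintZ//; first by apply: eq_cint => y _; rewrite mulrC.
  apply: (cintegrable_slice mD D_complete f_hol f_meas) => //; first exact: torus_in.
    exact: cmeas_cisJX.
  by move=> y; rewrite normc_cisJX.
- exact: lebesgue_circle_fin.
- move=> y _; have fD : dV D_off \is a fin_num.
    by rewrite ge0_fin_numE ?measure_ge0//; exact: D_off_fin.
  rewrite EFinM fineK// -integral_cst; last exact: mD_off.
  apply: ge0_le_integral => //; try exact: mD_off.
  + by move=> w _; rewrite lee_fin normc_ge0.
  + by apply/measurable_EFinP; apply: cmeas_normc.
  + by move=> w Dw; rewrite lee_fin hB'.
- move=> y _; apply: (cintegrable_bounded (mD_off mD) _ _ (B := normc c * B)) => //; first exact: D_off_fin.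
  by move=> w; exact: hB'.
- move=> w Dw; rewrite (_ : (fun _ => _) = (fun y => c * (mono d (ang w))^* *
      (f (cmul (dilation j (s%:C * cis y)) (cmul (ang w) z)) * (cis y)^* ^+ d j))); last first.
    by apply/funext => y; rewrite mulrC.
  apply: cintegrableZ => //; apply: (cintegrable_slice mD D_complete f_hol f_meas) => //; first exact: torus_in.
    exact: cmeas_cisJX.
  by move=> y; rewrite normc_cisJX.
Qed.

(** Rotating the [j]-th coordinate of [z] by [cis y] multiplies the coefficient by
    [cis y ^+ d j], so averaging over [y] against the conjugate harmonic leaves it
    unchanged. Exchanging the two averages by [torus_coef_swap] puts circle means
    of [f] inside, to which [slice_scaling] applies. *)
Lemma torus_coef_scale z j (s : R) : D z -> 0 < s <= 1 ->
  torus_coef (cmul (dilation j s%:C) z) = (s ^+ d j)%:C * torus_coef z.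
Proof.
move=> Dz s01; have /andP[s0 s1] := s01.
have dil_uni y : unimodular (dilation j (cis y) : Cn).
  by move=> i; rewrite mxE; case: ifP => _; rewrite ?normc_cis ?Normc.normc1.
have step (t : R) (c : R[i]) : 0 < t <= 1 ->
    (2 * pi)%:C * (c * torus_coef (cmul (dilation j t%:C) z)) =
    cint dV D_off (fun w => slice_integral f j (cmul (ang w) z) t (fun y => (cis y)^* ^+ d j)
    * (c * (mono d (ang w))^*)).
  move=> /andP[t0 t1]; rewrite -torus_coef_swap//; last by rewrite t1 ltW.
  have Dtz : D (cmul (dilation j t%:C) z).
    by apply: (dilation_in D_complete) => //; rewrite normc_real ger0_norm ?(ltW t0).
  have E y : cint dV D_off (fun w => f (cmul (dilation j (t%:C * cis y)) (cmul (ang w) z))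
      * (cis y)^* ^+ d j * (c * (mono d (ang w))^*)) = c * torus_coef (cmul (dilation j t%:C) z).
    transitivity (cint dV D_off (fun w => (c * (cis y)^* ^+ d j) *
        torus_kernel (cmul (dilation j (cis y)) (cmul (dilation j t%:C) z)) w)).
      apply: eq_cint => w _; rewrite /torus_kernel.
      have -> : cmul (dilation j (t%:C * cis y)) (cmul (ang w) z) =
          cmul (ang w) (cmul (dilation j (cis y)) (cmul (dilation j t%:C) z)).
        by apply/rowP => i; rewrite !mxE; case: (i == j); ring.
      by ring.
    rewrite cintZ; [|exact: mD_off|apply: cintegrable_torus_kernel; exact: rotation_in].
    rewrite -/(torus_coef _) torus_coef_rot// mono_dilation -mulrA; congr (_ * _).
    by rewrite mulrA -exprMn cisJ expr1n mul1r.
  transitivity (cint lambda circle (fun=> c * torus_coef (cmul (dilation j t%:C) z))); last first.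
    by apply: eq_cint => y _; exact/esym/E.
  by rewrite cint_cst// lebesgue_circle mulrC.
have two_pi : (2 * pi)%:C != 0 :> R[i] by apply/eqP => -[/eqP]; rewrite mulf_eq0 pnatr_eq0/= gt_eqF ?pi_gt0.
apply: (mulfI two_pi).
have := step 1 (s ^+ d j)%:C; rewrite ltr01 lexx => /(_ isT); rewrite cmul_dilation1 => ->.
have := step s 1 s01; rewrite mul1r => ->.
apply: eq_cint => w /set_mem Dw; rewrite (slice_scaling mD)//; last exact: torus_in.
ring.
Qed.

End fixed_degree.
End torus_coefficients.

(** * Taylor coefficients as weighted moments *)

Section moments.
Variables (R : realType) (n : nat).
Local Notation Cn := 'rV[R[i]]_n.
Local Notation dV := (lebesgue_Cn R n).
Local Notation MR := (measurableTypeR R).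
Local Notation circle := (`[0%R, (2 * pi)%R]%classic).
Local Notation lambda := (@lebesgue_measure R).

Variable (D : set Cn).
Hypotheses (mD : measurable D) (D_complete : complete_reinhardt D).
Hypothesis D_disc : D `<=` polydisc 0 1.
Hypothesis D_pos : (0 < dV D)%E.
Variable (f : Cn -> R[i]).
Hypotheses (f_hol : holomorphic D f) (f_meas : cmeas D f).
Local Notation D_off := (D_off D).

Section fixed_degree.
Variable d : 'I_n -> nat.
Local Notation G := (torus_coef D f d).

(** A point off the axes is obtained by a rotation and one real dilation in each
    coordinate. *)
Lemma torus_coef_cmul (w z : Cn) : D_off w -> D z -> G (cmul w z) = mono d w * G z.
Proof.
move=> [Dw w0] Dz; have wle j := ltW (D_coord_lt1 D_disc j Dw).
have aw := ang_unimodular w0.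
pose sc (r : seq 'I_n) : Cn := \row_i (if i \in r then (normc (w ord0 i))%:C else 1).
have Dsc r : D (cmul (sc r) z).
  apply: D_complete Dz _ => i; rewrite !mxE; case: ifP => _; last by rewrite mul1r.
  by rewrite Normc.normcM normc_real ger0_norm ?normc_ge0// ler_piMl ?normc_ge0.
have scE r : uniq r -> G (cmul (sc r) z) = (\prod_(i <- r) (normc (w ord0 i) ^+ d i)%:C) * G z.
  elim: r => [_|j r ih /= /andP[jr ur]].
    rewrite big_nil mul1r; congr (G _).
    by apply/rowP => i; rewrite !mxE in_nil mul1r.
  rewrite big_cons -mulrA -ih// -(torus_coef_scale mD D_complete D_disc f_hol f_meas)//; last first.
    by rewrite normc_gt0 w0 wle.
  congr (G _); apply/rowP => i; rewrite !mxE in_cons.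
  have [->|ij] /= := eqVneq i j; last by rewrite mul1r.
  by rewrite (negbTE jr) mul1r.
have E : cmul w z = cmul (ang w) (cmul (sc (enum 'I_n)) z).
  rewrite {1}(cmul_ang_modulus w0) -cmulA; congr (cmul _ (cmul _ _)).
  by apply/rowP => i; rewrite !mxE mem_enum.
rewrite E (torus_coef_rot mD D_complete D_disc f_hol f_meas)// scE ?enum_uniq// mulrA; congr (_ * _).
rewrite big_enum/= /mono -big_split; apply: eq_bigr => j _ /=.
have wj : w ord0 j = ang w ord0 j * (normc (w ord0 j))%:C.
  by rewrite mxE -mulrA -rmorphM/= mulVf ?mulr1// normc_eq0.
by rewrite [in RHS]wj exprMn rmorphXn.
Qed.

(** By [torus_coef_cmul] and the symmetry of [cmul],
    [mono d w * G z = mono d z * G w]. *)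
Lemma torus_coef_monomial : exists c : R[i], forall z, D_off z -> G z = c * mono d z.
Proof.
have [[w Dw]|noD] := pselect (exists w, D_off w); last first.
  by exists 0 => z Dz; exfalso; apply: noD; exists z.
have m0 : mono d w != 0 by apply: mono_neq0; case: Dw.
exists (G w / mono d w) => z Dz.
have := torus_coef_cmul Dw Dz.1; rewrite cmulC (torus_coef_cmul Dz Dw.1) => h.
by apply: (mulfI m0); rewrite -h; field.
Qed.

End fixed_degree.

Hypothesis f_int : cintegrable dV D f.

Definition rotation_invariant (psi : Cn -> R[i]) :=
  forall u z, unimodular u -> psi (cmul u z) = psi z.

(** With [psi = 1] the coefficient of the orthogonal projection of [f] on [mono d].
    That the same [c] serves all weights depending only on the moduli is what
    makes it the Taylor coefficient, and is needed for the weights of the test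
    functions below. *)
Definition taylor_coef d (c : R[i]) := forall (psi : Cn -> R[i]) (B : R),
  cmeas D psi -> (forall z, D z -> normc (psi z) <= B) -> rotation_invariant psi ->
  cint dV D (fun z => f z * ((mono d z)^* * psi z)) =
  c * cint dV D (fun z => (normc (mono d z) ^+ 2)%:C * psi z).

Lemma normc_mono_le1 d z : D z -> normc (mono d z) <= 1.
Proof.
move=> Dz; rewrite normc_mono; apply: prodr_ile1 => j _.
by rewrite exprn_ge0 ?normc_ge0//= exprn_ile1 ?normc_ge0// ltW// (D_coord_lt1 D_disc).
Qed.

(** The integral does not change when [z] is rotated, and the rotation leaves
    [psi] alone; so [f] may be replaced by its average [torus_coef], which is a
    multiple of [mono d]. *)
Lemma weighted_moment d : exists c : R[i], taylor_coef d c.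
Proof.
have [c hc] := torus_coef_monomial d.
pose V := fine (dV D_off).
have VE : dV D_off = dV D := dV_D_off mD.
have Dfin := D_fin mD D_disc.
have V0 : V%:C != 0 :> R[i].
  apply/eqP => -[] /eqP; rewrite /V VE fine_eq0 ?gt_eqF//.
  by rewrite ge0_fin_numE ?measure_ge0.
exists (c / V%:C) => psi B mpsi psiB psiI.
have mmono : cmeas D (fun z => (mono d z)^*).
  by apply: cmeasJ; exact: (cmeasS measurableT (@subsetT _ _) (@cmeas_mono R n d)).
have mt : cmeas D (fun z => (mono d z)^* * psi z) by exact: cmeasM.
have tB z : D z -> normc ((mono d z)^* * psi z) <= B.
  move=> Dz; rewrite Normc.normcM normcJ; apply: le_trans (psiB _ Dz).
  by rewrite ler_piMl ?normc_ge0// normc_mono_le1.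
have it : cintegrable dV D (fun z => f z * ((mono d z)^* * psi z)).
  exact: (cintegrable_mul_bounded mD f_int mt tB).
apply: (mulfI V0); rewrite mulrA mulrCA mulfV// mulr1.
pose F w z := torus_kernel f d z w * ((mono d z)^* * psi z).
have FE w z : D_off w -> F w z = (fun z => f z * ((mono d z)^* * psi z)) (cmul (ang w) z).
  move=> [_ /ang_unimodular aw]; rewrite /F /torus_kernel psiI// mono_cmul rmorphM/=.
  by ring.
have sD : D_off `<=` D by exact: subIsetl.
have mt' := cmeasS mD sD mt.
have itst : cintegrable dV D_off (fun z => f z * ((mono d z)^* * psi z)).
  exact: (cintegrableS mD (mD_off mD) sD it).
have mF : cmeas (D_off `*` D_off) (fun p : Cn * Cn => F p.1 p.2).
  have mX : measurable (D_off `*` D_off) := measurableX (mD_off mD) (mD_off mD).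
  have fstm : measurable_fun setT (@fst Cn Cn) by exact: measurable_fst.
  have sndm : measurable_fun setT (@snd Cn Cn) by exact: measurable_snd.
  have mang i : cmeas setT (fun p : Cn * Cn => ang p.1 ord0 i).
    have [c1 c2] := @cmeas_ang R n i.
    by split; [exact: (measurableT_comp c1 fstm)|exact: (measurableT_comp c2 fstm)].
  have mcoo i : cmeas setT (fun p : Cn * Cn => p.2 ord0 i).
    have [c1 c2] := @cmeas_coord R n i.
    by split; [exact: (measurableT_comp c1 sndm)|exact: (measurableT_comp c2 sndm)].
  apply: cmeasM; first apply: cmeasM.
  - apply: (cmeas_comp mD mX) f_meas; last by move=> [w z] [/= Dw /sD Dz]; exact: torus_in.
    by apply: measurable_to_row; apply: measurable_cmul.
  - apply: (cmeasS measurableT (@subsetT _ _)); apply: cmeasJ; apply: cmeas_prod => i; apply: cmeasX; exact: mang.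
  - by apply: (cmeas_comp (mD_off mD) mX sndm) mt' => -[w z] [].
have rot w : D_off w -> [/\ measure_preserving dV (cmul (ang w)), cmul (ang w) @^-1` D_off = D_off & unimodular (ang w)].
  move=> [_ /ang_unimodular aw].
  by split => //; [exact: cmul_preserving|exact: rotation_preimage_off].
rewrite (cint_D_off mD it).
have -> : V%:C * cint dV D_off (fun z => f z * ((mono d z)^* * psi z)) =
    cint dV D_off (fun w => cint dV D_off (F w)).
  transitivity (cint dV D_off (fun=> cint dV D_off (fun z => f z * ((mono d z)^* * psi z)))).
    by rewrite (cint_cst _ (mD_off mD)); exact: mulrC.
  apply: eq_cint => w /set_mem Dw; have [mp pre aw] := rot w Dw.
  rewrite -(cint_measure_preserving mp (mD_off mD) pre (cintegrable_cmeas itst)).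
  by apply: eq_cint => z _; rewrite FE.
have rotint w : D_off w -> cintegrable dV D_off (F w).
  move=> Dw; have [mp pre aw] := rot w Dw.
  have := cintegrable_measure_preserving mp (mD_off mD) pre itst.
  by apply: (eq_cintegrable (mD_off mD)) => z _; rewrite FE.
pose A := fine (\int[dV]_(z in D_off) (normc (f z * ((mono d z)^* * psi z)))%:E)%E.
have AE : (\int[dV]_(z in D_off) (normc (f z * ((mono d z)^* * psi z)))%:E = A%:E)%E.
  rewrite /A fineK// ge0_fin_numE; last by apply: integral_ge0 => z _; rewrite lee_fin normc_ge0.
  by have [h _] := cintegrableP dV (mD_off mD) (cintegrable_cmeas itst); exact: h.
rewrite (@cint_swap _ _ _ _ _ (lebesgue_Cn R n) (lebesgue_Cn R n) D_off D_off (mD_off mD) (mD_off mD) F A)//.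
- have iR : cintegrable dV D (fun z => (normc (mono d z) ^+ 2)%:C * psi z).
    apply: (cintegrable_bounded mD Dfin (B := B)).
      apply: cmeasM => //; apply: cmeas_real; apply: cmeas_sqr_normc.
      exact: (cmeasS measurableT (@subsetT _ _) (@cmeas_mono R n d)).
    move=> z Dz; rewrite Normc.normcM normc_real ger0_norm ?exprn_ge0 ?normc_ge0//.
    apply: le_trans (psiB _ Dz); rewrite ler_piMl ?normc_ge0// exprn_ile1 ?normc_ge0//.
    exact: normc_mono_le1.
  rewrite (cint_D_off mD iR) -(cintZ (mD_off mD)); last exact: (cintegrableS mD (mD_off mD) sD iR).
  apply: eq_cint => z /set_mem Dz; rewrite /F.
  transitivity (torus_coef D f d z * ((mono d z)^* * psi z)).
    rewrite [RHS]mulrC /torus_coef -(cintZ (mD_off mD)); last first.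
      exact: (cintegrable_torus_kernel mD D_complete D_disc f_hol f_meas _ Dz.1).
    by apply: eq_cint => w _; rewrite mulrC.
  by rewrite hc// -mulcJ; ring.
- exact: D_off_fin.
- move=> w Dw; have [mp pre aw] := rot w Dw.
  rewrite -AE -(integral_measure_preserving mp (mD_off mD) pre (f := fun z => (normc (f z * ((mono d z)^* * psi z)))%:E)).
    rewrite le_eqVlt; apply/orP; left; apply/eqP; apply: eq_integral => z _.
    by rewrite FE.
  by apply/measurable_EFinP/cmeas_normc; exact: cintegrable_cmeas itst.
- move=> z [Dz _]; rewrite /F.
  rewrite (_ : (fun _ => _) = (fun w => ((mono d z)^* * psi z) * torus_kernel f d z w)); last first.
    by apply/funext => w; rewrite mulrC.
  apply: cintegrableZ; [exact: mD_off|exact: (cintegrable_torus_kernel mD D_complete D_disc f_hol f_meas _ Dz)].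
Qed.

(** Averaging over rotations of the [j]-th coordinate, the integral becomes one of
    circle means of [f] against [cis y ^+ k], which vanish by [slice_vanish]. *)
Lemma vanishing_moment j k (q : Cn -> R[i]) (B : R) : (0 < k)%N ->
  cmeas D q -> (forall z, D z -> normc (q z) <= B) ->
  (forall y z, q (cmul (dilation j (cis y)) z) = cis y ^+ k * q z) ->
  cint dV D (fun z => f z * q z) = 0.
Proof.
move=> k0 mq qB qk.
have it : cintegrable dV D (fun z => f z * q z) := cintegrable_mul_bounded mD f_int mq qB.
have Dfin := D_fin mD D_disc.
have dil_uni y : unimodular (dilation j (cis y) : Cn).
  by move=> i; rewrite mxE; case: ifP => _; rewrite ?normc_cis ?Normc.normc1.
pose F y z := f (cmul (dilation j (cis y)) z) * (cis y ^+ k * q z).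
have FE y z : F y z = (fun z => f z * q z) (cmul (dilation j (cis y)) z) by rewrite /F qk.
have two_pi : (2 * pi)%:C != 0 :> R[i] by apply/eqP => -[/eqP]; rewrite mulf_eq0 pnatr_eq0/= gt_eqF ?pi_gt0.
apply: (mulfI two_pi); rewrite mulr0.
have pre y := rotation_preimage D_complete (dil_uni y).
have mp y := cmul_preserving (dil_uni y).
have -> : (2 * pi)%:C * cint dV D (fun z => f z * q z) = cint lambda circle (fun y => cint dV D (F y)).
  transitivity (cint lambda circle (fun=> cint dV D (fun z => f z * q z))).
    by rewrite cint_cst// lebesgue_circle mulrC.
  apply: eq_cint => y _.
  rewrite -(cint_measure_preserving (mp y) mD (pre y) (cintegrable_cmeas it)).
  by apply: eq_cint => z _; rewrite FE.
pose A := fine (\int[dV]_(z in D) (normc (f z * q z))%:E)%E.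
have AE : (\int[dV]_(z in D) (normc (f z * q z))%:E = A%:E)%E.
  rewrite /A fineK// ge0_fin_numE; last by apply: integral_ge0 => z _; rewrite lee_fin normc_ge0.
  by have [h _] := cintegrableP dV mD (cintegrable_cmeas it); exact: h.
have islice z : D z -> cintegrable lambda circle (F^~ z).
  move=> Dz; rewrite (_ : F^~ z = (fun y => q z * (f (cmul (dilation j (1%:C * cis y)) z) * cis y ^+ k))); last first.
    by apply/funext => y; rewrite /F mul1r; ring.
  apply: cintegrableZ => //; apply: (cintegrable_slice mD D_complete f_hol f_meas) => //.
  - by rewrite ler01 lexx.
  - exact/cmeasX/cmeas_cis.
  - by move=> y; rewrite normcX normc_cis expr1n.
rewrite (@cint_swap _ _ _ _ _ lambda (lebesgue_Cn R n) circle D _ mD F A)//.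
- transitivity (cint dV D (fun=> 0)); last by rewrite cint_cst// mul0r.
  apply: eq_cint => z /set_mem Dz.
  transitivity (q z * slice_integral f j z 1 (fun y => cis y ^+ k)).
    rewrite /slice_integral -cintZ//; last first.
      apply: (cintegrable_slice mD D_complete f_hol f_meas) => //.
      - by rewrite ler01 lexx.
      - exact/cmeasX/cmeas_cis.
      - by move=> y; rewrite normcX normc_cis expr1n.
    by apply: eq_cint => y _; rewrite /F mul1r; ring.
  by rewrite (slice_vanish mD D_complete f_hol f_meas)// mulr0.
- have mX : measurable ((circle : set MR) `*` D) := measurableX (measurable_itv _) mD.
  have fstm : measurable_fun setT (@fst MR Cn) by exact: measurable_fst.
  have sndm : measurable_fun setT (@snd MR Cn) by exact: measurable_snd.
  have mcis : cmeas setT (fun p : MR * Cn => cis p.1).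
    have [c1 c2] := @cmeas_cis R.
    by split; [exact: (measurableT_comp c1 fstm)|exact: (measurableT_comp c2 fstm)].
  have mcoo i : cmeas setT (fun p : MR * Cn => p.2 ord0 i).
    have [c1 c2] := @cmeas_coord R n i.
    by split; [exact: (measurableT_comp c1 sndm)|exact: (measurableT_comp c2 sndm)].
  apply: cmeasM; last apply: cmeasM.
  - apply: (cmeas_comp mD mX) f_meas; last by move=> [y z] [_ Dz]; exact: rotation_in.
    by apply: measurable_to_row; apply: measurable_cmul => //; exact: cmeas_dilation.
  - exact: (cmeasS measurableT (@subsetT _ _) (cmeasX _ mcis)).
  - by apply: (cmeas_comp mD mX sndm) mq => -[y z] [].
- exact: lebesgue_circle_fin.
- move=> y _.
  rewrite -AE -(integral_measure_preserving (mp y) mD (pre y) (f := fun z => (normc (f z * q z))%:E)).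
    rewrite le_eqVlt; apply/orP; left; apply/eqP; apply: eq_integral => z _.
    by rewrite FE.
  by apply/measurable_EFinP/cmeas_normc; exact: cintegrable_cmeas it.
- move=> y _; have := cintegrable_measure_preserving (mp y) mD (pre y) it.
  by apply: (eq_cintegrable mD) => z _; rewrite FE.
Qed.

End moments.

(** * Square-integrable functions *)

Lemma conjcM (R : realType) (z w : R[i]) : (z * w)^* = z^* * w^*.
Proof. exact: rmorphM. Qed.

Lemma conjcX (R : realType) (z : R[i]) m : (z ^+ m)^* = z^* ^+ m.
Proof. exact: rmorphXn. Qed.

Lemma conjcR (R : realType) (x : R) : (x%:C : R[i])^* = x%:C.
Proof. exact: conjc_real. Qed.

Section square_integrable.
Variables (R : realType) (n : nat) (D : set 'rV[R[i]]_n).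
Local Notation Cn := 'rV[R[i]]_n.
Local Notation dV := (lebesgue_Cn R n).
Hypothesis mD : measurable D.
Implicit Types (g h v w : Cn -> R[i]).

Definition nsq h : R := (\int[dV]_(z in D) (normc (h z) ^+ 2))%R.

Lemma L2_sqr_integrable h : L2 D h ->
  dV.-integrable D (EFin \o (fun z => normc (h z) ^+ 2)).
Proof.
move=> [mh fh]; apply/integrableP; split; first exact/measurable_EFinP/cmeas_sqr_normc.
by under eq_integral do rewrite /= ger0_norm ?sqr_ge0//.
Qed.

Lemma L2norm_sqE h : L2 D h -> L2norm_sq D h = (nsq h)%:E.
Proof.
by move=> hh; rewrite /nsq /Rintegral fineK//; exact: integrable_fin_num (L2_sqr_integrable hh).
Qed.

Lemma nsq_ge0 h : 0 <= nsq h.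
Proof. by apply: Rintegral_ge0 => z _; exact: sqr_ge0. Qed.

Lemma L2_dominated h (b : Cn -> R) : cmeas D h -> dV.-integrable D (EFin \o b) ->
  (forall z, D z -> normc (h z) ^+ 2 <= b z) -> L2 D h.
Proof.
move=> mh ib hb; split => //.
have /integrableP[_] : dV.-integrable D (EFin \o (fun z => normc (h z) ^+ 2)).
  apply: (le_integrable mD _ _ ib); first exact/measurable_EFinP/cmeas_sqr_normc.
  by move=> z Dz /=; rewrite lee_fin ger0_norm ?sqr_ge0// (le_trans (hb z Dz))// ler_norm.
by under eq_integral do rewrite /= ger0_norm ?sqr_ge0//.
Qed.

Lemma L2D g h : L2 D g -> L2 D h -> L2 D (fun z => g z + h z).
Proof.
move=> Lg Lh; apply: (@L2_dominated _ (fun z => 2 * normc (g z) ^+ 2 + 2 * normc (h z) ^+ 2)).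
- by apply: cmeasD; [case: Lg|case: Lh].
- have := integrableD mD (integrableZl mD 2 (L2_sqr_integrable Lg)) (integrableZl mD 2 (L2_sqr_integrable Lh)).
  exact.
- move=> z _; have := normcD_le (g z) (h z).
  have := normc_ge0 (g z + h z); have := normc_ge0 (g z); have := normc_ge0 (h z).
  have := sqr_ge0 (normc (g z) - normc (h z)).
  by move: (normc (g z)) (normc (h z)) (normc (g z + h z)) => a b c; nra.
Qed.

Lemma L2Z (a : R[i]) h : L2 D h -> L2 D (fun z => a * h z).
Proof.
move=> Lh; apply: (@L2_dominated _ (fun z => normc a ^+ 2 * normc (h z) ^+ 2)).
- by apply: cmeasM; [exact: cmeas_cst|case: Lh].
- exact: (integrableZl mD (normc a ^+ 2) (L2_sqr_integrable Lh)).
- by move=> z _; rewrite Normc.normcM exprMn.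
Qed.

Lemma L2_0 : L2 D (fun=> 0).
Proof.
apply: (@L2_dominated _ (fun=> 0)); [exact: cmeas_cst|exact: integrable0|].
by move=> z _; rewrite Normc.normc0 expr0n.
Qed.

Lemma L2B g h : L2 D g -> L2 D h -> L2 D (fun z => g z - h z).
Proof.
move=> Lg Lh; have := L2D Lg (L2Z (-1) Lh).
by under eq_fun do rewrite mulN1r.
Qed.

Lemma L2_sum (I : Type) (r : seq I) (F : I -> Cn -> R[i]) :
  (forall i, L2 D (F i)) -> L2 D (fun z => \sum_(i <- r) F i z).
Proof.
move=> hF; elim: r => [|i r ih].
  by under eq_fun do rewrite big_nil; exact: L2_0.
by under eq_fun do rewrite big_cons; exact: L2D.
Qed.

Lemma L2dot_integrable g h : L2 D g -> L2 D h ->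
  cintegrable dV D (fun z => g z * (h z)^*).
Proof.
move=> Lg Lh; apply: (cintegrable_dominated mD _ (f := fun z => normc (g z) ^+ 2 + normc (h z) ^+ 2)).
- by apply: cmeasM; [case: Lg|apply: cmeasJ; case: Lh].
- exact: (integrableD mD (L2_sqr_integrable Lg) (L2_sqr_integrable Lh)).
- move=> z _; rewrite Normc.normcM normcJ.
  have := normc_ge0 (g z); have := normc_ge0 (h z).
  have := sqr_ge0 (normc (g z) - normc (h z)).
  by move: (normc (g z)) (normc (h z)) => a b; nra.
Qed.

Lemma L2dotDl g h w : L2 D g -> L2 D h -> L2 D w ->
  L2dot D (fun z => g z + h z) w = L2dot D g w + L2dot D h w.
Proof.
move=> Lg Lh Lw; rewrite -[RHS](cintD mD (L2dot_integrable Lg Lw) (L2dot_integrable Lh Lw)).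
by apply: (@eq_cint _ _ _ dV D) => z _; rewrite mulrDl.
Qed.

Lemma L2dotZl a g w : L2 D g -> L2 D w -> L2dot D (fun z => a * g z) w = a * L2dot D g w.
Proof.
move=> Lg Lw; rewrite -[RHS](cintZ mD _ (L2dot_integrable Lg Lw)).
by apply: (@eq_cint _ _ _ dV D) => z _; rewrite mulrA.
Qed.

Lemma L2dotJ g h : L2 D g -> L2 D h -> L2dot D h g = (L2dot D g h)^*.
Proof.
move=> Lg Lh; rewrite -[RHS](cintJ mD (L2dot_integrable Lg Lh)).
by apply: (@eq_cint _ _ _ dV D) => z _; rewrite rmorphM/= conjcK mulrC.
Qed.

Lemma L2dotBl g h w : L2 D g -> L2 D h -> L2 D w ->
  L2dot D (fun z => g z - h z) w = L2dot D g w - L2dot D h w.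
Proof.
move=> Lg Lh Lw; rewrite -mulN1r -L2dotZl// -L2dotDl//; last exact: L2Z.
by congr (L2dot _ _ _); apply/funext => z; rewrite mulN1r.
Qed.

Lemma L2dot_suml (I : Type) (r : seq I) (F : I -> Cn -> R[i]) w :
  (forall i, L2 D (F i)) -> L2 D w ->
  L2dot D (fun z => \sum_(i <- r) F i z) w = \sum_(i <- r) L2dot D (F i) w.
Proof.
move=> hF Lw; rewrite -[RHS](cint_sum mD r (fun i => L2dot_integrable (hF i) Lw)).
by apply: (@eq_cint _ _ _ dV D) => z _; rewrite mulr_suml.
Qed.

Lemma L2dot_sumr (I : Type) (r : seq I) (F : I -> Cn -> R[i]) w :
  (forall i, L2 D (F i)) -> L2 D w ->
  L2dot D w (fun z => \sum_(i <- r) F i z) = \sum_(i <- r) L2dot D w (F i).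
Proof.
move=> hF Lw; rewrite (L2dotJ (L2_sum r hF) Lw) L2dot_suml// rmorph_sum/=.
by apply: eq_bigr => i _; rewrite (L2dotJ (hF i) Lw).
Qed.

Lemma L2dotZr a g w : L2 D g -> L2 D w -> L2dot D w (fun z => a * g z) = a^* * L2dot D w g.
Proof.
move=> Lg Lw; rewrite (L2dotJ (L2Z a Lg) Lw) L2dotZl// rmorphM/=.
by rewrite (L2dotJ Lg Lw).
Qed.

Lemma L2dot_nsq h : L2dot D h h = (nsq h)%:C.
Proof.
rewrite -[RHS](@cint_real _ _ _ dV _ mD); apply: (@eq_cint _ _ _ dV D) => z _.
by rewrite mulcJ.
Qed.

Lemma bessel (I : finType) (h : I -> Cn -> R[i]) v :
  L2 D v -> (forall x, L2 D (h x)) -> (forall x y, x != y -> L2dot D (h x) (h y) = 0) ->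
  \sum_x normc (L2dot D v (h x)) ^+ 2 / nsq (h x) <= nsq v.
Proof.
move=> Lv Lh orth.
pose c x := L2dot D v (h x) * ((nsq (h x))^-1)%:C.
have cJ x : (c x)^* = (L2dot D v (h x))^* * ((nsq (h x))^-1)%:C.
  by rewrite /c rmorphM; congr (_ * _); exact: conjc_real.
pose S z := \sum_x c x * h x z.
have Lch x : L2 D (fun z => c x * h x z) by exact: L2Z.
have LS : L2 D S by exact: L2_sum.
pose Q := \sum_x normc (L2dot D v (h x)) ^+ 2 / nsq (h x).
have vS : L2dot D v S = Q%:C.
  rewrite /S L2dot_sumr// /Q rmorph_sum; apply: eq_bigr => x _.
  rewrite L2dotZr// cJ.
  by rewrite mulrAC [_^* * _]mulrC mulcJ -rmorphM.
have hS x : L2dot D (h x) S = (c x)^* * (nsq (h x))%:C.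
  rewrite /S L2dot_sumr// (bigD1 x)//= L2dotZr// L2dot_nsq big1 ?addr0// => y yx.
  by rewrite L2dotZr// orth ?mulr0// eq_sym.
have SS : L2dot D S S = Q%:C.
  rewrite {1}/S L2dot_suml// /Q rmorph_sum; apply: eq_bigr => x _.
  rewrite L2dotZl// hS mulrA mulcJ /c Normc.normcM exprMn normc_real.
  rewrite ger0_norm ?invr_ge0 ?nsq_ge0// -rmorphM; congr (_ %:C).
  have [->|nx] := eqVneq (nsq (h x)) 0; first by rewrite invr0 !mulr0.
  by field.
have := nsq_ge0 (fun z => v z - S z); rewrite -lecR -L2dot_nsq.
have LvS := L2B Lv LS.
rewrite L2dotBl// (L2dotJ LvS Lv) (L2dotJ LvS LS) !L2dotBl//.
rewrite (L2dotJ Lv LS) vS SS L2dot_nsq subrr conjc0 subr0 conjcR -rmorphB conjcR lecR subr_ge0.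
exact.
Qed.

Lemma L2_cauchy_schwarz v w : L2 D v -> L2 D w ->
  normc (L2dot D v w) ^+ 2 <= nsq v * nsq w.
Proof.
move=> Lv Lw; have [w0|w0] := eqVneq (nsq w) 0; last first.
  have := @bessel unit (fun=> w) v Lv (fun=> Lw).
  rewrite (bigD1 tt)//= big1 ?addr0; last by case.
  rewrite ler_pdivrMr; last by rewrite lt_neqAle eq_sym w0 nsq_ge0.
  by apply => -[] [].
(* the vector [w] is null: test against [t v + w] for a negative [t] *)
rewrite w0 mulr0; set a := L2dot D v w.
have pos (t : R) : 0 <= 2 * t * normc a ^+ 2 + nsq v * t ^+ 2 * normc a ^+ 2.
  pose u z := (t%:C * a^*) * v z + w z.
  have Lu : L2 D u by apply: L2D => //; exact: L2Z.
  have := nsq_ge0 u; rewrite -lecR -L2dot_nsq {1}/u L2dotDl//; last exact: L2Z.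
  rewrite L2dotZl// (L2dotJ Lu Lv) (L2dotJ Lu Lw) /u !L2dotDl//; try exact: L2Z.
  rewrite !L2dotZl// !L2dot_nsq w0 (L2dotJ Lv Lw) -/a.
  rewrite -[X in X -> _]/(is_true (0%:C <= _)) => h.
  suff -> : 2 * t * normc a ^+ 2 + nsq v * t ^+ 2 * normc a ^+ 2 =
      complex.Re (t%:C * a^* * (t%:C * a^* * (nsq v)%:C + a^*)^* + (t%:C * a^* * a + 0%:C)^*).
    by move: h; rewrite lecE => /andP[].
  rewrite sqr_normcE; case: (a) => p q /=; ring.
have [a0|a0] := eqVneq (normc a ^+ 2) 0; first by rewrite a0.
have {}a0 : 0 < normc a ^+ 2 by rewrite lt_neqAle eq_sym a0 sqr_ge0.
have := pos (- (1 + nsq v)^-1); have nv := nsq_ge0 v.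
have s0 : 0 < (1 + nsq v)^-1 by rewrite invr_gt0 ltr_pwDl.
have s1 : (1 + nsq v)^-1 * (1 + nsq v) = 1 by rewrite mulVf// gt_eqF// ltr_pwDl.
move: (1 + nsq v)^-1 s0 s1 => s s0 s1 h; exfalso.
have : 0 <= (2 * - s + nsq v * (- s) ^+ 2) * normc a ^+ 2.
  by move: h; move: (normc a ^+ 2) => X; lra.
rewrite pmulr_lge0// leNgt => /negP; apply.
have -> : 2 * - s + nsq v * (- s) ^+ 2 = - s + s * ((s * (1 + nsq v)) - s - 1) by ring.
by rewrite s1; nra.
Qed.

Lemma L2dot_ae g g' w : L2 D g -> L2 D g' -> L2 D w -> ae_eq dV D g g' ->
  L2dot D g w = L2dot D g' w.
Proof.
move=> Lg Lg' Lw gg'.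
have [i1 i2] := L2dot_integrable Lg Lw; have [j1 j2] := L2dot_integrable Lg' Lw.
congr Complex; congr fine; apply: ae_eq_integral => //;
  try exact: (measurable_int dV).
  by apply: filterS gg' => z /= zz Dz; rewrite zz.
by apply: filterS gg' => z /= zz Dz; rewrite zz.
Qed.

End square_integrable.

(** * A lower bound for the Hilbert-Schmidt norm *)

Section hilbert_schmidt_bound.
Variables (R : realType) (n : nat) (D : set 'rV[R[i]]_n).
Local Notation Cn := 'rV[R[i]]_n.
Local Notation dV := (lebesgue_Cn R n).
Hypothesis mD : measurable D.
Implicit Types (g h v w : Cn -> R[i]).

Lemma bergman_L2 g : bergman_space D g -> L2 D g.
Proof. by case. Qed.

Lemma bergman_lin (a : R[i]) g h : bergman_space D g -> bergman_space D h ->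
  bergman_space D (fun z => a * g z + h z).
Proof.
move=> [hg Lg] [hh Lh]; split; last by apply: L2D => //; exact: L2Z.
move=> z Dz.
apply: (@differentiableD _ _ _ (fun z => a * g z) h z); last exact: hh.
apply: (@differentiableM _ _ (fun=> a) g z); first exact: differentiable_cst.
exact: hg.
Qed.

Lemma bergman0 : bergman_space D (fun=> 0).
Proof. by split; [move=> z _; exact: differentiable_cst|exact: L2_0]. Qed.

Lemma bergman_sum (c : nat -> R[i]) (xi : nat -> Cn -> R[i]) N :
  (forall j, bergman_space D (xi j)) ->
  bergman_space D (fun z => \sum_(0 <= j < N) c j * xi j z).
Proof.
move=> hxi; elim: N => [|N ih].
  by under eq_fun do rewrite big_geq//; exact: bergman0.
under eq_fun do rewrite big_nat_recr//= addrC.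
exact: bergman_lin.
Qed.

Lemma bergmanB g h : bergman_space D g -> bergman_space D h ->
  bergman_space D (fun z => g z - h z).
Proof.
move=> hg hh; have := bergman_lin (-1) hh hg.
by under eq_fun do rewrite mulN1r addrC.
Qed.

Section functional.
Variables (l : (Cn -> R[i]) -> R[i]).
Hypothesis l_lin : forall a g h, bergman_space D g -> bergman_space D h ->
  l (fun z => a * g z + h z) = a * l g + l h.

Lemma functional_sum (c : nat -> R[i]) (xi : nat -> Cn -> R[i]) N :
  (forall j, bergman_space D (xi j)) ->
  l (fun z => \sum_(0 <= j < N) c j * xi j z) = \sum_(0 <= j < N) c j * l (xi j).
Proof.
move=> hxi.
have l0 : l (fun=> 0) = 0.
  have := l_lin 1 bergman0 bergman0.
  rewrite (_ : (fun z : Cn => 1 * 0 + 0) = fun=> 0); last first.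
    by apply/funext => z; rewrite mulr0 addr0.
  by rewrite mul1r => h; apply: (addrI (l (fun=> 0))); rewrite -h addr0.
elim: N => [|N ih].
  by rewrite big_geq// -{2}l0; congr l; apply/funext => z; rewrite big_geq.
rewrite big_nat_recr//= addrC -ih -l_lin//; last exact: bergman_sum.
by congr l; apply/funext => z; rewrite big_nat_recr//= addrC.
Qed.

Lemma functionalB g h : bergman_space D g -> bergman_space D h ->
  l (fun z => g z - h z) = l g - l h.
Proof.
move=> hg hh; have := l_lin (-1) hh hg; rewrite mulN1r addrC => <-.
by congr l; apply/funext => z; rewrite mulN1r addrC.
Qed.

End functional.

Variables (T : (Cn -> R[i]) -> Cn -> R[i]) (xi : nat -> Cn -> R[i]).
Hypotheses (T_bnd : bounded_operator D T) (xi_basis : bergman_orthonormal_basis D xi).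

Let T_L2 g : bergman_space D g -> L2 D (T g). Proof. by case: T_bnd => + _ _; exact. Qed.

Let xi_A j : bergman_space D (xi j). Proof. by case: xi_basis. Qed.

Lemma operator_functional_lin w : L2 D w -> forall a g h, bergman_space D g -> bergman_space D h ->
  L2dot D (T (fun z => a * g z + h z)) w = a * L2dot D (T g) w + L2dot D (T h) w.
Proof.
move=> Lw a g h Ag Ah; have [_ lin _] := T_bnd.
rewrite (L2dot_ae mD _ _ Lw (lin a g h Ag Ah)); last 2 first.
- exact/T_L2/bergman_lin.
- by apply: L2D => //; [apply: L2Z => //; exact: T_L2|exact: T_L2].
by rewrite L2dotDl// ?L2dotZl//; try exact: T_L2; apply: L2Z => //; exact: T_L2.
Qed.

(** With [tau j = L2dot D (T (xi j)) w], the functional [g |-> <T g, w>] is, on the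
    span of the first [N0] basis vectors, the inner product with
    [\sum_j (tau j)^* * xi j], so it is controlled by the sum of the
    [normc (tau j) ^+ 2]; approximating [v] by such spans costs an arbitrarily
    small [eta]. *)
Lemma functional_bound v w (eta : R) : bergman_space D v -> L2 D w -> 0 < eta ->
  (exists S : R, forall N, \sum_(0 <= j < N) normc (L2dot D (T (xi j)) w) ^+ 2 <= S) ->
  exists N0 : nat, forall N, (N0 <= N)%N ->
    normc (L2dot D (T v) w) ^+ 2 <=
      nsq D v * \sum_(0 <= j < N) normc (L2dot D (T (xi j)) w) ^+ 2 + eta.
Proof.
move=> Av Lw eta0 [S hS]; pose tau j := L2dot D (T (xi j)) w.
have S0 : 0 <= S by have := hS 0%N; rewrite big_geq.
have [_ orth dense] := xi_basis.
have [_ _ [M hM]] := T_bnd.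
have lin := operator_functional_lin Lw.
pose K := 2 * M ^+ 2 * nsq D w + 2 * S.
have K0 : 0 <= K by rewrite addr_ge0// mulr_ge0 ?nsq_ge0// mulr_ge0 ?sqr_ge0.
(* [dlt * C] bounds all the errors of an approximation of [v] up to [dlt] *)
pose C := 1 + 2 * K + 2 * (1 + nsq D v * S).
have C0 : 1 <= C.
  by have := mulr_ge0 (nsq_ge0 D v) S0; rewrite /C; move: (nsq D v * S) => t t0; lra.
pose dlt := Num.min 1 (eta / C).
have C00 : 0 < C by exact: lt_le_trans ltr01 C0.
have d0 : 0 < dlt by rewrite lt_min ltr01 divr_gt0.
have d1 : dlt <= 1 by rewrite ge_min lexx.
have dC : dlt * C <= eta by rewrite -ler_pdivlMr// ge_min lexx orbT.
have [N0 [c hc]] := dense v Av (dlt ^+ 2) (exprn_gt0 _ d0).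
exists N0 => N N0N; set b := \sum_(0 <= j < N) _.
pose g z := \sum_(0 <= j < N0) (tau j)^* * xi j z.
pose u z := \sum_(0 <= j < N0) c j * xi j z.
have Ag : bergman_space D g by exact: (bergman_sum (fun j => (tau j)^*)).
have Au : bergman_space D u by exact: bergman_sum.
have Lv := bergman_L2 Av; have Lg := bergman_L2 Ag; have Lu := bergman_L2 Au.
have Avu := bergmanB Av Au; have Lvu := bergman_L2 Avu.
set b0 := \sum_(0 <= j < N0) normc (tau j) ^+ 2.
have b0b : b0 <= b.
  rewrite /b (big_cat_nat _ N0N)//= lerDl sumr_ge0// => j _; exact: sqr_ge0.
have b00 : 0 <= b0 by apply: sumr_ge0 => j _; exact: sqr_ge0.
have xL j := bergman_L2 (xi_A j).
have dotg h : L2 D h -> L2dot D h g = \sum_(0 <= j < N0) tau j * L2dot D h (xi j).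
  move=> Lh; rewrite /g L2dot_sumr//; last by move=> i; exact: L2Z.
  by apply: eq_bigr => j _; rewrite L2dotZr// conjcK.
have lu : L2dot D (T u) w = L2dot D u g.
  rewrite (functional_sum (l := fun g => L2dot D (T g) w) lin c N0 xi_A).
  rewrite /u L2dot_suml//; last by move=> i; exact: L2Z.
  rewrite !big_mkord; apply: eq_bigr => j _; rewrite L2dotZl// dotg//; congr (_ * _).
  rewrite big_mkord (bigD1 j)//= big1 ?addr0; first by rewrite orth eqxx mulr1.
  by move=> i ij; rewrite orth val_eqE eq_sym (negbTE ij) mulr0.
have ng : nsq D g = b0.
  apply: complexI; rewrite -L2dot_nsq// {1}/g L2dot_suml//; last by move=> i; exact: L2Z.
  rewrite /b0 rmorph_sum !big_mkord; apply: eq_bigr => j _.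
  rewrite L2dotZl// dotg// big_mkord (bigD1 j)//= big1 ?addr0.
    by rewrite orth eqxx mulr1 mulrC mulcJ.
  by move=> i ij; rewrite orth val_eqE eq_sym (negbTE ij) mulr0.
have nvu : nsq D (fun z => v z - u z) < dlt ^+ 2 by rewrite -lte_fin -L2norm_sqE.
set X := L2dot D (T (fun z => v z - u z)) w; set Y := L2dot D (fun z => v z - u z) g.
set Z := L2dot D v g.
have E : L2dot D (T v) w = Z + (X - Y).
  rewrite /X /Y (functionalB (l := fun g => L2dot D (T g) w) lin)// L2dotBl// lu.
  by rewrite /Z; ring.
have hX : normc X ^+ 2 <= M ^+ 2 * nsq D w * dlt ^+ 2.
  apply: (le_trans (L2_cauchy_schwarz mD (T_L2 Avu) Lw)).
  have := hM _ Avu; rewrite L2norm_sqE//; last exact: T_L2.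
  rewrite L2norm_sqE// -EFinM lee_fin => h.
  rewrite mulrAC ler_wpM2r ?nsq_ge0// (le_trans h)// ler_wpM2l ?sqr_ge0//.
  exact: ltW.
have hY : normc Y ^+ 2 <= S * dlt ^+ 2.
  apply: (le_trans (L2_cauchy_schwarz mD Lvu Lg)); rewrite ng mulrC.
  by apply: ler_pM => //; [exact: nsq_ge0|exact: hS|exact: ltW].
have hZ : normc Z ^+ 2 <= nsq D v * b0.
  by apply: (le_trans (L2_cauchy_schwarz mD Lv Lg)); rewrite ng.
have hXY : normc (X - Y) ^+ 2 <= K * dlt ^+ 2.
  have := normcD_le X (- Y); rewrite normcN.
  have := normc_ge0 (X - Y); have := normc_ge0 X; have := normc_ge0 Y.
  have := sqr_ge0 (normc X - normc Y).
  rewrite /K; move: hX hY; move: (normc X) (normc Y) (normc (X - Y)) => x y t.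
  by nra.
have vb : nsq D v * b0 <= nsq D v * S by rewrite ler_wpM2l ?nsq_ge0//; exact: hS.
have : normc (Z + (X - Y)) ^+ 2 <= nsq D v * b0 + dlt * C.
  have h1 := normcD_le Z (X - Y).
  apply: (@le_trans _ _ ((normc Z + normc (X - Y)) ^+ 2)).
    by rewrite ler_pXn2r ?nnegrE ?addr_ge0 ?normc_ge0.
  have z0 := normc_ge0 Z; have t0 := normc_ge0 (X - Y).
  move: (normc Z) (normc (X - Y)) z0 t0 hZ hXY {h1} => z t z0 t0 hZ hXY.
  have d2 : dlt ^+ 2 <= dlt by rewrite expr2 ler_piMl// ltW.
  have Kd : K * dlt ^+ 2 <= K * dlt by rewrite ler_wpM2l.
  have zS : z ^+ 2 <= nsq D v * S by exact: le_trans hZ vb.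
  have zt : 2 * z * t <= dlt * z ^+ 2 + dlt * K.
    have : 0 <= (dlt * z - t) ^+ 2 by exact: sqr_ge0.
    move=> h; rewrite -(ler_pM2l d0).
    have : t ^+ 2 <= K * dlt ^+ 2 by [].
    nra.
  have dz : dlt * z ^+ 2 <= dlt * (nsq D v * S) by rewrite ler_pM2l.
  have nS0 : 0 <= dlt * (nsq D v * S) by rewrite mulr_ge0 ?(ltW d0)// mulr_ge0 ?nsq_ge0.
  have -> : (z + t) ^+ 2 = z ^+ 2 + 2 * z * t + t ^+ 2 by ring.
  have -> : dlt * C = dlt + 2 * (dlt * K) + 2 * dlt + 2 * (dlt * (nsq D v * S)).
    by rewrite /C; ring.
  have -> : dlt * K = K * dlt by rewrite mulrC.
  move: zt; rewrite [dlt * K]mulrC; lra.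
rewrite -E => h; apply: (le_trans h); rewrite lerD//.
by rewrite ler_wpM2l ?nsq_ge0.
Qed.

Hypothesis T_sum : (\sum_(0 <= j <oo) L2norm_sq D (T (xi j)) < +oo)%E.

(** By [functional_bound] a term is at most the sum over [j] of
    [|<T (xi j), w x>| ^ 2 / |w x| ^ 2]. Summing over [x] first, Bessel's inequality
    leaves the sum of the [|T (xi j)| ^ 2]. This replaces the adjoint of [T]. *)
Lemma hilbert_schmidt_bound : exists S : R, forall (I : finType) (v w : I -> Cn -> R[i]),
  (forall x, bergman_space D (v x)) -> (forall x, L2 D (w x)) ->
  (forall x y, x != y -> L2dot D (w x) (w y) = 0) ->
  (forall x, 0 < nsq D (v x)) ->
  \sum_x normc (L2dot D (T (v x)) (w x)) ^+ 2 / (nsq D (v x) * nsq D (w x)) <= S.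
Proof.
pose s := (\sum_(0 <= j <oo) L2norm_sq D (T (xi j)))%E.
have s0 : (0 <= s)%E.
  by apply: nneseries_ge0 => j _ _; rewrite L2norm_sqE ?lee_fin ?nsq_ge0//; exact: T_L2.
pose S := fine s.
have sE : s = S%:E by rewrite /S fineK// ge0_fin_numE.
have part N : \sum_(0 <= j < N) nsq D (T (xi j)) <= S.
  rewrite -lee_fin -sE -sumEFin.
  rewrite (eq_bigr (fun j => L2norm_sq D (T (xi j)))); last first.
    by move=> j _; rewrite L2norm_sqE//; exact: T_L2.
  by apply: nneseries_lim_ge => j _ _; rewrite L2norm_sqE ?lee_fin ?nsq_ge0//; exact: T_L2.
exists (S + 1) => I v w Av Lw orth v0.
pose B x N := (\sum_(0 <= j < N) normc (L2dot D (T (xi j)) (w x)) ^+ 2) / nsq D (w x).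
(* the errors [e] of the terms add up to less than [1] *)
pose e : R := (#|I|%:R + 1)^-1.
have e0 : 0 < e by rewrite invr_gt0 ltr_wpDl// ler0n.
have step x : exists N0 : nat, forall N, (N0 <= N)%N ->
    normc (L2dot D (T (v x)) (w x)) ^+ 2 / (nsq D (v x) * nsq D (w x)) <= B x N + e.
  have [w0|w0] := eqVneq (nsq D (w x)) 0.
    by exists 0%N => N _; rewrite /B w0 mulr0 invr0 !mulr0 add0r ltW.
  have {}w0 : 0 < nsq D (w x) by rewrite lt_neqAle eq_sym w0 nsq_ge0.
  have vw0 : 0 < nsq D (v x) * nsq D (w x) by rewrite mulr_gt0.
  have [|N0 hN0] := @functional_bound (v x) (w x) (e * (nsq D (v x) * nsq D (w x))) (Av x) (Lw x) (mulr_gt0 e0 vw0).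
    exists (S * nsq D (w x)) => N.
    apply: (@le_trans _ _ (\sum_(0 <= j < N) (nsq D (T (xi j)) * nsq D (w x)))).
      by apply: ler_sum => j _; apply: L2_cauchy_schwarz => //; exact: T_L2.
    by rewrite -mulr_suml ler_wpM2r ?nsq_ge0.
  exists N0 => N /hN0 h; rewrite ler_pdivrMr// (le_trans h)//.
  rewrite mulrDl /B; apply: lerD => //; rewrite le_eqVlt; apply/orP; left; apply/eqP.
  by rewrite [nsq D (v x) * nsq D (w x)]mulrC mulrA divfK ?gt_eqF// mulrC.
have [N0 hN0] := choice step.
pose N := \max_x N0 x.
apply: (@le_trans _ _ (\sum_x (B x N + e))).
  by apply: ler_sum => x _; apply: hN0; exact: leq_bigmax.
rewrite big_split/= lerD//.
  apply: le_trans (part N).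
  rewrite /B; under eq_bigr do rewrite mulr_suml.
  rewrite exchange_big/=; apply: ler_sum => j _.
  by apply: bessel => //; exact: T_L2.
rewrite sumr_const -[X in X <= _]mulr_natl /e ler_pdivrMr ?ltr_wpDl ?ler0n// mul1r.
by rewrite (_ : #|_| = #|I|) ?lerDl.
Qed.

End hilbert_schmidt_bound.

(** * Monomials in the Bergman space *)

Section reinhardt_domain.
Variables (R : realType) (n : nat) (D : set 'rV[R[i]]_n).
Local Notation Cn := 'rV[R[i]]_n.
Local Notation dV := (lebesgue_Cn R n).
Hypotheses (mD : measurable D) (D_complete : complete_reinhardt D).
Hypothesis D_disc : D `<=` polydisc 0 1.
Variable r : R.
Hypotheses (r_gt0 : 0 < r) (D_polydisc : polydisc 0 r `<=` D).

Lemma reinhardt_pos : (0 < dV D)%E.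
Proof.
apply: lt_le_trans (lebesgue_Cn_polydisc_gt0 0 r_gt0) _.
by apply: le_measure; rewrite ?inE//; exact: measurable_polydisc.
Qed.
Let D_finite := D_fin mD D_disc.

Lemma cmeas_mono_on (d : 'I_n -> nat) : cmeas D (mono d).
Proof. exact: (cmeasS measurableT (@subsetT _ _) (@cmeas_mono R n d)). Qed.

Lemma integrable_cst_on (x : R) : dV.-integrable D (EFin \o (fun=> x)).
Proof.
apply/integrableP; split; first exact/measurable_EFinP/measurable_cst.
by rewrite /= integral_cst// lte_mul_pinfty.
Qed.

Lemma L2_bounded (h : Cn -> R[i]) (B : R) : cmeas D h ->
  (forall z, D z -> normc (h z) <= B) -> L2 D h.
Proof.
move=> mh hB; apply: (L2_dominated mD mh (integrable_cst_on (B ^+ 2))) => z Dz.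
have B0 := le_trans (normc_ge0 _) (hB z Dz).
by rewrite ler_pXn2r ?nnegrE ?normc_ge0// hB.
Qed.

Lemma differentiable_mono (d : 'I_n -> nat) (z : Cn) : differentiable (@mono R n d : Cn -> R[i]) z.
Proof.
rewrite /mono; elim: (index_enum _) => [|j s ih].
  by under eq_fun do rewrite big_nil; exact: differentiable_cst.
under eq_fun do rewrite big_cons.
apply: (@differentiableM _ _ (fun z : Cn => z ord0 j ^+ d j) _ z) => //.
by apply: (@differentiable_power _ _ (fun z : Cn => z ord0 j)); exact: differentiable_coord.
Qed.

Lemma bergman_mono d : bergman_space D (@mono R n d).
Proof.
split; first by move=> z _; exact: differentiable_mono.
by apply: (L2_bounded (cmeas_mono_on d) (B := 1)) => z; exact: normc_mono_le1.
Qed.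

Lemma L2_integrable (g : Cn -> R[i]) : L2 D g -> cintegrable dV D g.
Proof.
move=> Lg; have L1 : L2 D (fun=> 1).
  by apply: (L2_bounded (cmeas_cst _ _) (B := 1)) => z _; rewrite Normc.normc1.
have := L2dot_integrable mD Lg L1.
by apply: (eq_cintegrable mD) => z _; rewrite conjc1 mulr1.
Qed.

Lemma L2_mul_bounded (g q : Cn -> R[i]) (B : R) : L2 D g -> cmeas D q ->
  (forall z, D z -> normc (q z) <= B) -> L2 D (fun z => g z * q z).
Proof.
move=> Lg mq qB; apply: (@L2_dominated _ _ _ mD _ (fun z => B ^+ 2 * normc (g z) ^+ 2)).
- by apply: cmeasM => //; case: Lg.
- exact: (integrableZl mD (B ^+ 2) (L2_sqr_integrable Lg)).
- move=> z Dz; have B0 := le_trans (normc_ge0 _) (qB z Dz).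
  by rewrite Normc.normcM exprMn mulrC ler_wpM2r ?sqr_ge0// ler_pXn2r ?nnegrE ?normc_ge0// qB.
Qed.

Lemma normc_mono_rot d u z : unimodular u -> normc (mono d (cmul u z : Cn)) = normc (mono d z).
Proof. by move=> u1; rewrite mono_cmul Normc.normcM normc_mono_unimodular// mul1r. Qed.

Lemma cisX (y : R) m : cis y ^+ m = cis (m%:R * y) :> R[i].
Proof.
have E t : cis t = cexp (Complex 0 t) :> R[i] by rewrite cexp_polar expR0 mul1r.
rewrite !E -cexpMn; congr cexp; elim: m => [|m ih]; first by rewrite mulr0n mul0r.
by rewrite mulrS ih -natr1 mulrDl mul1r addrC; apply/eqP; rewrite eq_complex/= addr0 !eqxx.
Qed.

(** Some rotation of the [j]-th coordinate multiplies [q] by [-1]. *)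
Lemma cint_weight_eq0 (q : Cn -> R[i]) j a b : cintegrable dV D q ->
  (forall y z, q (cmul (dilation j (cis y)) z) = cis y ^+ a * (cis y)^* ^+ b * q z) ->
  a != b -> cint dV D q = 0.
Proof.
move=> iq qw ab; have mq := cintegrable_cmeas iq.
have dil_uni y : unimodular (dilation j (cis y) : Cn).
  by move=> i; rewrite mxE; case: ifP => _; rewrite ?normc_cis ?Normc.normc1.
have [y hy] : exists y : R, cis y ^+ a * (cis y)^* ^+ b = -1.
  have pw m : (0 < m)%N -> cis (pi / m%:R) ^+ m = -1 :> R[i].
    move=> m0; rewrite cisX mulrCA divff ?mulr1 ?pnatr_eq0 -?lt0n//.
    by rewrite /cis cospi sinpi; apply/eqP; rewrite eq_complex/= oppr0 !eqxx.
  case: (ltngtP a b) ab => // h _.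
    have := subn_gt0 a b; rewrite h; move: (subnKC (ltnW h)); move: (b - a)%N => m <- m0.
    exists (pi / m%:R); rewrite exprD mulrA -exprMn [cis _ * _]mulrC cisJ expr1n mul1r.
    by rewrite -rmorphXn/= pw// rmorphN1.
  have := subn_gt0 b a; rewrite h; move: (subnKC (ltnW h)); move: (a - b)%N => m <- m0.
  exists (pi / m%:R); rewrite exprD mulrAC -exprMn [cis _ * _]mulrC cisJ expr1n mul1r.
  by rewrite pw.
have := cint_measure_preserving (cmul_preserving (dil_uni y)) mD (rotation_preimage D_complete (dil_uni y)) mq.
rewrite (@eq_cint _ _ _ dV D _ (fun z => - q z)); last by move=> z _; rewrite qw hy mulN1r.
rewrite cintN// => /eqP; rewrite eq_sym -subr_eq0 opprK => /eqP h.
have : (2%:R : R[i]) * cint dV D q = 0 by rewrite mulr_natl mulr2n.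
by move/eqP; rewrite mulf_eq0 pnatr_eq0 => /eqP.
Qed.

End reinhardt_domain.

(** * Chains of monomials *)

Section monomial_chain.
Variables (R : realType) (n : nat) (D : set 'rV[R[i]]_n).
Local Notation Cn := 'rV[R[i]]_n.
Local Notation dV := (lebesgue_Cn R n).
Hypothesis mD : measurable D.
Hypothesis D_disc : D `<=` polydisc 0 1.
Variable r : R.
Hypotheses (r_gt0 : 0 < r) (D_polydisc : polydisc 0 r `<=` D).
Let D_finite := D_fin mD D_disc.

Variables (alpha : 'I_n -> nat) (l : 'I_n).

Local Notation p := (@mono R n alpha).

Definition chain_degree (i k : nat) : 'I_n -> nat :=
  fun x => ((x == l) * i + k * alpha x)%N.
(** This is [z_l ^+ i * p z ^+ k]. *)
Definition chain i k : Cn -> R[i] := mono (chain_degree i k).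

Lemma chainS i k z : chain i k.+1 z = p z * chain i k z.
Proof.
rewrite /chain /mono -big_split/=; apply: eq_bigr => x _.
by rewrite -exprD; congr (_ ^+ _); rewrite /chain_degree mulSn addnCA.
Qed.

Lemma cmeas_chain i k : cmeas D (chain i k).
Proof. exact: cmeas_mono_on. Qed.

Lemma chain_A2 i k : bergman_space D (chain i k).
Proof. exact: bergman_mono. Qed.

Lemma chain_L2 i k : L2 D (chain i k).
Proof. by case: (chain_A2 i k). Qed.

Lemma normc_chain_le1 i k z : D z -> normc (chain i k z) <= 1.
Proof. exact: normc_mono_le1. Qed.

Definition cnorm i k : R := nsq D (chain i k).

(** On a small polydisc away from the axes all coordinates are at least [r / 4] in
    modulus, so [p] is bounded below there; this gives the rate [t], and [i]
    only affects [m]. *)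
Lemma cnorm_lower : exists2 t : R, 0 < t &
  forall i, exists2 m : R, 0 < m & forall k, t ^+ k * m <= cnorm i k.
Proof.
pose w : Cn := \row_x (r / 2)%:C; pose U := polydisc w (r / 4).
have r4 : 0 < r / 4 by rewrite divr_gt0.
have mU : measurable U by exact: measurable_polydisc.
have Ulow z x : U z -> r / 4 <= normc (z ord0 x).
  move=> /(_ x); rewrite mxE => h.
  have := normcD_le (z ord0 x) ((r / 2)%:C - z ord0 x); rewrite addrC subrK normc_real.
  rewrite ger0_norm ?divr_ge0 ?(ltW r_gt0)//.
  have -> : normc ((r / 2)%:C - z ord0 x) = normc (z ord0 x - (r / 2)%:C) by rewrite -normcN opprB.
  by move: h; lra.
have UD : U `<=` D.
  move=> z Uz; apply: D_polydisc => x; rewrite mxE subr0.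
  have := Uz x; rewrite mxE => h.
  have := normcD_le (z ord0 x - (r / 2)%:C) (r / 2)%:C; rewrite subrK normc_real.
  by rewrite ger0_norm ?divr_ge0 ?(ltW r_gt0)//; move: h; lra.
have U0 : (0 < dV U)%E by exact: lebesgue_Cn_polydisc_gt0.
have Ufin : (dV U < +oo)%E.
  by apply: le_lt_trans D_finite; apply: le_measure; rewrite ?inE.
pose V := fine (dV U).
have V0 : 0 < V by rewrite fine_gt0// U0.
have monolow d z : U z -> (r / 4) ^+ (\sum_x d x) <= normc (mono d z).
  move=> Uz; rewrite normc_mono expr_sum; apply: ler_prod => x _.
  rewrite exprn_ge0 ?(ltW r4)//=.
  by apply: lerXn2r; rewrite ?nnegrE ?normc_ge0 ?(ltW r4)// Ulow.
exists ((r / 4) ^+ (\sum_x alpha x) ^+ 2); first by rewrite !exprn_gt0.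
move=> i; exists ((r / 4) ^+ (\sum_x chain_degree i 0 x) ^+ 2 * V); first by rewrite mulr_gt0// !exprn_gt0.
move=> k; set s := (r / 4) ^+ _; set m := (r / 4) ^+ _.
have low z : U z -> (s ^+ 2) ^+ k * m ^+ 2 <= normc (chain i k z) ^+ 2.
  move=> Uz.
  have -> : normc (chain i k z) = normc (p z) ^+ k * normc (chain i 0 z).
    elim: k => [|k ih]; first by rewrite expr0 mul1r.
    by rewrite chainS Normc.normcM ih exprS mulrA.
  have s0 : 0 <= s by rewrite exprn_ge0// ltW.
  have m0 : 0 <= m by rewrite exprn_ge0// ltW.
  rewrite [leRHS]exprMn; apply: ler_pM; [by do 2 apply: exprn_ge0|exact: exprn_ge0| | ].
    have -> : (normc (p z) ^+ k) ^+ 2 = (normc (p z) ^+ 2) ^+ k by rewrite -!exprM mulnC.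
    apply: lerXn2r; rewrite ?nnegrE ?sqr_ge0//.
    by apply: lerXn2r; rewrite ?nnegrE ?normc_ge0// monolow.
  by apply: lerXn2r; rewrite ?nnegrE ?normc_ge0// monolow.
rewrite mulrA -lee_fin -L2norm_sqE//; last exact: chain_L2.
rewrite EFinM /V fineK ?ge0_fin_numE ?measure_ge0//.
rewrite -integral_cst//.
apply: (@le_trans _ _ (\int[dV]_(z in U) (normc (chain i k z) ^+ 2)%:E)%E).
  apply: ge0_le_integral => //.
  - by move=> z _; rewrite lee_fin mulr_ge0// ?exprn_ge0// ?exprn_ge0// ltW.
  - apply/measurable_EFinP; apply: cmeas_sqr_normc.
    exact: (cmeasS mD UD (cmeas_chain i k)).
apply: ge0_subset_integral => //.
  apply/measurable_EFinP; apply: cmeas_sqr_normc; exact: cmeas_chain.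
by move=> z _; rewrite lee_fin sqr_ge0.
Qed.

Lemma cnorm_gt0 i k : 0 < cnorm i k.
Proof.
have [t t0 /(_ i)[m m0 h]] := cnorm_lower.
by apply: lt_le_trans (h k); rewrite mulr_gt0// exprn_gt0.
Qed.

(** If all the ratios in a chain were less than [t / 2], the norms would decay
    faster than [cnorm_lower] allows. *)
Lemma cnorm_ratio : exists2 t : R, 0 < t &
  forall i, exists k, t <= cnorm i k.+1 / cnorm i k.
Proof.
have [t t0 ht] := cnorm_lower; exists (t / 2); first by rewrite divr_gt0.
move=> i; have [m m0 hm] := ht i; apply: contrapT => /forallNP noK.
have up k : cnorm i k <= cnorm i 0 * (t / 2) ^+ k.
  elim: k => [|k ih]; first by rewrite expr0 mulr1.
  have /negP := noK k; rewrite -ltNge ltr_pdivrMr ?cnorm_gt0// => h.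
  by rewrite exprS mulrCA (le_trans (ltW h))// ler_pM2l ?divr_gt0.
have main k : 2 ^+ k <= cnorm i 0 / m.
  rewrite ler_pdivlMr//; have h := le_trans (hm k) (up k).
  have tk : 0 < t ^+ k by rewrite exprn_gt0.
  have k2 : 0 < (2 : R) ^+ k by rewrite exprn_gt0.
  have e : (t / 2) ^+ k * 2 ^+ k = t ^+ k by rewrite -exprMn divfK.
  rewrite -(ler_pM2l tk) mulrCA.
  apply: (@le_trans _ _ (2 ^+ k * (cnorm i 0 * (t / 2) ^+ k))); first by rewrite ler_pM2l.
  by rewrite -e le_eqVlt; apply/orP; left; apply/eqP; ring.
have [k hk] : exists k, cnorm i 0 / m < 2 ^+ k.
  exists (Num.truncn (cnorm i 0 / m)).+1.
  apply: (@lt_le_trans _ _ ((Num.truncn (cnorm i 0 / m)).+1%:R)).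
    by apply: truncnS_gt.
  by rewrite -natrX ler_nat ltnW// ltn_expl.
by have := main k; rewrite leNgt hk.
Qed.

End monomial_chain.

(** * Test functions for the Hankel operator *)

Section hankel_test.
Variables (R : realType) (n : nat) (D : set 'rV[R[i]]_n).
Local Notation Cn := 'rV[R[i]]_n.
Local Notation dV := (lebesgue_Cn R n).
Hypotheses (mD : measurable D) (D_complete : complete_reinhardt D).
Hypothesis D_disc : D `<=` polydisc 0 1.
Variable r : R.
Hypotheses (r_gt0 : 0 < r) (D_polydisc : polydisc 0 r `<=` D).
Let D_pos := reinhardt_pos mD r_gt0 D_polydisc.

Variables (alpha : 'I_n -> nat) (j l : 'I_n).
Hypotheses (alpha_j : (0 < alpha j)%N) (lj : l != j).

Local Notation p := (@mono R n alpha).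
Local Notation chain := (@chain R n alpha l).
Local Notation cnorm := (@cnorm R n D alpha l).

Let chain_L2 i k : L2 D (chain i k). Proof. exact: chain_L2. Qed.

(** Also the coefficient of [chain i k] in the projection of
    [p^* * chain i k.+1] on the Bergman space. *)
Definition ratio i k := cnorm i k.+1 / cnorm i k.

(** The radial factor of [(chain i k)^* * test i k], see [chainJ_test]. *)
Definition test_weight i k (z : Cn) : R :=
  if k is k'.+1 then normc (chain i k' z) ^+ 2 * (normc (p z) ^+ 2 - ratio i k')
  else normc (chain i 0 z) ^+ 2.

(** This is [p^* * chain i k] minus its projection on the Bergman space, so the
    image of [chain i k] under the Hankel operator with symbol [p^*]. *)
Definition test i k (z : Cn) : R[i] :=
  if k is k'.+1 then chain i k' z * (normc (p z) ^+ 2 - ratio i k')%:C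
  else (p z)^* * chain i 0 z.

Definition test_norm i k : R :=
  if k is k'.+1 then cnorm i k'.+2 - ratio i k' * cnorm i k'.+1 else cnorm i 1.

Let normc_p_le1 z : D z -> normc (p z) <= 1.
Proof. exact: normc_mono_le1. Qed.

Let normc_chain_le1 i k z : D z -> normc (chain i k z) <= 1.
Proof. exact: normc_chain_le1. Qed.

Let cmeas_p : cmeas D p. Proof. exact: cmeas_mono_on. Qed.

Let cmeas_chain i k : cmeas D (chain i k). Proof. exact: cmeas_chain. Qed.

Lemma test_L2 i k : L2 D (test i k).
Proof.
case: k => [|k].
  apply: (L2_bounded mD D_disc (B := 1)).
    by apply: cmeasM => //; exact: cmeasJ.
  move=> z Dz; rewrite /= Normc.normcM normcJ -[leRHS]mulr1.
  by apply: ler_pM; rewrite ?normc_ge0// ?normc_p_le1 ?normc_chain_le1.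
apply: (L2_mul_bounded mD (B := 1 + `|ratio i k|)) => //.
  apply: cmeas_real; apply: measurable_funB => //; exact: cmeas_sqr_normc.
move=> z Dz; rewrite normc_real (le_trans (ler_normB _ _))// lerD//.
by rewrite ger0_norm ?sqr_ge0// exprn_ile1 ?normc_ge0// normc_p_le1.
Qed.

Lemma chainJ_test i k z : (chain i k z)^* * test i k z = (p z)^* * (test_weight i k z)%:C.
Proof.
case: k => [|k] /=; first by rewrite mulrCA [_^* * chain _ _ _]mulrC mulcJ.
have -> : (normc (chain i k z) ^+ 2 * (normc (p z) ^+ 2 - ratio i k))%:C =
    chain i k z * (chain i k z)^* * (normc (p z) ^+ 2 - ratio i k)%:C :> R[i].
  by rewrite mulcJ -rmorphM.
by rewrite chainS conjcM; ring.
Qed.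

Lemma sqr_test i k z : normc (test i k z) ^+ 2 =
  (if k is k'.+1 then
     normc (chain i k'.+2 z) ^+ 2 - 2 * ratio i k' * normc (chain i k'.+1 z) ^+ 2
       + ratio i k' ^+ 2 * normc (chain i k' z) ^+ 2
   else normc (chain i 1 z) ^+ 2).
Proof.
case: k => [|k].
  by rewrite -[test i 0 z]/((p z)^* * chain i 0 z) chainS !Normc.normcM normcJ.
rewrite -[test i k.+1 z]/(chain i k z * (normc (p z) ^+ 2 - ratio i k)%:C).
rewrite !chainS !Normc.normcM normc_real; move: (ratio i k) => x.
by rewrite !exprMn real_normK ?num_real//; ring.
Qed.

Let isq i k : dV.-integrable D (EFin \o (fun z => normc (chain i k z) ^+ 2)).
Proof. exact: L2_sqr_integrable. Qed.

Let isqZ (x : R) i k : dV.-integrable D (EFin \o (fun z => x * normc (chain i k z) ^+ 2)).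
Proof. exact: (integrableZl mD x (isq i k)). Qed.

Let cnorm0 i k : 0 < cnorm i k. Proof. exact: (cnorm_gt0 mD D_disc r_gt0). Qed.

Lemma ratioK i k : ratio i k * cnorm i k = cnorm i k.+1.
Proof. by rewrite /ratio divfK ?gt_eqF. Qed.

Lemma nsq_test i k : nsq D (test i k) = test_norm i k.
Proof.
transitivity (\int[dV]_(z in D) (if k is k'.+1 then
     normc (chain i k'.+2 z) ^+ 2 - 2 * ratio i k' * normc (chain i k'.+1 z) ^+ 2
       + ratio i k' ^+ 2 * normc (chain i k' z) ^+ 2
   else normc (chain i 1 z) ^+ 2))%R.
  by apply: eq_Rintegral => z _; rewrite sqr_test.
case: k => [|k] //.
rewrite (RintegralD mD (integrableB mD (isq i k.+2) (isqZ (2 * ratio i k) i k.+1))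
  (isqZ (ratio i k ^+ 2) i k)).
rewrite (RintegralB mD (isq i k.+2) (isqZ (2 * ratio i k) i k.+1)).
rewrite (RintegralZl _ mD (isq i k.+1)) (RintegralZl _ mD (isq i k)).
rewrite -/(nsq D (chain i k)) -/(nsq D (chain i k.+1)) -/(nsq D (chain i k.+2)).
rewrite -!/(cnorm _ _) /test_norm.
have := ratioK i k; move: (cnorm i k.+2) (cnorm i k.+1) (cnorm i k) (ratio i k) => a b c x <-.
by ring.
Qed.

(** So the inner product of [hankel D f (chain i k)] with [test i k] is
    proportional to the square norm of [test i k]. *)
Lemma weight_moment i k :
  cint dV D (fun z => (normc (p z) ^+ 2)%:C * (test_weight i k z)%:C) = (test_norm i k)%:C.
Proof.
transitivity (cint dV D (fun z => (if k is k'.+1 then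
    normc (chain i k'.+2 z) ^+ 2 - ratio i k' * normc (chain i k'.+1 z) ^+ 2
   else normc (chain i 1 z) ^+ 2)%:C)).
  apply: eq_cint => z _; rewrite -rmorphM; congr (_%:C).
  case: k => [|k] /=; rewrite !chainS !Normc.normcM !exprMn//; ring.
rewrite cint_real//; congr (_%:C); case: k => [|k] //.
by rewrite (RintegralB mD (isq i k.+2) (isqZ _ i k.+1)) (RintegralZl _ mD (isq i k.+1)).
Qed.

(** This is what [ratio] is chosen for: [test i k.+1] is orthogonal to
    [chain i k]. *)
Lemma weight_mean_eq0 i k :
  cint dV D (fun z => (normc (chain i k z) ^+ 2)%:C * (normc (p z) ^+ 2 - ratio i k)%:C) = 0.
Proof.
transitivity (cint dV D (fun z => (normc (chain i k.+1 z) ^+ 2 - ratio i k * normc (chain i k z) ^+ 2)%:C)).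
  apply: eq_cint => z _; rewrite -rmorphM; congr (_%:C).
  by rewrite chainS Normc.normcM exprMn; ring.
rewrite cint_real// (RintegralB mD (isq i k.+1) (isqZ _ i k)) (RintegralZl _ mD (isq i k)).
by rewrite -/(nsq D (chain i k)) -/(nsq D (chain i k.+1)) -!/(cnorm _ _) ratioK subrr.
Qed.

Lemma cmeas_weight i k : cmeas D (fun z => (test_weight i k z)%:C).
Proof.
apply: cmeas_real; case: k => [|k] /=; first exact: cmeas_sqr_normc.
apply: measurable_funM; first exact: cmeas_sqr_normc.
by apply: measurable_funB => //; exact: cmeas_sqr_normc.
Qed.

Lemma normc_weight i k : exists B : R, forall z, D z -> normc (test_weight i k z)%:C <= B.
Proof.
exists (1 + `|ratio i k.-1|) => z Dz; rewrite normc_real.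
case: k => [|k] /=.
  rewrite ger0_norm ?sqr_ge0// -[leLHS]addr0 lerD// exprn_ile1 ?normc_ge0//.
  exact: normc_chain_le1.
rewrite normrM -[leRHS]mul1r; apply: ler_pM => //.
  by rewrite ger0_norm ?sqr_ge0// exprn_ile1 ?normc_ge0// normc_chain_le1.
rewrite (le_trans (ler_normB _ _))// lerD//.
by rewrite ger0_norm ?sqr_ge0// exprn_ile1 ?normc_ge0// normc_p_le1.
Qed.

Lemma weight_rotation_invariant i k : rotation_invariant (fun z : Cn => (test_weight i k z)%:C).
Proof.
move=> u z u1; congr (_%:C).
by case: k => [|k] /=; rewrite /chain !normc_mono_rot.
Qed.

(** The first test function of a chain has negative degree in the [j]-th
    variable; the later ones are orthogonal to the only monomial of their
    degree. *)
Lemma test_orthogonal g i k : bergman_space D g -> L2dot D g (test i k) = 0.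
Proof.
move=> [g_hol Lg]; have g_meas : cmeas D g by case: Lg.
have g_int := L2_integrable mD D_disc Lg.
case: k => [|k].
  transitivity (cint dV D (fun z => g z * (p z * (chain i 0 z)^*))).
    by apply: (@eq_cint _ _ _ dV D) => z _; rewrite /= conjcM conjcK.
  apply: (vanishing_moment mD D_complete D_disc g_hol g_meas g_int alpha_j (j := j) (B := 1)).
  - by apply: cmeasM => //; exact: cmeasJ.
  - move=> z Dz; rewrite Normc.normcM normcJ -[leRHS]mulr1.
    by apply: ler_pM; rewrite ?normc_ge0// ?normc_p_le1 ?normc_chain_le1.
  - move=> y z; rewrite /chain !mono_cmul !mono_dilation /chain_degree.
    by rewrite eq_sym (negbTE lj) /= !mul0n expr0 mul1r mulrA.
have [c hc] := weighted_moment mD D_complete D_disc D_pos g_hol g_meas g_int (chain_degree alpha l i k).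
transitivity (cint dV D (fun z => g z * ((mono (chain_degree alpha l i k) z)^* * (normc (p z) ^+ 2 - ratio i k)%:C))).
  by apply: (@eq_cint _ _ _ dV D) => z _; rewrite /= conjcM conjcR.
rewrite (hc _ (1 + `|ratio i k|)).
- by rewrite weight_mean_eq0 mulr0.
- by apply: cmeas_real; apply: measurable_funB => //; exact: cmeas_sqr_normc.
- move=> z Dz; rewrite normc_real (le_trans (ler_normB _ _))// lerD//.
  by rewrite ger0_norm ?sqr_ge0// exprn_ile1 ?normc_ge0// normc_p_le1.
- by move=> u z u1; rewrite normc_mono_rot.
Qed.

Lemma test_rotation i k x y z : test i k (cmul (dilation x (cis y)) z) =
  cis y ^+ chain_degree alpha l i k x * (cis y)^* ^+ alpha x * test i k z.
Proof.
have u1 : unimodular (dilation x (cis y) : Cn).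
  by move=> i'; rewrite mxE; case: ifP => _; rewrite ?normc_cis ?Normc.normc1.
case: k => [|k] /=; rewrite /chain !mono_cmul !mono_dilation.
  by rewrite conjcM conjcX; ring.
rewrite Normc.normcM normcX normc_cis expr1n mul1r.
have -> : chain_degree alpha l i k.+1 x = (chain_degree alpha l i k x + alpha x)%N.
  by rewrite /chain_degree mulSn [RHS]addnC addnCA.
have c1 : cis y ^+ alpha x * (cis y)^* ^+ alpha x = 1 :> R[i].
  by rewrite -exprMn mulrC cisJ expr1n.
by rewrite exprD -[LHS]mul1r -c1; ring.
Qed.

(** The torus acts on [test i k] by the character of multidegree
    [chain_degree alpha l i k - alpha], whose [j]-th entry determines [k], as
    [l != j] and [0 < alpha j], and whose [l]-th entry then determines [i]. *)
Lemma test_pairwise_orthogonal i k i' k' : (i, k) != (i', k') ->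
  L2dot D (test i k) (test i' k') = 0.
Proof.
move=> ne.
have [x hx] : exists x, chain_degree alpha l i k x != chain_degree alpha l i' k' x.
  have [kk|kk] := eqVneq k k'; last first.
    exists j; rewrite /chain_degree [j == l]eq_sym (negbTE lj) /= !mul0n !add0n.
    by rewrite eqn_mul2r negb_or -lt0n alpha_j.
  exists l; rewrite /chain_degree eqxx !mul1n kk eqn_add2r.
  by apply: contraNN ne => /eqP ->; rewrite kk.
apply: (cint_weight_eq0 mD D_complete (j := x)
  (a := chain_degree alpha l i k x) (b := chain_degree alpha l i' k' x)) => //.
  exact: L2dot_integrable (test_L2 _ _) (test_L2 _ _).
move=> y z; rewrite !test_rotation !conjcM.
rewrite !conjcX conjcK.
have c1 : (cis y)^* ^+ alpha x * cis y ^+ alpha x = 1 :> R[i] by rewrite -exprMn cisJ expr1n.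
rewrite -[RHS]mul1r -c1; ring.
Qed.

Variable f : Cn -> R[i].
Hypothesis f_A2 : bergman_space D f.

(** The projection of any function lies in the Bergman space, to which [test i k]
    is orthogonal, so only [f^* * chain i k] contributes. *)
Lemma hankel_test c i k : taylor_coef D f alpha c ->
  hankel_domain D f (chain i k) /\ L2 D (hankel D f (chain i k)) /\
  L2dot D (hankel D f (chain i k)) (test i k) = c^* * (test_norm i k)%:C.
Proof.
move=> hc; have [f_hol Lf] := f_A2.
have LJ : L2 D (fun z => (f z)^*).
  apply: (L2_dominated mD _ (L2_sqr_integrable Lf)); first by apply: cmeasJ; case: Lf.
  by move=> z _; rewrite normcJ.
have Lfe : L2 D (fun z => (f z)^* * chain i k z).
  by apply: (L2_mul_bounded mD LJ (B := 1)) => // z; exact: normc_chain_le1.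
set P := bergman_projection D (fun w => (f w)^* * chain i k w).
have AP : bergman_space D P.
  rewrite /P /bergman_projection; case: xgetP => [q _ []//|_]; exact: bergman0.
have dom : hankel_domain D f (chain i k) by split => //; exact: chain_A2.
split => //; split; first by apply: L2B => //; case: AP.
rewrite /hankel L2dotBl//; [|by case: AP|exact: test_L2].
rewrite (test_orthogonal i k AP) subr0.
have [B hB] := normc_weight i k.
have := hc _ B (cmeas_weight i k) hB (@weight_rotation_invariant i k).
rewrite weight_moment => h.
have -> : c^* * (test_norm i k)%:C = (c * (test_norm i k)%:C)^* by rewrite conjcM conjcR.
rewrite -h -cintJ//.
  apply: (@eq_cint _ _ _ dV D) => z _.
  by rewrite conjcM -chainJ_test conjcM conjcK mulrA.
have := cintegrableJ mD (L2dot_integrable mD Lfe (test_L2 i k)).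
apply: (eq_cintegrable mD) => z _.
by rewrite -chainJ_test !conjcM !conjcK mulrA.
Qed.

(** The term of index [k.+1] is [ratio i k.+1 - ratio i k]. *)
Lemma sum_test_norm i N :
  \sum_(0 <= k < N.+1) test_norm i k / cnorm i k = ratio i N.
Proof.
elim: N => [|N ih]; first by rewrite big_nat1.
rewrite big_nat_recr//= ih mulrBl -/(ratio i N.+1).
by rewrite -[ratio i N * _ / _]mulrA divff ?gt_eqF// mulr1 addrCA subrr addr0.
Qed.

(** Each chain contributes at least [normc c ^+ 2 * t] to a sum that is bounded by
    [S], and there is a chain for each [i]. *)
Theorem hankel_coef_eq0 c : hankel_hilbert_schmidt D f -> taylor_coef D f alpha c -> c = 0.
Proof.
move=> [T [[T_bnd [xi [xi_basis T_sum]]] T_hankel]] hc.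
have [S hS] := hilbert_schmidt_bound mD T_bnd xi_basis T_sum.
have [t t0 ht] := cnorm_ratio mD D_disc r_gt0 D_polydisc alpha l.
have tn0 i k : 0 <= test_norm i k by rewrite -nsq_test nsq_ge0.
have T_test i k : L2dot D (T (chain i k)) (test i k) = c^* * (test_norm i k)%:C.
  have [dom [Lh <-]] := hankel_test i k hc.
  apply: (L2dot_ae mD) => //; [|exact: test_L2|exact: T_hankel].
  by case: T_bnd => + _ _; apply; exact: chain_A2.
have [K0 hK0] := choice ht.
have bound K : normc c ^+ 2 * (K%:R * t) <= S.
  pose N := \max_(i < K) K0 i.
  apply: le_trans (hS ('I_K * 'I_N.+1)%type (fun x => chain x.1 x.2) (fun x => test x.1 x.2) _ _ _ _).
  - rewrite (eq_bigr (fun x : 'I_K * 'I_N.+1 => normc c ^+ 2 * (test_norm x.1 x.2 / cnorm x.1 x.2))).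
      rewrite -mulr_sumr ler_wpM2l ?sqr_ge0//.
      rewrite -(pair_bigA _ (fun (i : 'I_K) (k : 'I_N.+1) => test_norm i k / cnorm i k))/=.
      have -> : K%:R * t = \sum_(i < K) t by rewrite sumr_const card_ord mulr_natl.
      apply: ler_sum => i _; apply: (le_trans (hK0 i)).
      rewrite -/(ratio i (K0 i)) -sum_test_norm.
      rewrite -(big_mkord xpredT (fun k => test_norm i k / cnorm i k)).
      have leN : (K0 i < N.+1)%N by rewrite ltnS; exact: (leq_bigmax i).
      rewrite (big_cat_nat _ leN)//= lerDl sumr_ge0// => k _.
      by rewrite divr_ge0// ltW.
    move=> [i k] _; rewrite T_test Normc.normcM normcJ normc_real ger0_norm//.
    rewrite nsq_test -/(cnorm i k) exprMn -mulrA; congr (_ * _).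
    have [->|nz] := eqVneq (test_norm i k) 0; first by rewrite expr0n/= !mul0r.
    by rewrite expr2 invfM mulrA mulrAC -mulrA [X in X * _]mulrC mulrA mulfK// mulrC.
  - by move=> x; exact: chain_A2.
  - by move=> x; exact: test_L2.
  - move=> [i k] [i' k'] ne /=; apply: test_pairwise_orthogonal.
    by apply: contraNN ne => /eqP[/val_inj -> /val_inj ->].
  - by move=> x; exact: cnorm0.
apply/eqP; rewrite -normc_eq0; apply/eqP/le_anti; rewrite normc_ge0 andbT leNgt.
apply/negP => c0.
have ct : 0 < normc c ^+ 2 * t by rewrite mulr_gt0// exprn_gt0.
have := bound (Num.truncn (S / (normc c ^+ 2 * t))).+1.
rewrite mulrCA -ler_pdivlMr// leNgt => /negP; apply.
exact: truncnS_gt.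
Qed.

End hankel_test.

(** * Uniqueness of holomorphic functions with given moments *)

Section moment_uniqueness.
Variables (R : realType) (n : nat) (D : set 'rV[R[i]]_n).
Local Notation Cn := 'rV[R[i]]_n.
Local Notation dV := (lebesgue_Cn R n).
Hypothesis mD : measurable D.
Hypothesis D_disc : D `<=` polydisc 0 1.
Hypothesis D_open : forall z, D z -> exists2 rho : R, 0 < rho & polydisc z rho `<=` D.
Let D_finite := D_fin mD D_disc.

Variable u : Cn -> R[i].
Hypotheses (u_hol : holomorphic D u) (u_int : cintegrable dV D u).
Hypothesis u_moments : forall a b : 'I_n -> nat,
  cint dV D (fun z => u z * (mono a z * (mono b z)^*)) = 0.

(** All the products of monomials and conjugate monomials are included, so that
    the class is stable under multiplication by coordinates and their
    conjugates. *)
Definition annihilated (q : Cn -> R[i]) :=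
  [/\ cmeas D q, exists B : R, forall z, D z -> normc (q z) <= B &
    forall a b, cint dV D (fun z => u z * (q z * (mono a z * (mono b z)^*))) = 0].

Let mono_pair_le1 a b z : D z -> normc (mono a z * (mono b z)^*) <= 1.
Proof.
move=> Dz; rewrite Normc.normcM normcJ -[leRHS]mulr1.
by apply: ler_pM; rewrite ?normc_ge0//; exact: (normc_mono_le1 D_disc).
Qed.

Let annihilated_integrable q a b : annihilated q ->
  cintegrable dV D (fun z => u z * (q z * (mono a z * (mono b z)^*))).
Proof.
move=> [mq [B hB] _]; apply: (cintegrable_mul_bounded mD u_int (B := B)).
  by apply: cmeasM => //; apply: cmeasM; [|apply: cmeasJ]; exact: cmeas_mono_on.
move=> z Dz; rewrite Normc.normcM -[leRHS]mulr1.
by apply: ler_pM; rewrite ?normc_ge0 ?hB// mono_pair_le1.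
Qed.

Lemma annihilated1 : annihilated (fun=> 1).
Proof.
split; [exact: cmeas_cst|by exists 1 => z _; rewrite Normc.normc1|].
by move=> a b; under eq_fun do rewrite mul1r; exact: u_moments.
Qed.

Lemma annihilatedD q1 q2 : annihilated q1 -> annihilated q2 ->
  annihilated (fun z => q1 z + q2 z).
Proof.
move=> h1 h2; have [m1 [B1 hB1] z1] := h1; have [m2 [B2 hB2] z2] := h2; split.
- exact: cmeasD.
- exists (B1 + B2) => z Dz; rewrite (le_trans (normcD_le _ _))// lerD ?hB1 ?hB2//.
- move=> a b; rewrite -[RHS]addr0 -[X in _ = X + _](z1 a b) -[X in _ = _ + X](z2 a b).
  rewrite -(cintD mD (annihilated_integrable a b h1) (annihilated_integrable a b h2)).
  by apply: eq_cint => z _; rewrite mulrDl mulrDr.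
Qed.

Lemma annihilatedZ c q : annihilated q -> annihilated (fun z => c * q z).
Proof.
move=> h; have [m [B hB] z0] := h; split.
- by apply: cmeasM => //; exact: cmeas_cst.
- by exists (normc c * B) => z Dz; rewrite Normc.normcM ler_wpM2l ?normc_ge0// hB.
- move=> a b; transitivity (c * 0 : R[i]); last by rewrite mulr0.
  rewrite -(z0 a b) -(cintZ mD _ (annihilated_integrable a b h)).
  by apply: eq_cint => z _; ring.
Qed.

Let succ_at (j : 'I_n) (a : 'I_n -> nat) x := ((x == j) + a x)%N.

Let mono_succ j a (z : Cn) : mono (succ_at j a) z = z ord0 j * mono a z.
Proof.
rewrite /mono (bigD1 j)//= [in RHS](bigD1 j)//= mulrA /succ_at eqxx exprS; congr (_ * _).
by apply: eq_bigr => x /negbTE ->; rewrite add0n.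
Qed.

Let coord_le1 (z : Cn) j : D z -> normc (z ord0 j) <= 1.
Proof. by move=> Dz; exact: ltW (D_coord_lt1 D_disc j Dz). Qed.

Let cmeas_coord_on j : cmeas D (fun z : Cn => z ord0 j).
Proof. exact: (cmeasS measurableT (@subsetT _ _) (@cmeas_coord R n j)). Qed.

Lemma annihilatedX j q : annihilated q -> annihilated (fun z => z ord0 j * q z).
Proof.
move=> [m [B hB] z0]; split.
- by apply: cmeasM.
- exists B => z Dz; rewrite Normc.normcM (le_trans _ (hB z Dz))// ler_piMl ?normc_ge0//.
  exact: coord_le1.
- move=> a b; rewrite -[RHS](z0 (succ_at j a) b).
  by apply: eq_cint => z _; rewrite mono_succ; ring.
Qed.

Lemma annihilatedXJ j q : annihilated q -> annihilated (fun z => (z ord0 j)^* * q z).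
Proof.
move=> [m [B hB] z0]; split.
- by apply: cmeasM => //; exact: cmeasJ.
- exists B => z Dz; rewrite Normc.normcM normcJ (le_trans _ (hB z Dz))// ler_piMl ?normc_ge0//.
  exact: coord_le1.
- move=> a b; rewrite -[RHS](z0 a (succ_at j b)).
  by apply: eq_cint => z _; rewrite mono_succ conjcM; ring.
Qed.

Section peak.
Variable w : Cn.

Definition sqdist (z : Cn) : R := \sum_j normc (z ord0 j - w ord0 j) ^+ 2.
Definition kappa : R := (4 * n.+1%:R)^-1.
(** A polynomial in the coordinates and their conjugates with its maximum [1] at
    [w]; [kappa] is small enough to keep it nonnegative on the unit polydisc. *)
Definition peak (z : Cn) : R := 1 - kappa * sqdist z.

Lemma annihilated_peak N : annihilated (fun z => (peak z ^+ N)%:C).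
Proof.
elim: N => [|N ih].
  by under eq_fun do rewrite expr0; exact: annihilated1.
have term j : annihilated (fun z => (normc (z ord0 j - w ord0 j) ^+ 2)%:C * (peak z ^+ N)%:C).
  have h1 := annihilatedXJ j ih.
  have h2 := annihilatedD h1 (annihilatedZ (- (w ord0 j)^*) ih).
  have h3 := annihilatedD (annihilatedX j h2) (annihilatedZ (- w ord0 j) h2).
  move: h3; congr annihilated; apply/funext => z.
  by rewrite -mulcJ rmorphB/=; ring.
have sumt (s : seq 'I_n) : annihilated (fun z => \sum_(j <- s) (normc (z ord0 j - w ord0 j) ^+ 2)%:C * (peak z ^+ N)%:C).
  elim: s => [|j s hs].
    move: (annihilatedZ 0 ih); congr annihilated; apply/funext => z.
    by rewrite big_nil mul0r.
  move: (annihilatedD (term j) hs); congr annihilated; apply/funext => z.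
  by rewrite big_cons.
move: (annihilatedD ih (annihilatedZ (- kappa%:C) (sumt (index_enum 'I_n)))).
congr annihilated; apply/funext => z.
rewrite -mulr_suml -rmorph_sum -/(sqdist z) exprS /peak mulrBl mul1r.
by rewrite rmorphB !rmorphM/= mulNr mulrA.
Qed.

Lemma kappa_gt0 : 0 < kappa.
Proof. by rewrite invr_gt0 mulr_gt0. Qed.

Lemma peak_ge0 z : D w -> D z -> 0 <= peak z.
Proof.
move=> Dw Dz; rewrite subr_ge0 /kappa mulrC ler_pdivrMr ?mulr_gt0// mul1r.
apply: (@le_trans _ _ (\sum_(j < n) 4)).
  apply: ler_sum => j _; have -> : (4 : R) = 2 ^+ 2 by ring.
  apply: lerXn2r; rewrite ?nnegrE ?normc_ge0//.
  apply: (le_trans (normcD_le _ _)); rewrite normcN.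
  by have := coord_le1 j Dw; have := coord_le1 j Dz; lra.
by rewrite sumr_const card_ord -[X in X <= _]mulr_natr ler_wpM2l// ler_nat.
Qed.

End peak.

Let bernoulli (e : R) N : 0 <= e -> 1 + N%:R * e <= (1 + e) ^+ N.
Proof.
move=> e0; elim: N => [|N ih]; first by rewrite mul0r addr0 expr0.
rewrite exprS; apply: (@le_trans _ _ ((1 + e) * (1 + N%:R * e))).
  rewrite -natr1; have : 0 <= N%:R * e * e by rewrite !mulr_ge0// ler0n.
  lra.
by rewrite ler_wpM2l// addr_ge0.
Qed.

Lemma holomorphic_near w (e : R) : D w -> 0 < e -> exists2 rho : R, 0 < rho &
  forall z, polydisc w rho z -> normc (u z - u w) < e.
Proof.
move=> Dw e0.
have cu : {for w, continuous u} by exact: differentiable_continuous (u_hol Dw).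
have ec0 : (0 : R[i]) < e%:C by rewrite ltcR.
have Fn : Filter (nbhs w) by exact: nbhs_filter.
have Fw : Filter (u x @[x --> w]) := fmap_filter _ Fn.
have /cvgrPdist_lt /(_ _ ec0) := cu.
rewrite near_simpl => /nbhs_ballP[d /= d0 hd].
have [dE d'0] : d = (complex.Re d)%:C /\ 0 < complex.Re d.
  by move: d0; case: (d) => x y; rewrite ltcE/= => /andP[/eqP-> ?].
exists (complex.Re d) => // z hz.
have /hd : ball w d z.
  split=> [|i j]; first exact: d0.
  rewrite /ball/= (ord1 i) dE normC_E ltcR -normcN opprB.
  exact: hz.
by rewrite /= normC_E ltcR -normcN opprB.
Qed.

(** Suppose [u w != 0]. Near [w] the real part [v] of [(u w)^* * u] is at least
    some [c > 0]. The powers of [peak w] integrate to [0] against [v]. They are at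
    least [q1 ^+ N] on a polydisc [B'] around [w], and at most [q0 ^+ N] with
    [q0 < q1] where [v] may be negative. So [c * V * q1 ^+ N <= A * q0 ^+ N] for all
    [N], with [V] the volume of [B'] and [A] the integral of [|v|], which is
    absurd. *)
Theorem moments_zero_eq0 w : D w -> u w = 0.
Proof.
move=> Dw; apply/eqP; rewrite -normc_eq0; apply/eqP/le_anti.
rewrite normc_ge0 andbT leNgt; apply/negP => uw0.
have [rho1 rho10 near1] := holomorphic_near Dw (divr_gt0 uw0 (ltr0n _ 2)).
have [rho2 rho20 inD] := D_open Dw.
pose rho := Num.min 1 (Num.min rho1 rho2).
have rho0 : 0 < rho by rewrite !lt_min ltr01 rho10 rho20.
have rho_le1 : rho <= 1 by rewrite ge_min lexx.
pose v z := complex.Re ((u w)^* * u z).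
pose c := normc (u w) ^+ 2 / 2.
have c0 : 0 < c by rewrite divr_gt0// exprn_gt0.
have subP (s t : R) z : s <= t -> polydisc w s z -> polydisc w t z.
  by move=> st hz j; apply: lt_le_trans st; exact: hz.
have vlow z : polydisc w rho z -> c <= v z.
  move=> hz; have hz1 : polydisc w rho1 z.
    by apply: subP hz; rewrite !ge_min lexx orbT.
  have := near1 z hz1 => h.
  have -> : v z = normc (u w) ^+ 2 + complex.Re ((u w)^* * (u z - u w)).
    by rewrite /v mulrBr [(u w)^* * u w]mulrC mulcJ cReB/=; ring.
  have := normRe_le ((u w)^* * (u z - u w)).
  rewrite Normc.normcM normcJ ler_norml => /andP[h1 _].
  have : normc (u w) * normc (u z - u w) <= normc (u w) * (normc (u w) / 2).
    by rewrite ler_wpM2l ?normc_ge0// ltW.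
  rewrite /c; move: h1; lra.
(* small enough for the sum of the squares of [n] distances less than [rho'] to be at most [rho ^+ 2 / 4] *)
pose rho' := rho / n.+1%:R.
have rho'0 : 0 < rho' by rewrite divr_gt0.
pose B' := polydisc w rho'.
have B'rho : B' `<=` polydisc w rho.
  move=> z; apply: subP; rewrite /rho' ler_pdivrMr// ler_peMr ?(ltW rho0)//.
  by rewrite ler1n.
have B'D : B' `<=` D.
  move=> z /B'rho hz; apply: inD; apply: subP hz.
  by rewrite !ge_min lexx !orbT.
have k0 := kappa_gt0.
have k4 : kappa <= 1 / 4.
  rewrite /kappa mul1r lef_pV2 ?posrE ?mulr_gt0//.
  by rewrite ler_peMr// ler1n.
pose q0 := 1 - kappa * rho ^+ 2; pose q1 := 1 - kappa * (rho ^+ 2 / 4).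
have r2 : 0 < rho ^+ 2 by rewrite exprn_gt0.
have r21 : rho ^+ 2 <= 1 by rewrite exprn_ile1// ltW.
have q00 : 0 < q0.
  have : kappa * rho ^+ 2 <= 1 / 4 * 1 by apply: ler_pM => //; exact: ltW.
  rewrite /q0; lra.
have q01 : q0 <= 1 by rewrite gerBl mulr_ge0// ltW.
pose dl := q1 - q0.
have dl0 : 0 < dl.
  have : 0 < kappa * rho ^+ 2 by rewrite mulr_gt0.
  rewrite /dl /q1 /q0; lra.
have peak_in z : B' z -> q1 <= peak w z.
  move=> hz; rewrite /q1 /peak lerD2l lerN2 ler_pM2l//.
  apply: (@le_trans _ _ (\sum_(j < n) rho' ^+ 2)).
    by apply: ler_sum => j _; apply: lerXn2r; rewrite ?nnegrE ?normc_ge0 ?(ltW rho'0)// ltW// hz.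
  rewrite sumr_const card_ord -[X in X <= _]mulr_natl /rho' exprMn mulrCA ler_pM2l//.
  rewrite exprVn ler_pdivrMr ?exprn_gt0//.
  have : 0 <= (n%:R - 1 : R) ^+ 2 by exact: sqr_ge0.
  rewrite -[n.+1%:R]natr1; move: (n%:R : R) => t; lra.
have peak_out z : ~ polydisc w rho z -> peak w z <= q0.
  move=> /existsNP[j /negP]; rewrite -leNgt => hj.
  rewrite /q0 /peak lerD2l lerN2 ler_pM2l// /sqdist (bigD1 j)//= -[leLHS]addr0.
  apply: lerD; first by apply: lerXn2r; rewrite ?nnegrE ?normc_ge0 ?(ltW rho0).
  by apply: sumr_ge0 => x _; exact: sqr_ge0.
have mB' : measurable B' by exact: measurable_polydisc.
pose V := fine (dV B').
have B'fin : (dV B' < +oo)%E.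
  by apply: le_lt_trans D_finite; apply: le_measure; rewrite ?inE.
have V0 : 0 < V by rewrite fine_gt0// lebesgue_Cn_polydisc_gt0.
have iwu : cintegrable dV D (fun z => (u w)^* * u z) := cintegrableZ mD _ u_int.
have iv : dV.-integrable D (EFin \o v) by case: iwu.
pose A := (\int[dV]_(z in D) `|v z|)%R.
have iav : dV.-integrable D (EFin \o (fun z => `|v z|)) := integrable_norm iv.
have iind : dV.-integrable D (EFin \o (fun z => \1_B' z : R)).
  apply: (le_integrable mD _ _ (integrable_cst_on mD D_disc 1)).
    by apply/measurable_EFinP; exact: measurable_indic.
  by move=> z _ /=; rewrite lee_fin normr1 ger0_norm// indicE; case: (_ \in _).
have Iind : (\int[dV]_(z in D) (\1_B' z : R))%R = V.
  by rewrite /Rintegral integral_indic// setIidl.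
have ReR (a : R[i]) (x : R) : complex.Re (a * x%:C) = complex.Re a * x.
  by case: a => a1 a2 /=; rewrite mulr0 subr0.
have key N : c * V * q1 ^+ N <= A * q0 ^+ N.
  have [_ _ /(_ (fun=> 0%N) (fun=> 0%N)) hN] := annihilated_peak w N.
  have zero : (\int[dV]_(z in D) (v z * peak w z ^+ N))%R = 0.
    have E : cint dV D (fun z => (u w)^* * (u z * (peak w z ^+ N)%:C)) = 0.
      have ih := annihilated_integrable (fun=> 0%N) (fun=> 0%N) (annihilated_peak w N).
      transitivity ((u w)^* * 0 : R[i]); last by rewrite mulr0.
      rewrite -hN -(cintZ mD _ ih); apply: eq_cint => z _; congr (_ * (_ * _)).
      by rewrite /mono !big1// conjc1 !mulr1.
    have : complex.Re (cint dV D (fun z => (u w)^* * (u z * (peak w z ^+ N)%:C))) = 0 by rewrite E.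
    move=> <-; rewrite /cint/=; apply: eq_Rintegral => z _.
    by rewrite mulrA ReR.
  have ivp : dV.-integrable D (EFin \o (fun z => v z * peak w z ^+ N)).
    have [mpk [B hB] _] := annihilated_peak w N.
    have [+ _] := cintegrable_mul_bounded mD iwu mpk hB.
    apply: eq_integrable => // z _ /=; congr (_%:E).
    by rewrite ReR.
  have ilow : dV.-integrable D (EFin \o (fun z => c * q1 ^+ N * \1_B' z - q0 ^+ N * `|v z|)).
    exact: (integrableB mD (integrableZl mD (c * q1 ^+ N) iind) (integrableZl mD (q0 ^+ N) iav)).
  have : (\int[dV]_(z in D) (c * q1 ^+ N * \1_B' z - q0 ^+ N * `|v z|))%R <= 0.
    rewrite -zero; apply: le_Rintegral => // z Dz.
    have pk0 := peak_ge0 Dw Dz.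
    have q0N : 0 <= q0 ^+ N * `|v z| by rewrite mulr_ge0// exprn_ge0// ltW.
    rewrite indicE; have [zB|zB] := boolP (z \in B').
      rewrite mulr1; have hz := set_mem zB.
      apply: (@le_trans _ _ (c * q1 ^+ N)); first by rewrite gerBl.
      have q10 : 0 <= q1 by rewrite (le_trans (ltW q00))// -subr_ge0 ltW.
      apply: ler_pM; rewrite ?exprn_ge0 ?(ltW c0)//; first exact/vlow/B'rho.
      by apply: lerXn2r; rewrite ?nnegrE// peak_in.
    rewrite mulr0 sub0r; have [hz|hz] := pselect (polydisc w rho z).
      apply: (@le_trans _ _ 0); first by rewrite oppr_le0.
      by rewrite mulr_ge0 ?exprn_ge0// (le_trans (ltW c0))// vlow.
    rewrite lerNl (le_trans (ler_norm _))// normrN normrM mulrC ler_wpM2r//.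
    rewrite ger0_norm ?exprn_ge0//; apply: lerXn2r; rewrite ?nnegrE ?(ltW q00)//.
    exact: peak_out.
  rewrite (RintegralB mD (integrableZl mD (c * q1 ^+ N) iind) (integrableZl mD (q0 ^+ N) iav)).
  rewrite (RintegralZl _ mD iind) (RintegralZl _ mD iav) Iind -/A subr_le0.
  by rewrite mulrAC [q0 ^+ N * A]mulrC.
have main N : c * V * (N%:R * dl) <= A.
  have qN : q0 ^+ N * (1 + dl) ^+ N <= q1 ^+ N.
    rewrite -exprMn; apply: lerXn2r; rewrite ?nnegrE.
    - by rewrite mulr_ge0 ?(ltW q00)// addr_ge0// ltW.
    - by rewrite (le_trans (ltW q00))// -subr_ge0 ltW.
    - have : q0 * dl <= 1 * dl by rewrite ler_wpM2r// ltW.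
      by rewrite /dl; lra.
  have q0N : 0 < q0 ^+ N by rewrite exprn_gt0.
  have cV : 0 < c * V by rewrite mulr_gt0.
  rewrite -(ler_pM2r q0N); apply: le_trans (key N).
  have -> : c * V * (N%:R * dl) * q0 ^+ N = c * V * (N%:R * dl * q0 ^+ N) by ring.
  rewrite ler_pM2l//; apply: le_trans qN; rewrite mulrC ler_pM2l//.
  by apply: le_trans (bernoulli N (ltW dl0)); rewrite lerDr.
have cVd : 0 < c * V * dl by rewrite !mulr_gt0.
have := main (Num.truncn (A / (c * V * dl))).+1.
rewrite mulrCA -ler_pdivlMr// leNgt => /negP; apply.
exact: truncnS_gt.
Qed.

End moment_uniqueness.

(** * Reinhardt domains and ellipsoids *)

Section reinhardt_theorem.
Variables (R : realType) (n : nat) (D : set 'rV[R[i]]_n).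
Local Notation Cn := 'rV[R[i]]_n.
Local Notation dV := (lebesgue_Cn R n).
Hypotheses (n_ge2 : (2 <= n)%N) (mD : measurable D) (D_complete : complete_reinhardt D).
Hypothesis D_disc : D `<=` polydisc 0 1.
Hypothesis D_open : forall z, D z -> exists2 rho : R, 0 < rho & polydisc z rho `<=` D.

(** All Taylor coefficients but the constant one vanish by [hankel_coef_eq0], so
    [f - c] satisfies the hypothesis of [moments_zero_eq0]: a product
    [mono a * (mono b)^*] is either of positive degree in some variable, or the
    conjugate of a monomial times a radial weight. *)
Theorem reinhardt_hankel_constant f : bergman_space D f -> hankel_hilbert_schmidt D f ->
  exists c : R[i], forall z, D z -> f z = c.
Proof.
move=> f_A2 f_HS; have [[w Dw]|noD] := pselect (exists w, D w); last first.
  by exists 0 => z Dz; exfalso; apply: noD; exists z.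
have D0 : D 0 by apply: D_complete Dw _ => j; rewrite mxE Normc.normc0 normc_ge0.
have [r r0 rD] := D_open D0.
have D_pos := reinhardt_pos mD r0 rD.
have [f_hol Lf] := f_A2; have f_meas : cmeas D f by case: Lf.
have f_int := L2_integrable mD D_disc Lf.
have moment d := weighted_moment mD D_complete D_disc D_pos f_hol f_meas f_int d.
have coef0 d c : (exists j, d j != 0%N) -> taylor_coef D f d c -> c = 0.
  move=> [j dj] hc.
  (* a second variable: this uses that [n] is at least [2] *)
  have [l lj] : exists l : 'I_n, l != j.
    have [/eqP j0|j0] := boolP (val j == 0%N).
      by exists (Ordinal n_ge2); rewrite -val_eqE /= j0.
    by exists (Ordinal (ltnW n_ge2)); rewrite -val_eqE /= eq_sym.
  have dj0 : (0 < d j)%N by rewrite lt0n.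
  exact: (hankel_coef_eq0 mD D_complete D_disc r0 rD dj0 lj f_A2 f_HS hc).
have [c hc] := moment (fun=> 0%N).
exists c => z Dz; apply/eqP; rewrite -subr_eq0; apply/eqP.
have cA2 : bergman_space D (fun z => f z - c).
  apply: bergmanB => //.
  have := bergman_lin mD c (bergman_mono mD D_disc (fun=> 0%N)) (bergman0 mD).
  by under eq_fun do rewrite /mono big1// mulr1 addr0.
have [u_hol Lu] := cA2; have u_meas : cmeas D (fun z => f z - c) by case: Lu.
have u_int := L2_integrable mD D_disc Lu.
have mpair a b : cmeas D (fun z => mono a z * (mono b z)^* : R[i]).
  by apply: cmeasM; [|apply: cmeasJ]; exact: cmeas_mono_on.
have bpair a b (x : Cn) : D x -> normc (mono a x * (mono b x)^*) <= 1.
  move=> Dx; rewrite Normc.normcM normcJ -[leRHS]mulr1.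
  by apply: ler_pM; rewrite ?normc_ge0//; exact: (normc_mono_le1 D_disc).
have pair_rot a b j y (x : Cn) : mono a (cmul (dilation j (cis y)) x) * (mono b (cmul (dilation j (cis y)) x))^* =
    cis y ^+ a j * (cis y)^* ^+ b j * (mono a x * (mono b x)^*) :> R[i].
  by rewrite !mono_cmul !mono_dilation conjcM conjcX; ring.
apply: (moments_zero_eq0 mD D_disc D_open u_hol u_int) => // a b.
have [[j abj]|le_ab] := pselect (exists j, (b j < a j)%N).
  apply: (vanishing_moment mD D_complete D_disc u_hol u_meas u_int (j := j) (k := (a j - b j)%N) (B := 1)) => //.
  - by rewrite subn_gt0.
  - exact: bpair.
  - move=> y x; rewrite pair_rot; congr (_ * _).
    rewrite -{1}(subnK (ltnW abj)) exprD -mulrA -exprMn [cis y * _]mulrC cisJ.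
    by rewrite expr1n mulr1.
have {}le_ab j : (a j <= b j)%N by rewrite leqNgt; apply/negP => h; apply: le_ab; exists j.
pose d j := (b j - a j)%N; pose psi x : R[i] := (normc (mono a x) ^+ 2)%:C.
have pairE x : mono a x * (mono b x)^* = (mono d x)^* * psi x.
  have -> : mono b x = mono d x * mono a x.
    rewrite /mono -big_split; apply: eq_bigr => j _ /=.
    by rewrite -exprD subnK.
  by rewrite conjcM /psi -mulcJ; ring.
have mpsi : cmeas D psi by apply: cmeas_real; apply: cmeas_sqr_normc; exact: cmeas_mono_on.
have bpsi x : D x -> normc (psi x) <= 1.
  move=> Dx; rewrite normc_real ger0_norm ?sqr_ge0// exprn_ile1 ?normc_ge0//.
  exact: (normc_mono_le1 D_disc).
have rpsi : rotation_invariant psi by move=> v x v1; rewrite /psi normc_mono_rot.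
have ifp : cintegrable dV D (fun x => f x * (mono a x * (mono b x)^*)).
  by apply: (cintegrable_mul_bounded mD f_int (B := 1)) => //; exact: bpair.
have ip : cintegrable dV D (fun x => mono a x * (mono b x)^*).
  by apply: (cintegrable_bounded mD (D_fin mD D_disc) _ (B := 1)) => //; exact: bpair.
transitivity (cint dV D (fun x => f x * (mono a x * (mono b x)^*)) -
    c * cint dV D (fun x => mono a x * (mono b x)^*)).
  rewrite -(cintZ mD _ ip) -(cintB mD ifp (cintegrableZ mD _ ip)).
  by apply: eq_cint => x _; rewrite mulrBl.
have [d0|[j dj]] : d = (fun=> 0%N) \/ exists j, d j != 0%N.
  have [?|] := pselect (exists j, d j != 0%N); first by right.
  by move=> /forallNP h; left; apply/funext => j; apply/eqP/negP => /negP; exact: h.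
- transitivity (cint dV D (fun x => f x * ((mono (fun=> 0%N) x)^* * psi x)) -
     c * cint dV D (fun x => (normc (mono (fun=> 0%N) x : R[i]) ^+ 2)%:C * psi x)).
    congr (_ - c * _); apply: eq_cint => x _; rewrite pairE d0//.
    by rewrite /mono big1// conjc1 Normc.normc1 expr1n.
  by rewrite (hc psi 1)// subrr.
- have [c' hc'] := moment d.
  have c'0 : c' = 0 by apply: (coef0 d) => //; exists j.
  have -> : cint dV D (fun x => f x * (mono a x * (mono b x)^*)) = 0.
    rewrite -[RHS](mul0r (cint dV D (fun z => (normc (mono d z) ^+ 2)%:C * psi z))) -c'0 -(hc' psi 1)//.
    by apply: eq_cint => x _; rewrite pairE.
  have -> : cint dV D (fun x => mono a x * (mono b x)^*) = 0.
    apply: (cint_weight_eq0 mD D_complete ip (j := j) (a := a j) (b := b j)).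
      by move=> y x; exact: pair_rot.
    by move: dj; rewrite /d subn_eq0 -ltnNge => /ltn_eqF ->.
  by rewrite mulr0 subrr.
Qed.

End reinhardt_theorem.

Section ellipsoid.
Variables (R : realType) (n : nat) (m : 'I_n -> R).
Hypothesis m_gt0 : forall j, 0 < m j.
Local Notation Cn := 'rV[R[i]]_n.

Let e_gt0 j : 0 < 2 * m j. Proof. by rewrite mulr_gt0. Qed.

Lemma measurable_ellipsoid : measurable (ellipsoid m).
Proof.
pose S (s : seq 'I_n) (z : Cn) := \sum_(j <- s) normc (z ord0 j) `^ (2 * m j).
have mS s : measurable_fun setT (S s).
  elim: s => [|j s ih]; rewrite /S.
    by under eq_fun do rewrite big_nil; exact: measurable_cst.
  under eq_fun do rewrite big_cons; apply: measurable_funD => //.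
  apply: (measurableT_comp (@measurable_powR R (2 * m j))).
  by apply: cmeas_normc; exact: cmeas_coord.
rewrite (_ : ellipsoid m = S (index_enum 'I_n) @^-1` `]-oo, 1[).
  by rewrite -[X in measurable X]setTI; apply: mS.
by apply/seteqP; split => z; rewrite /= in_itv.
Qed.

Lemma ellipsoid_complete : complete_reinhardt (ellipsoid m).
Proof.
move=> z w /= hz wz; apply: le_lt_trans hz; apply: ler_sum => j _.
by apply: ge0_ler_powR; rewrite ?nnegrE ?normc_ge0// ltW.
Qed.

Lemma ellipsoid_disc : ellipsoid m `<=` polydisc 0 1.
Proof.
move=> z /= hz j; rewrite mxE subr0 ltNge; apply/negP => z1.
have : 1 <= normc (z ord0 j) `^ (2 * m j).
  have e1 : (1 : R) `^ (2 * m j) = 1 by rewrite powR1.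
  rewrite -{1}e1; apply: ge0_ler_powR; rewrite ?nnegrE ?normc_ge0//.
  exact: ltW.
apply/negP; rewrite -ltNge; apply: le_lt_trans hz.
by rewrite (bigD1 j)//= lerDl sumr_ge0// => i _; exact: powR_ge0.
Qed.

Let powR_upper (x p e : R) : 0 <= x -> 0 < p -> 0 < e -> exists2 rho : R, 0 < rho &
  forall y, 0 <= y -> y < x + rho -> y `^ p <= x `^ p + e.
Proof.
move=> x0 p0 e0; pose Y := (x `^ p + e) `^ p^-1.
have xp0 : 0 <= x `^ p by exact: powR_ge0.
have YE : Y `^ p = x `^ p + e by rewrite /Y -powRrM mulVf ?gt_eqF// powRr1// addr_ge0// ltW.
have Y0 : 0 <= Y by exact: powR_ge0.
have xY : x < Y.
  rewrite ltNge; apply/negP => h.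
  have : Y `^ p <= x `^ p by apply: ge0_ler_powR; rewrite ?nnegrE// ltW.
  by rewrite YE gerDl leNgt e0.
exists (Y - x); first by rewrite subr_gt0.
move=> y y0; rewrite addrC subrK => yY; rewrite -YE.
by apply: ge0_ler_powR; rewrite ?nnegrE// ltW.
Qed.

Lemma ellipsoid_open (z : Cn) : ellipsoid m z ->
  exists2 rho : R, 0 < rho & polydisc z rho `<=` ellipsoid m.
Proof.
rewrite /ellipsoid/= => hz; set s := \sum_(j < n) _ in hz.
(* with [n.+1] and not [n] the [n] errors add up to less than [1 - s] *)
pose e := (1 - s) / n.+1%:R.
have e0 : 0 < e by rewrite divr_gt0// subr_gt0.
have step j : exists rho : R, 0 < rho /\ forall y, 0 <= y -> y < normc (z ord0 j) + rho ->
    y `^ (2 * m j) <= normc (z ord0 j) `^ (2 * m j) + e.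
  by have [rho r0 h] := powR_upper (normc_ge0 (z ord0 j)) (e_gt0 j) e0; exists rho.
have [rho hrho] := choice step.
have [r r0 hr] : exists2 r : R, 0 < r & forall j, j \in index_enum 'I_n -> r <= rho j.
  elim: (index_enum 'I_n) => [|j t [r r0 hr]]; first by exists 1.
  exists (Num.min r (rho j)); first by rewrite lt_min r0; case: (hrho j).
  move=> i; rewrite in_cons => /orP[/eqP ->|/hr]; first by rewrite ge_min lexx orbT.
  by rewrite ge_min => ->.
exists r => // w hw; apply: (@le_lt_trans _ _ (\sum_(j < n) (normc (z ord0 j) `^ (2 * m j) + e))).
  apply: ler_sum => j _; have [_ h] := hrho j; apply: h; first exact: normc_ge0.
  have := normcD_le (w ord0 j - z ord0 j) (z ord0 j); rewrite subrK.
  have := hw j; have := hr j (mem_index_enum j); lra.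
rewrite big_split/= -/s sumr_const card_ord -[X in _ + X]mulr_natl /e.
rewrite mulrCA -ltrBrDl gtr_pMr ?subr_gt0// ltr_pdivrMr// mul1r ltr_nat//.
Qed.

End ellipsoid.

Theorem theorem1 (R : realType) (n : nat) (n_ge2 : (2 <= n)%N)
    (m : 'I_n -> R) (m_gt0 : forall j, 0 < m j)
    (f : 'rV[R[i]]_n -> R[i])
    (f_A2 : bergman_space (ellipsoid m) f)
    (Hf_HS : hankel_hilbert_schmidt (ellipsoid m) f) :
  exists c : R[i], forall z, ellipsoid m z -> f z = c.
Proof.
apply: (reinhardt_hankel_constant n_ge2 (measurable_ellipsoid m)
  (ellipsoid_complete m_gt0) (ellipsoid_disc m_gt0) _ f_A2 Hf_HS) => z.
exact: ellipsoid_open.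
Qed.
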